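(* Let $G=\mathbb{T}\times\mathbb{R}^n\times V\times H$ be a translation complete subgroup of $G_{aWH}$ and let $\psi,f\in L^2(\mathbb{R}^n)$. Then $$\|V_\psi f\|_{L^2(G)}^2=\int_{\mathbb{R}^n}|\widehat f(\omega)|^2\int_V\int_H|\widehat\psi(h^T(\omega-\xi))|^2\,|\det(h^T|_V)|\,dh\,d\xi\,d\omega,$$ in the extended sense that one side is infinite if and only if the other one is. Equivalently, defining $$\Phi_\psi(\omega):=\int_V\int_H|\widehat\psi(h^T(\omega-\xi))|^2\,|\det(h^T|_V)|\,dh\,d\xi\in[0,\infty],$$ one has $$\|V_\psi f\|_{L^2(G)}^2=\int_{\mathbb{R}^n}|\widehat f(\omega)|^2\,\Phi_\psi(\omega)\,d\omega,$$ again including the case that both sides are infinite.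
   Context: The dual group $\widehat{\mathbb{R}^n}$ is identified with $\mathbb{R}^n$ (column vectors) by associating to $\xi$ the character $x\mapsto e^{2\pi i\langle x,\xi\rangle}$; $\widehat f$ denotes the Fourier--Plancherel transform, $\widehat f(\gamma)=\int f(x)e^{-2\pi i\langle\gamma,x\rangle}dx$. The affine Weyl-Heisenberg group is $G_{aWH}=\mathbb{T}\times\mathbb{R}^n\times\widehat{\mathbb{R}^n}\times\mathrm{GL}(n,\mathbb{R})$ with the product topology and group law $(z_1,x_1,\xi_1,h_1)(z_2,x_2,\xi_2,h_2)=(z_1z_2e^{2\pi i\langle\xi_1,h_1x_2\rangle},\,x_1+h_1x_2,\,\xi_1+h_1^{-T}\xi_2,\,h_1h_2)$, where $h^{-T}=(h^{-1})^T$. Its quasi-regular representation on $L^2(\mathbb{R}^n)$ is $\pi(z,x,\xi,h)=zT_xM_\xi D_h$, where $T_xf(y)=f(y-x)$, $M_\xi f(y)=e^{2\pi i\langle y,\xi\rangle}f(y)$, $D_hf(y)=|\det h|^{-1/2}f(h^{-1}y)$. A translation complete subgroup is a subgroup of the form $G=\mathbb{T}\times\mathbb{R}^n\times V\times H$, where $V\subset\widehat{\mathbb{R}^n}$ is a linear subspace, $H$ is a closed subgroup of $\mathrm{GL}(n,\mathbb{R})$, and $h^TV\subset V$ for all $h\in H$. Its left Haar measure is $|\det(h^T|_V)|\,dz\,dx\,d\xi\,\frac{dh}{|\det h|}$, where $dz$ is normalized Haar measure on $\mathbb{T}$, $dx,d\xi$ are Lebesgue measures on $\mathbb{R}^n$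 and $V$, $dh$ is left Haar measure on $H$, and $h^T|_V:V\to V$ is the restriction. The generalized wavelet transform is $V_\psi f(\mathbf{x})=\langle f,\pi(\mathbf{x})\psi\rangle$, $\mathbf{x}\in G$. *)

(* Defs.v *)
From HB Require Import structures.
From mathcomp Require Import all_boot all_order all_algebra.
From mathcomp Require Import complex.
From mathcomp Require Import all_classical all_reals all_analysis measurable_realfun.

Set Implicit Arguments.
Unset Strict Implicit.
Unset Printing Implicit Defensive.

Import Order.TTheory GRing.Theory Num.Theory.
Import numFieldNormedType.Exports.

Local Open Scope classical_set_scope.
Local Open Scope ring_scope.

(* Borel sigma-algebras: on matrices over R it is generated by the entries, on
   R[i] by the real and imaginary parts. *)

Section matrix_measurable.
Context (R : realType) (m n : nat).

Definition mx_cylinder : set (set 'M[R]_(m, n)) :=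
  \bigcup_(ij in [set: 'I_m * 'I_n])
    preimage_set_system setT (fun M : 'M[R]_(m, n) => M ij.1 ij.2) measurable.

Let mx0 : <<s mx_cylinder >> set0.
Proof. exact: sigma_algebra0. Qed.

Let mxC A : <<s mx_cylinder >> A -> <<s mx_cylinder >> (~` A).
Proof. exact: sigma_algebraC. Qed.

Let mx_bigcup (F : (set 'M[R]_(m, n))^nat) :
  (forall k, <<s mx_cylinder >> (F k)) -> <<s mx_cylinder >> (\bigcup_k F k).
Proof. exact: sigma_algebra_bigcup. Qed.

HB.instance Definition _ := @isMeasurable.Build default_measure_display
  'M[R]_(m, n) <<s mx_cylinder >> mx0 mxC mx_bigcup.

End matrix_measurable.

Section complex_measurable.
Context (R : realType).

HB.instance Definition _ := isPointed.Build R[i] 0.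

Definition complex_cylinder : set (set R[i]) :=
  preimage_set_system setT (@complex.Re R) measurable `|`
  preimage_set_system setT (@complex.Im R) measurable.

Let complex0 : <<s complex_cylinder >> set0.
Proof. exact: sigma_algebra0. Qed.

Let complexC A : <<s complex_cylinder >> A -> <<s complex_cylinder >> (~` A).
Proof. exact: sigma_algebraC. Qed.

Let complex_bigcup (F : (set R[i])^nat) :
  (forall k, <<s complex_cylinder >> (F k)) -> <<s complex_cylinder >> (\bigcup_k F k).
Proof. exact: sigma_algebra_bigcup. Qed.

HB.instance Definition _ := @isMeasurable.Build default_measure_display
  R[i] <<s complex_cylinder >> complex0 complexC complex_bigcup.

End complex_measurable.

Section measurability.
Context d (T : measurableType d) (R : realType).

Lemma measurable_entry m n (i : 'I_m) (j : 'I_n) :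
  measurable_fun setT (fun M : 'M[R]_(m, n) => M i j).
Proof. by move=> _ Y mY; apply: sub_sigma_algebra; exists (i, j) => //; exists Y. Qed.

Lemma measurable_fun_mx m n (f : T -> 'M[R]_(m, n)) :
  (forall i j, measurable_fun setT (fun x => f x i j)) -> measurable_fun setT f.
Proof.
move=> mf; apply: (@measurability _ _ _ _ _ _ (@mx_cylinder R m n)) => //.
move=> _ [_ [[i j] _ [B mB <-]] <-] /=.
by rewrite !setTI; have := mf i j measurableT B mB; rewrite setTI.
Qed.

Lemma measurable_fun_complex (f : T -> R[i]) :
  measurable_fun setT (fun x => complex.Re (f x)) ->
  measurable_fun setT (fun x => complex.Im (f x)) -> measurable_fun setT f.
Proof.
move=> mr mi; apply: (@measurability _ _ _ _ _ _ (@complex_cylinder R)) => //.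
move=> _ [_ [] [B mB <-] <-] /=; rewrite !setTI.
  by have := mr measurableT B mB; rewrite setTI.
by have := mi measurableT B mB; rewrite setTI.
Qed.

End measurability.

Lemma sigma_finite_pushforward d1 d2 (T1 : measurableType d1)
    (T2 : measurableType d2) (R : realType)
    (mu : set T1 -> \bar R) (f : T1 -> T2) (g : T2 -> T1) :
  measurable_fun setT g -> cancel f g -> sigma_finite setT mu ->
  sigma_finite setT (pushforward mu f).
Proof.
move=> mg fK [F FT Ffin].
exists (fun k => g @^-1` F k) => [|k]; first by rewrite -preimage_bigcup -FT.
split; first by rewrite -[X in measurable X]setTI; apply: mg => //; case: (Ffin k).
rewrite /pushforward -comp_preimage (_ : g \o f = id); first by case: (Ffin k).
exact/funext.
Qed.

Lemma sigma_finite_product d1 d2 (T1 : measurableType d1)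
    (T2 : measurableType d2) (R : realType)
    (m1 : {sigma_finite_measure set T1 -> \bar R})
    (m2 : {sigma_finite_measure set T2 -> \bar R}) :
  sigma_finite setT (m1 \x m2)%E.
Proof.
have /sigma_finiteP[F [FT ndF Ffin]] := sigma_finiteT m1.
have /sigma_finiteP[G [GT ndG Gfin]] := sigma_finiteT m2.
exists (fun k => F k `*` G k).
  apply/seteqP; split=> // -[x y] _.
  have [i _ Fi] : (\bigcup_i F i) x by rewrite -FT.
  have [j _ Gj] : (\bigcup_i G i) y by rewrite -GT.
  exists (maxn i j) => //; split => /=.
    by move: x Fi; exact/subsetPset/ndF/leq_maxl.
  by move: y Gj; exact/subsetPset/ndG/leq_maxr.
move=> k; have [mF ?] := Ffin k; have [mG ?] := Gfin k; split.
  exact: measurableX.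
by rewrite product_measure1E// lte_mul_pinfty// ge0_fin_numE.
Qed.

(* Lebesgue measure on R^n: the unit point mass for n = 0, and the product of
   the one-dimensional measure with Lebesgue measure on R^n for n + 1. *)

Section lebesgue_cV.
Context {R : realType}.

Definition cons_cV n (p : measurableTypeR R * 'cV[R]_n) : 'cV[R]_n.+1 :=
  \col_i oapp (fun j => p.2 j 0) p.1 (unlift ord0 i).

Lemma measurable_cons_cV n : measurable_fun setT (@cons_cV n).
Proof.
apply: measurable_fun_mx => i j.
rewrite (_ : (fun x => _) =
    fun p : measurableTypeR R * 'cV[R]_n =>
      oapp (fun k => p.2 k 0) p.1 (unlift ord0 i)); last first.
  by apply/funext => p; rewrite mxE.
case: unlift => [k|] /=; last exact: measurable_fst.
exact: (measurableT_comp (measurable_entry k 0) measurable_snd).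
Qed.

Definition uncons_cV n (v : 'cV[R]_n.+1) : measurableTypeR R * 'cV[R]_n :=
  (v ord0 0, \col_i v (lift ord0 i) 0).

Lemma measurable_uncons_cV n : measurable_fun setT (@uncons_cV n).
Proof.
apply: measurable_fun_pair; first exact: measurable_entry.
apply: measurable_fun_mx => i j.
rewrite (_ : (fun x => _) = fun v : 'cV[R]_n.+1 => v (lift ord0 i) 0).
  exact: measurable_entry.
by apply/funext => v; rewrite mxE.
Qed.

Lemma cons_cVK n : cancel (@cons_cV n) (@uncons_cV n).
Proof.
case=> x v; rewrite /uncons_cV mxE unlift_none /=; congr pair.
by apply/colP => i; rewrite !mxE liftK.
Qed.

HB.instance Definition _ n :=
  isMeasurableFun.Build _ _ _ _ (@cons_cV n) (@measurable_cons_cV n).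

Section lebesgue_cV_step.
Context n (mu : {sigma_finite_measure set 'cV[R]_n -> \bar R}).

Definition lebesgue_cV_step : set 'cV[R]_n.+1 -> \bar R :=
  pushforward (@lebesgue_measure R \x mu)%E (@cons_cV n).

Let step0 : lebesgue_cV_step set0 = 0%E.
Proof. by rewrite /lebesgue_cV_step; exact: measure0. Qed.

Let step_ge0 A : (0 <= lebesgue_cV_step A)%E.
Proof. exact: measure_ge0. Qed.

Let step_additive : semi_sigma_additive lebesgue_cV_step.
Proof. exact: measure_semi_sigma_additive. Qed.

HB.instance Definition _ := isMeasure.Build _ _ _ lebesgue_cV_step
  step0 step_ge0 step_additive.

Let step_sigma_finite : sigma_finite setT lebesgue_cV_step.
Proof.
apply: sigma_finite_pushforward (@measurable_uncons_cV n) (@cons_cVK n) _.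
exact: sigma_finite_product.
Qed.

HB.instance Definition _ := Measure_isSigmaFinite.Build _ _ _ lebesgue_cV_step
  step_sigma_finite.

End lebesgue_cV_step.

Fixpoint lebesgue_cV n : {sigma_finite_measure set 'cV[R]_n -> \bar R} :=
  if n is n'.+1 then lebesgue_cV_step (lebesgue_cV n') else \d_(0 : 'cV[R]_0).

End lebesgue_cV.

Section euclidean.
Context {R : realType} {n : nat}.
Implicit Types (V : {vspace 'cV[R]_n}) (h : 'M[R]_n).

Definition dotp (u v : 'cV[R]_n) : R := \sum_i u i 0 * v i 0.

Definition vs_comb V (c : 'cV[R]_(\dim V)) : 'cV[R]_n :=
  \sum_i c i 0 *: (vbasis V)`_i.

Definition vs_coord V (v : 'cV[R]_n) : 'cV[R]_(\dim V) :=
  \col_i coord (vbasis V) i v.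

Definition gram V : 'M[R]_(\dim V) :=
  \matrix_(i, j) dotp (vbasis V)`_i (vbasis V)`_j.

Lemma measurable_vs_comb V : measurable_fun setT (@vs_comb V).
Proof.
apply: measurable_fun_mx => i j.
rewrite (_ : (fun x => _) = fun c : 'cV[R]_(\dim V) =>
    \sum_(k < \dim V) c k 0 * ((vbasis V)`_k i j)); last first.
  by apply/funext => c; rewrite /vs_comb summxE; apply: eq_bigr => k _; rewrite mxE.
apply: measurable_sum => k.
by apply: measurable_funM => //; exact: measurable_entry.
Qed.

Lemma measurable_vs_coord V : measurable_fun setT (vs_coord V).
Proof.
apply: measurable_fun_mx => i j.
rewrite (_ : (fun x => _) = fun v : 'cV[R]_n =>
    \sum_(k < n) v k 0 * coord (vbasis V) i (delta_mx k 0)); last first.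
  apply/funext => v; rewrite mxE {1}(matrix_sum_delta v).
  under eq_bigr do rewrite big_ord1.
  by rewrite linear_sum; apply: eq_bigr => k _; rewrite linearZ.
apply: measurable_sum => k.
by apply: measurable_funM => //; exact: measurable_entry.
Qed.

Lemma vs_combK V : cancel (@vs_comb V) (vs_coord V).
Proof.
move=> c; apply/colP => i; rewrite mxE /vs_comb coord_sum_free //.
exact: basis_free (vbasisP V).
Qed.

HB.instance Definition _ V :=
  isMeasurableFun.Build _ _ _ _ (@vs_comb V) (@measurable_vs_comb V).

Definition vs_image V : set 'cV[R]_n -> \bar R :=
  pushforward (lebesgue_cV (\dim V)) (@vs_comb V).

Let vs_image0 V : vs_image V set0 = 0%E.
Proof. by rewrite /vs_image; exact: measure0. Qed.

Let vs_image_ge0 V A : (0 <= vs_image V A)%E.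
Proof. exact: measure_ge0. Qed.

Let vs_image_additive V : semi_sigma_additive (vs_image V).
Proof. exact: measure_semi_sigma_additive. Qed.

HB.instance Definition _ V := isMeasure.Build _ _ _ (vs_image V)
  (vs_image0 V) (@vs_image_ge0 V) (@vs_image_additive V).

(* Lebesgue measure of the subspace V, as a measure on R^n carried by V: the
   factor sqrt (det Gram) makes it independent of the chosen basis of V, and
   equal to the image of Lebesgue measure under any orthonormal basis. *)
Definition lebesgue_vs V : set 'cV[R]_n -> \bar R :=
  mscale (NngNum (sqrtr_ge0 (\det (gram V)))) (vs_image V).

HB.instance Definition _ V := Measure.on (lebesgue_vs V).

Let lebesgue_vs_sigma_finite V : sigma_finite setT (lebesgue_vs V).
Proof.
have [F FT Ffin] := sigma_finite_pushforward (@measurable_vs_coord V)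
  (@vs_combK V) (sigma_finiteT (lebesgue_cV (\dim V))).
exists F => // k; have [mF Fk] := Ffin k; split => //.
by rewrite /lebesgue_vs /mscale lte_mul_pinfty// ?lee_fin.
Qed.

HB.instance Definition _ V := Measure_isSigmaFinite.Build _ _ _ (lebesgue_vs V)
  (lebesgue_vs_sigma_finite V).

End euclidean.

Section fourier.
Context {R : realType} {n : nat}.
Implicit Types (f g : 'cV[R]_n -> R[i]).

Definition cis (t : R) : R[i] := (cos (2 * pi * t) +i* sin (2 * pi * t))%C.

Definition cintegral f : R[i] :=
  ((\int[lebesgue_cV n]_x complex.Re (f x)) +i*
   (\int[lebesgue_cV n]_x complex.Im (f x)))%C.

Definition inner f g : R[i] := cintegral (fun x => f x * conjc (g x)).

Definition sqnorm f : \bar R := (\int[lebesgue_cV n]_x (Normc.normc (f x) ^+ 2)%:E)%E.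

Definition L1 : set ('cV[R]_n -> R[i]) :=
  [set f | measurable_fun setT f /\
           (\int[lebesgue_cV n]_x (Normc.normc (f x))%:E < +oo)%E].

Definition L2 : set ('cV[R]_n -> R[i]) :=
  [set f | measurable_fun setT f /\ (sqnorm f < +oo)%E].

Definition fourier f : 'cV[R]_n -> R[i] :=
  fun gamma => cintegral (fun x => f x * cis (- dotp gamma x)).

(* The graph of the Fourier-Plancherel transform: the L2-closure of the graph
   of the Fourier transform on L1 `&` L2. *)
Definition is_plancherel f g :=
  L2 g /\
  exists u : nat -> 'cV[R]_n -> R[i],
    [/\ forall k, L1 (u k) /\ L2 (u k),
        sqnorm (fun x => u k x - f x) @[k --> \oo] --> 0%E &
        sqnorm (fun x => fourier (u k) x - g x) @[k --> \oo] --> 0%E].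

(* A representative of the Fourier-Plancherel transform of the class of f; for
   f in L2 the set is nonempty and any two of its elements agree a.e., so the
   default value 0 is used only outside L2. *)
Definition plancherel f : 'cV[R]_n -> R[i] :=
  xget (fun=> 0) [set g | is_plancherel f g].

End fourier.

Definition subgroup T (mul : T -> T -> T) (one : T) (G : set T) :=
  [/\ G one,
      forall a b, G a -> G b -> G (mul a b) &
      forall a, G a -> exists2 b, G b & mul a b = one /\ mul b a = one].

Section circle_haar.
Context {R : realType}.

Lemma measurable_cis : measurable_fun [set: measurableTypeR R] (@cis R).
Proof.
apply: measurable_fun_complex; apply: continuous_measurable_fun => t /=.
  by apply: continuous_comp; [exact: mulrl_continuous|exact: continuous_cos].
by apply: continuous_comp; [exact: mulrl_continuous|exact: continuous_sin].
Qed.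

Definition circle_haar : set R[i] -> \bar R :=
  pushforward (mrestr (@lebesgue_measure R) (measurable_itv `[0, 1])) (@cis R).

Let circle_haar0 : circle_haar set0 = 0%E.
Proof. by rewrite /circle_haar /pushforward preimage_set0 measure0. Qed.

Let circle_haar_ge0 A : (0 <= circle_haar A)%E.
Proof. by rewrite /circle_haar /pushforward measure_ge0. Qed.

Let circle_haar_additive : semi_sigma_additive circle_haar.
Proof.
have mcis A : measurable A -> measurable (@cis R @^-1` A : set (measurableTypeR R)).
  by move=> mA; rewrite -[X in measurable X]setTI; exact: measurable_cis.
move=> F mF tF mUF; rewrite /circle_haar /pushforward preimage_bigcup.
apply: measure_semi_sigma_additive => [k||]; first exact: mcis.
- apply/trivIsetP => i j _ _ ij; rewrite -preimage_setI.
  by move/trivIsetP : tF => -> //; rewrite preimage_set0.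
- by rewrite -preimage_bigcup; exact: mcis.
Qed.

HB.instance Definition _ := isMeasure.Build _ _ _ circle_haar
  circle_haar0 circle_haar_ge0 circle_haar_additive.

End circle_haar.

Section affine_weyl_heisenberg.
Context {R : realType} {n : nat}.
Implicit Types (V : {vspace 'cV[R]_n}) (H : set 'M[R]_n) (h : 'M[R]_n).

(* (z, x, xi, h) is encoded as the nested pair (((z, x), xi), h). *)
Definition awh_type := (R[i] * 'cV[R]_n * 'cV[R]_n * 'M[R]_n)%type.

Definition GL : set 'M[R]_n := [set h | h \in unitmx].

Definition circle : set R[i] := [set z | Normc.normc z = 1].

Definition awh : set awh_type := circle `*` setT `*` setT `*` GL.

Definition awh_mul (p q : awh_type) : awh_type :=
  let: (z1, x1, xi1, h1) := p in
  let: (z2, x2, xi2, h2) := q in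
  (z1 * z2 * cis (dotp xi1 (h1 *m x2)), x1 + h1 *m x2,
   xi1 + (invmx h1)^T *m xi2, h1 *m h2).

Definition awh_one : awh_type := (1, 0, 0, 1%:M).

Definition translation (x : 'cV[R]_n) (f : 'cV[R]_n -> R[i]) :=
  fun y => f (y - x).

Definition modulation (xi : 'cV[R]_n) (f : 'cV[R]_n -> R[i]) :=
  fun y => cis (dotp y xi) * f y.

Definition dilation h (f : 'cV[R]_n -> R[i]) :=
  fun y => (`|\det h| `^ (- 2^-1))%:C%C * f (invmx h *m y).

Definition quasi_regular (p : awh_type) (f : 'cV[R]_n -> R[i]) :=
  let: (z, x, xi, h) := p in
  fun y => z * translation x (modulation xi (dilation h f)) y.

Definition tc_set V H : set awh_type :=
  circle `*` setT `*` [set xi | xi \in V] `*` H.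

Definition closed_subgroup_GL H :=
  [/\ H `<=` GL, subgroup mulmx 1%:M H &
      exists2 C : set 'M[R]_n, closed C & H = C `&` GL].

Definition translation_complete V H :=
  [/\ closed_subgroup_GL H,
      forall h, H h -> forall xi, xi \in V -> h^T *m xi \in V,
      tc_set V H `<=` awh &
      subgroup awh_mul awh_one (tc_set V H)].

(* A left Haar measure of H, as a Borel measure on n x n matrices carried by H;
   finiteness on compact sets is regularity since GL(n, R) is locally compact
   and second countable. *)
Definition left_haar H (nu : {measure set 'M[R]_n -> \bar R}) :=
  [/\ nu (~` H) = 0%E, (0 < nu H)%E,
      forall K, compact K -> K `<=` H -> (nu K < +oo)%E &
      forall h A, H h -> measurable A -> A `<=` H ->
        nu [set h *m a | a in A] = nu A].

(* The matrix, in the basis vbasis V, of the restriction of h^T to V. *)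
Definition tr_restr V h : 'M[R]_(\dim V) :=
  \matrix_(i, j) coord (vbasis V) i (h^T *m (vbasis V)`_j).

Definition tc_haar V (nu : set 'M[R]_n -> \bar R) : set awh_type -> \bar R :=
  fun A => (\int[circle_haar \x lebesgue_cV n \x lebesgue_vs V \x nu]_(p in A)
    (`|\det (tr_restr V p.2)| / `|\det p.2|)%:E)%E.

Definition wavelet_transform psi f (p : awh_type) : R[i] :=
  inner f (quasi_regular p psi).

Definition tc_sqnorm V H nu (F : awh_type -> R[i]) : \bar R :=
  (\int[tc_haar V nu]_(p in tc_set V H) (Normc.normc (F p) ^+ 2)%:E)%E.

Definition Phi V H (nu : {measure set 'M[R]_n -> \bar R})
    (psi : 'cV[R]_n -> R[i]) (omega : 'cV[R]_n) : \bar R :=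
  (\int[lebesgue_vs V]_(xi in [set xi | xi \in V]) \int[nu]_(h in H)
    (Normc.normc (plancherel psi (h^T *m (omega - xi))) ^+ 2
     * `|\det (tr_restr V h)|)%:E)%E.

End affine_weyl_heisenberg.

(* Main.v *)
(** Fix z, xi and h. The Fourier-Plancherel transform intertwines the
    quasi-regular representation with an action on the frequency side, so by
    Parseval x |-> V_psi f (z, x, xi, h) is, up to conjugation and a unimodular
    factor, the Fourier transform of the integrable function
    phi(w) = |det h|^(1/2) psi^(h^T (w - xi)) conj(f^(w)). Plancherel's identity
    holds for every integrable function, both sides being possibly infinite;
    hence integrating |V_psi f|^2 over x gives
    int |f^(w)|^2 |det h| |psi^(h^T (w - xi))|^2 dw. The factor |det h| cancels
    the one in the Haar measure of G, and Tonelli's theorem concludes. It applies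
    because H, the intersection of GL with a closed set of matrices, is
    sigma-compact, so that its Haar measure is sigma-finite.

    On the line, the extended Plancherel identity for phi in L1 comes from
    damping phi^ by exp(-eps |g|), whose Fourier transform is the Poisson kernel
    P_eps: the damped energy of phi^ is <P_eps * phi, phi>, at most the energy of
    phi, and P_eps * phi tends to phi in L1. In dimension n it follows by partial
    Fourier transforms. *)
Require Import Defs.
From HB Require Import structures.
From mathcomp Require Import all_boot all_order all_algebra.
From mathcomp Require Import complex.
From mathcomp Require Import all_classical all_reals all_analysis measurable_realfun.
From mathcomp Require Import ring lra.

Set Implicit Arguments.
Unset Strict Implicit.
Unset Printing Implicit Defensive.

Import Order.TTheory GRing.Theory Num.Theory.
Import numFieldNormedType.Exports.

Local Open Scope classical_set_scope.
Local Open Scope ring_scope.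

(** * Complex-valued measurable functions and integrals *)

(** The function phi is a product of two square integrable functions, hence integrable but in
    general not square integrable. This is why Plancherel's identity is needed on L1 with possibly
    infinite values, out of reach of the L2 isometry. Restricted to functions in both L1 and L2, the
    same identity makes the Fourier transform isometric, and from this the Fourier-Plancherel
    transform is built: transforms of fast Cauchy sequences converge by Riesz-Fischer, and isometry
    and linearity pass to the closed graph. Parseval's identity is stated for arbitrary pairs in
    that graph, so that it applies both to [plancherel] and to the explicit [frequency_side].
    Exponential damping is chosen because it is elementary: exp(-eps t) (1 + cos (a t)) and the
    Poisson kernel have explicit antiderivatives, so the pair is computed by the fundamental theorem
    of calculus on a half-line, without Fourier inversion or contour integrals. *)

Section complex_norm.
Context {R : realType}.
Implicit Types z w : R[i].

Lemma sqr_normcE z : Normc.normc z ^+ 2 = complex.Re z ^+ 2 + complex.Im z ^+ 2.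
Proof. by case: z => a b /=; rewrite sqr_sqrtr ?addr_ge0 ?sqr_ge0. Qed.

Lemma normc_ge0 z : 0 <= Normc.normc z.
Proof. by case: z => a b; exact: sqrtr_ge0. Qed.

Lemma normc_conjc z : Normc.normc (conjc z) = Normc.normc z.
Proof. by case: z => a b /=; rewrite sqrrN. Qed.

Lemma normrRe_le z : `|complex.Re z| <= Normc.normc z.
Proof.
by rewrite -(ler_pXn2r (n := 2)) ?nnegrE ?normc_ge0// sqr_normcE real_normK ?num_real// lerDl sqr_ge0.
Qed.

Lemma normrIm_le z : `|complex.Im z| <= Normc.normc z.
Proof.
by rewrite -(ler_pXn2r (n := 2)) ?nnegrE ?normc_ge0// sqr_normcE real_normK ?num_real// lerDr sqr_ge0.
Qed.

Lemma normc_leReIm z : Normc.normc z <= `|complex.Re z| + `|complex.Im z|.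
Proof.
rewrite -(ler_pXn2r (n := 2)) ?nnegrE ?normc_ge0 ?addr_ge0// sqr_normcE sqrrD !real_normK ?num_real//.
by rewrite addrAC lerDl mulrn_wge0// mulr_ge0.
Qed.

Lemma normc_real (x : R) : Normc.normc x%:C%C = `|x|.
Proof. by rewrite /= expr0n addr0 sqrtr_sqr. Qed.

Lemma normcN z : Normc.normc (- z) = Normc.normc z.
Proof. by case: z => a b /=; rewrite !sqrrN. Qed.

Lemma ler_normcB z w : Normc.normc (z - w) <= Normc.normc z + Normc.normc w.
Proof. by rewrite -(normcN w) le_normcD. Qed.

Lemma ReD z w : complex.Re (z + w) = complex.Re z + complex.Re w.
Proof. by case: z w => a b []. Qed.

Lemma ImD z w : complex.Im (z + w) = complex.Im z + complex.Im w.
Proof. by case: z w => a b []. Qed.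

Lemma ReM z w : complex.Re (z * w) = complex.Re z * complex.Re w - complex.Im z * complex.Im w.
Proof. by case: z w => a b []. Qed.

Lemma ImM z w : complex.Im (z * w) = complex.Re z * complex.Im w + complex.Im z * complex.Re w.
Proof. by case: z w => a b []. Qed.

Lemma ReJ z : complex.Re (conjc z) = complex.Re z. Proof. by case: z. Qed.
Lemma ImJ z : complex.Im (conjc z) = - complex.Im z. Proof. by case: z. Qed.

Lemma conjcM z w : conjc (z * w) = conjc z * conjc w.
Proof. exact: rmorphM. Qed.

Lemma mulc_conjc z : z * conjc z = (Normc.normc z ^+ 2)%:C%C.
Proof. by rewrite sqr_normcE; case: z => a b; apply/eqP; rewrite eq_complex /=; apply/andP; split; apply/eqP; ring. Qed.

Lemma cisD (s t : R) : cis (s + t) = cis s * cis t.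
Proof.
rewrite /cis mulrDr cosD sinD; apply/eqP; rewrite eq_complex /=.
by apply/andP; split; apply/eqP; ring.
Qed.

Lemma conjc_cis (t : R) : conjc (cis t) = cis (- t).
Proof. by rewrite /cis /= mulrN cosN sinN. Qed.

Lemma cis0 : cis 0 = 1 :> R[i].
Proof. by rewrite /cis mulr0 cos0 sin0. Qed.

Lemma normc_cis (t : R) : Normc.normc (cis t) = 1.
Proof. by rewrite /cis /= cos2Dsin2 sqrtr1. Qed.

End complex_norm.

Section complex_measurability.
Context {R : realType}.

Lemma measurable_Re : measurable_fun [set: R[i]] (@complex.Re R).
Proof. by move=> _ Y mY; rewrite setTI; apply: sub_sigma_algebra; left; exists Y; rewrite ?setTI. Qed.

Lemma measurable_Im : measurable_fun [set: R[i]] (@complex.Im R).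
Proof. by move=> _ Y mY; rewrite setTI; apply: sub_sigma_algebra; right; exists Y; rewrite ?setTI. Qed.

Context d (T : measurableType d).
Implicit Types f g : T -> R[i].

Lemma measurable_funRe f : measurable_fun setT f -> measurable_fun setT (fun x => complex.Re (f x)).
Proof. exact: measurableT_comp measurable_Re. Qed.

Lemma measurable_funIm f : measurable_fun setT f -> measurable_fun setT (fun x => complex.Im (f x)).
Proof. exact: measurableT_comp measurable_Im. Qed.

Lemma measurable_fun_normc f : measurable_fun setT f -> measurable_fun setT (fun x => Normc.normc (f x)).
Proof.
move=> mf.
rewrite (_ : (fun _ => _) = fun x => Num.sqrt (complex.Re (f x) ^+ 2 + complex.Im (f x) ^+ 2)).
  apply: measurableT_comp; first by apply: continuous_measurable_fun; exact: sqrt_continuous.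
  by apply: measurable_funD; apply: measurable_funX; [exact: measurable_funRe|exact: measurable_funIm].
by apply/funext => x; rewrite -sqr_normcE sqrtr_sqr ger0_norm// normc_ge0.
Qed.

Lemma measurable_funcD f g : measurable_fun setT f -> measurable_fun setT g ->
  measurable_fun setT (fun x => f x + g x).
Proof.
move=> mf mg; apply: measurable_fun_complex.
  by under eq_fun do rewrite ReD; apply: measurable_funD; exact: measurable_funRe.
by under eq_fun do rewrite ImD; apply: measurable_funD; exact: measurable_funIm.
Qed.

Lemma measurable_funcM f g : measurable_fun setT f -> measurable_fun setT g ->
  measurable_fun setT (fun x => f x * g x).
Proof.
move=> mf mg; apply: measurable_fun_complex.
  under eq_fun do rewrite ReM.
  by apply: measurable_funB; apply: measurable_funM; (exact: measurable_funRe || exact: measurable_funIm).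
under eq_fun do rewrite ImM.
by apply: measurable_funD; apply: measurable_funM; (exact: measurable_funRe || exact: measurable_funIm).
Qed.

Lemma measurable_fun_conjc f : measurable_fun setT f -> measurable_fun setT (fun x => conjc (f x)).
Proof.
move=> mf; apply: measurable_fun_complex.
  by under eq_fun do rewrite ReJ; exact: measurable_funRe.
by under eq_fun do rewrite ImJ; apply: measurableT_comp => //; exact: measurable_funIm.
Qed.

Lemma measurable_fun_realc (f : T -> R) : measurable_fun setT f ->
  measurable_fun setT (fun x => (f x)%:C%C).
Proof. by move=> mf; apply: measurable_fun_complex => /=. Qed.

Lemma measurable_funcN f : measurable_fun setT f -> measurable_fun setT (fun x => - f x).
Proof.
move=> mf; under eq_fun do rewrite -mulN1r.
by apply: measurable_funcM => //.
Qed.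

Lemma measurable_funcB f g : measurable_fun setT f -> measurable_fun setT g ->
  measurable_fun setT (fun x => f x - g x).
Proof. by move=> mf mg; apply: measurable_funcD => //; exact: measurable_funcN. Qed.

Lemma measurable_fun_cis (f : T -> R) : measurable_fun setT f ->
  measurable_fun setT (fun x => cis (f x)).
Proof. exact: measurableT_comp measurable_cis. Qed.

Lemma measurable_sqr_normc f : measurable_fun setT f ->
  measurable_fun setT (fun x => (Normc.normc (f x) ^+ 2)%:E).
Proof. by move=> mf; apply/measurable_EFinP/measurable_funX/measurable_fun_normc. Qed.

Lemma measurable_normcE f : measurable_fun setT f ->
  measurable_fun setT (fun x => (Normc.normc (f x))%:E).
Proof. by move=> mf; apply/measurable_EFinP/measurable_fun_normc. Qed.

End complex_measurability.

(** Same body as [cintegral], over an arbitrary measure: [cintegral] converts to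
    [cint (lebesgue_cV n)], and the line and product spaces are covered by the same lemmas. *)
Definition cint d (T : measurableType d) (R : realType) (mu : {measure set T -> \bar R}) (f : T -> R[i]) : R[i] :=
  ((\int[mu]_x complex.Re (f x)) +i* (\int[mu]_x complex.Im (f x)))%C.

(** For [lebesgue_cV n] this converts to [L1]; the two are used interchangeably. *)
Definition cintegrable d (T : measurableType d) (R : realType) (mu : {measure set T -> \bar R}) (f : T -> R[i]) :=
  measurable_fun setT f /\ (\int[mu]_x (Normc.normc (f x))%:E < +oo)%E.

Section complex_integral.
Context d (T : measurableType d) (R : realType) (mu : {measure set T -> \bar R}).
Implicit Types f g : T -> R[i].

Lemma integrableZl_EFin (k : R) (h : T -> R) : mu.-integrable setT (fun x => (h x)%:E) ->
  mu.-integrable setT (EFin \o (fun x => k * h x)).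
Proof. by move=> ih; have := integrableZl measurableT k ih; exact: eq_integrable. Qed.

Lemma cintegrable_Re f : cintegrable mu f -> mu.-integrable setT (fun x => (complex.Re (f x))%:E).
Proof.
move=> [mf fi]; apply/integrableP; split; first by apply/measurable_EFinP; exact: measurable_funRe.
apply: le_lt_trans fi; apply: ge0_le_integral => //.
- by apply/measurable_EFinP/measurableT_comp => //; exact: measurable_funRe.
- exact: measurable_normcE.
- by move=> x _; rewrite lee_fin normrRe_le.
Qed.

Lemma cintegrable_Im f : cintegrable mu f -> mu.-integrable setT (fun x => (complex.Im (f x))%:E).
Proof.
move=> [mf fi]; apply/integrableP; split; first by apply/measurable_EFinP; exact: measurable_funIm.
apply: le_lt_trans fi; apply: ge0_le_integral => //.
- by apply/measurable_EFinP/measurableT_comp => //; exact: measurable_funIm.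
- exact: measurable_normcE.
- by move=> x _; rewrite lee_fin normrIm_le.
Qed.

Lemma cintegrableP f : mu.-integrable setT (fun x => (complex.Re (f x))%:E) ->
  mu.-integrable setT (fun x => (complex.Im (f x))%:E) -> cintegrable mu f.
Proof.
move=> ir ii.
have mr : measurable_fun setT (fun x => complex.Re (f x)) by apply/measurable_EFinP/measurable_int/ir.
have mi : measurable_fun setT (fun x => complex.Im (f x)) by apply/measurable_EFinP/measurable_int/ii.
have mf : measurable_fun setT f by exact: measurable_fun_complex.
split => //; move/integrableP: (integrableD measurableT (integrable_abse ir) (integrable_abse ii)) => [m].
apply: le_lt_trans; apply: ge0_le_integral => //.
- by move=> x _; rewrite lee_fin normc_ge0.
- exact: measurable_normcE.
- by apply: measurableT_comp.
- by move=> x _; rewrite [leRHS]gee0_abs ?adde_ge0//= -EFinD lee_fin normc_leReIm.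
Qed.

Lemma le_cintegrable f (g : T -> \bar R) : measurable_fun setT f ->
  measurable_fun setT g ->
  (forall x, ((Normc.normc (f x))%:E <= g x)%E) -> (\int[mu]_x g x < +oo)%E -> cintegrable mu f.
Proof.
move=> mf mg fg gi; split => //; apply: le_lt_trans gi; apply: ge0_le_integral => //.
- by move=> x _; rewrite lee_fin normc_ge0.
- exact: measurable_normcE.
Qed.

Lemma cintegrableM_bounded f g : cintegrable mu f -> measurable_fun setT g ->
  (forall x, Normc.normc (g x) <= 1) -> cintegrable mu (fun x => f x * g x).
Proof.
move=> [mf fi] mg g1; apply: (@le_cintegrable _ (fun x => (Normc.normc (f x))%:E)) => //.
- exact: measurable_funcM.
- exact: measurable_normcE.
- by move=> x; rewrite lee_fin Normc.normcM ler_piMr// normc_ge0.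
Qed.

Lemma cintegrableD f g : cintegrable mu f -> cintegrable mu g -> cintegrable mu (fun x => f x + g x).
Proof.
move=> cf cg; apply: cintegrableP.
  under eq_fun do rewrite ReD EFinD.
  by apply: integrableD => //; exact: cintegrable_Re.
under eq_fun do rewrite ImD EFinD.
by apply: integrableD => //; exact: cintegrable_Im.
Qed.

Lemma cintegrableZ f (c : R[i]) : cintegrable mu f -> cintegrable mu (fun x => c * f x).
Proof.
move=> [mf fi]; split; first by apply: measurable_funcM.
under eq_integral do rewrite Normc.normcM EFinM.
rewrite ge0_integralZl ?lee_fin ?normc_ge0//; [|exact: measurable_normcE| by move=> x _; rewrite lee_fin normc_ge0].
by rewrite lte_mul_pinfty ?lee_fin ?normc_ge0.
Qed.

Lemma cintegrableZr f (c : R[i]) : cintegrable mu f -> cintegrable mu (fun x => f x * c).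
Proof. by move=> cf; under eq_fun do rewrite mulrC; exact: cintegrableZ. Qed.

Lemma cintegrable_conjc f : cintegrable mu f -> cintegrable mu (fun x => conjc (f x)).
Proof.
move=> [mf fi]; split; first exact: measurable_fun_conjc.
by under eq_integral do rewrite normc_conjc.
Qed.

Lemma cintegrable_normc f : cintegrable mu f -> mu.-integrable setT (fun x => (Normc.normc (f x))%:E).
Proof.
move=> [mf fi]; apply/integrableP; split; first exact: measurable_normcE.
by under eq_integral do rewrite gee0_abs ?lee_fin ?normc_ge0//.
Qed.

Lemma cintD f g : cintegrable mu f -> cintegrable mu g ->
  cint mu (fun x => f x + g x) = cint mu f + cint mu g.
Proof.
move=> cf cg; rewrite /cint; apply/eqP; rewrite eq_complex /=.
rewrite -!RintegralD//; try (exact: cintegrable_Re || exact: cintegrable_Im).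
by apply/andP; split; apply/eqP/eq_Rintegral => x _; rewrite (ReD, ImD).
Qed.

Lemma cintZ f (c : R[i]) : cintegrable mu f -> cint mu (fun x => c * f x) = c * cint mu f.
Proof.
move=> cf; have ir := cintegrable_Re cf; have ii := cintegrable_Im cf.
rewrite /cint; apply/eqP; rewrite eq_complex ReM ImM /=.
rewrite -!RintegralZl// -RintegralB -?RintegralD//; try exact: integrableZl_EFin.
by apply/andP; split; apply/eqP/eq_Rintegral => x _; rewrite (ReM, ImM).
Qed.

Lemma cintZr f (c : R[i]) : cintegrable mu f -> cint mu (fun x => f x * c) = cint mu f * c.
Proof. by move=> cf; under eq_fun do rewrite mulrC; rewrite cintZ// mulrC. Qed.

Lemma cint_conjc f : cintegrable mu f -> cint mu (fun x => conjc (f x)) = conjc (cint mu f).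
Proof.
move=> cf; rewrite /cint; apply/eqP; rewrite eq_complex /=.
rewrite -mulN1r -RintegralZl//; last exact: cintegrable_Im.
by apply/andP; split; apply/eqP/eq_Rintegral => x _; rewrite (ReJ, ImJ) ?mulN1r.
Qed.

Lemma cint_real (f : T -> R) : cint mu (fun x => (f x)%:C%C) = (\int[mu]_x f x)%:C%C.
Proof.
rewrite /cint /=; congr (_ +i* _)%C.
by rewrite /Rintegral integral0_eq.
Qed.

(** Multiplication by the conjugate of the integral I rotates it onto the real axis: |I|^2 is the
    real part of the integral of conj(I) f, at most |I| times the integral of |f|. *)
Lemma normc_cint_le f : measurable_fun setT f ->
  ((Normc.normc (cint mu f))%:E <= \int[mu]_x (Normc.normc (f x))%:E)%E.
Proof.
move=> mf; have [fi|] := ltP (\int[mu]_x (Normc.normc (f x))%:E)%E +oo%E; last first.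
  by rewrite leye_eq => /eqP ->; rewrite leey.
have cf : cintegrable mu f by split.
have [I Ie] : exists I, cint mu f = I by exists (cint mu f).
rewrite Ie; have [I0|I0] := eqVneq (Normc.normc I) 0.
  by rewrite I0 integral_ge0// => x _; rewrite lee_fin normc_ge0.
have nI : 0 < Normc.normc I by rewrite lt0r I0 normc_ge0.
rewrite -(@fineK _ (\int[mu]_x _)%E) ?ge0_fin_numE ?integral_ge0//; last first.
  by move=> x _; rewrite lee_fin normc_ge0.
rewrite lee_fin -(ler_pM2l nI) -expr2.
have -> : Normc.normc I ^+ 2 = complex.Re (cint mu (fun x => conjc I * f x)).
  by rewrite cintZ// Ie mulrC mulc_conjc.
rewrite [leLHS]/= -[fine _]/(Rintegral _ _ _) -RintegralZl//; last exact: cintegrable_normc.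
apply: le_Rintegral => //.
- exact/cintegrable_Re/cintegrableZ.
- by apply: integrableZl_EFin; exact: cintegrable_normc.
- move=> x _; apply: le_trans (ler_norm _) _; apply: le_trans (normrRe_le _) _.
  by rewrite Normc.normcM normc_conjc.
Qed.

Lemma eq_cint f g : f =1 g -> cint mu f = cint mu g.
Proof. by move=> /funext ->. Qed.

End complex_integral.

Section ereal_limits.
Context d (T : measurableType d) (R : realType) (mu : {measure set T -> \bar R}).

(** Fatou's lemma for a sequence that converges everywhere; it serves to remove the damping and,
    later, the truncation of phi. *)
Lemma cvg_integral_le (f_ : nat -> T -> \bar R) (f : T -> \bar R) (M : \bar R) :
  (forall k, measurable_fun setT (f_ k)) -> (forall k x, (0 <= f_ k x)%E) ->
  (forall x, f_ k x @[k --> \oo] --> f x) ->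
  (\forall k \near \oo, (\int[mu]_x f_ k x <= M)%E) -> (\int[mu]_x f x <= M)%E.
Proof.
move=> mf f0 ff fM.
have -> : (\int[mu]_x f x = \int[mu]_x limn_einf (f_ ^~ x))%E.
  by apply: eq_integral => x _; rewrite (cvg_limn_einf_sup (ff x)).
apply: le_trans (fatou mu measurableT mf _) _ => //.
rewrite limn_einf_lim; apply: lime_le; first exact: is_cvg_einfs.
near=> k; apply: le_trans (_ : (\int[mu]_x f_ k x <= M)%E); last by near: k.
by apply: ereal_inf_lbound; exists k => /=.
Unshelve. all: by end_near. Qed.

End ereal_limits.

Lemma ge0_cvge0P (R : realType) (u : nat -> \bar R) : (forall k, (0 <= u k)%E) ->
  (forall e : R, 0 < e -> \forall k \near \oo, (u k <= e%:E)%E) -> u k @[k --> \oo] --> 0%E.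
Proof.
move=> u0 ue.
have ufin : \forall k \near \oo, u k \is a fin_num.
  near=> k; rewrite ge0_fin_numE//; apply: (@le_lt_trans _ _ 1%:E); last exact: ltry.
  by near: k; exact: ue.
apply/fine_cvgP; split => //; apply/cvgrPdist_le => /= e e0.
near=> k; rewrite sub0r normrN ger0_norm ?fine_ge0// -lee_fin fineK; last by near: k.
by near: k; exact: ue.
Unshelve. all: by end_near. Qed.

Lemma ge0_cvge0_near (R : realType) (u : nat -> \bar R) (e : R) : u k @[k --> \oo] --> 0%E ->
  0 < e -> \forall k \near \oo, (u k < e%:E)%E.
Proof.
move=> /fine_cvgP[ufin u0] e0; near=> k.
have uk : u k \is a fin_num by near: k.
by rewrite -(fineK uk) lte_fin; near: k; exact: (cvgr_lt _ u0).
Unshelve. all: by end_near. Qed.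

Lemma ge0_cvge0_leD (R : realType) (w u v : nat -> \bar R) : (forall k, (0 <= w k)%E) ->
  (forall k, (w k <= u k + v k)%E) -> u k @[k --> \oo] --> 0%E -> v k @[k --> \oo] --> 0%E ->
  w k @[k --> \oo] --> 0%E.
Proof.
move=> w0 wuv u0 v0; apply: ge0_cvge0P => // e e0.
have e20 : 0 < e / 2 by rewrite divr_gt0.
near=> k; apply: (le_trans (wuv k)); rewrite (splitr e) EFinD.
by apply: leeD; apply/ltW; near: k; exact: ge0_cvge0_near.
Unshelve. all: by end_near. Qed.

Lemma ge0_cvge0_le (R : realType) (w u : nat -> \bar R) : (forall k, (0 <= w k)%E) ->
  (forall k, (w k <= u k)%E) -> u k @[k --> \oo] --> 0%E -> w k @[k --> \oo] --> 0%E.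
Proof.
move=> w0 wu u0; apply: (@ge0_cvge0_leD _ _ u (fun=> 0%E)) => //; last exact: cvg_cst.
by move=> k; rewrite adde0.
Qed.

(** * Fubini's theorem for real and complex integrals *)

Section real_fubini.
Context d1 d2 (T1 : measurableType d1) (T2 : measurableType d2) (R : realType).
Context (m1 : {sigma_finite_measure set T1 -> \bar R}) (m2 : {sigma_finite_measure set T2 -> \bar R}).
Implicit Types h : T1 * T2 -> R.

(** The inner integral is a difference of two Tonelli integrals, measurable in x, and [fine] sends
    its infinite values measurably to a default; so the statement holds even where slices fail to be
    integrable. *)
Lemma measurable_Rintegral h : measurable_fun setT h ->
  measurable_fun setT (fun x => \int[m2]_y h (x, y)).
Proof.
move=> mh; apply: measurableT_comp; first exact: fine_measurable.
under eq_fun do rewrite integralE.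
have mEh : measurable_fun setT (EFin \o h) by exact/measurable_EFinP.
apply: emeasurable_funB.
- have h0 p : (0 <= (EFin \o h)^\+ p)%E by exact: funepos_ge0.
  have := @measurable_fun_fubini_tonelli_F _ _ _ _ _ m2 _ (measurable_funepos mEh) h0.
  by congr measurable_fun; apply/funext => x; apply: eq_integral => y _; rewrite !funeposE.
- have h0 p : (0 <= (EFin \o h)^\- p)%E by exact: funeneg_ge0.
  have := @measurable_fun_fubini_tonelli_F _ _ _ _ _ m2 _ (measurable_funeneg mEh) h0.
  by congr measurable_fun; apply/funext => x; apply: eq_integral => y _; rewrite !funenegE.
Qed.

Lemma Rintegral_fubini1 h (k : T1 -> R) : (m1 \x m2)%E.-integrable setT (EFin \o h) ->
  measurable_fun setT k -> {ae m1, forall x, k x = \int[m2]_y h (x, y)} ->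
  \int[m1]_x k x = \int[(m1 \x m2)%E]_p h p.
Proof.
move=> ih mk kh; congr fine; rewrite -integral12_prod_meas1//.
apply: ae_eq_integral => //.
- exact/measurable_EFinP.
- exact: (measurable_fubini_F ih).
- apply: filterS2 kh (ae_integrable1 ih) => x -> ix _.
  by rewrite [LHS]fineK//; exact: (integrable_fin_num measurableT ix).
Qed.

Lemma Rintegral_fubini2 h (k : T2 -> R) : (m1 \x m2)%E.-integrable setT (EFin \o h) ->
  measurable_fun setT k -> {ae m2, forall y, k y = \int[m1]_x h (x, y)} ->
  \int[m2]_y k y = \int[(m1 \x m2)%E]_p h p.
Proof.
move=> ih mk kh; congr fine; rewrite -integral21_prod_meas1//.
apply: ae_eq_integral => //.
- exact/measurable_EFinP.
- exact: (measurable_fubini_G ih).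
- apply: filterS2 kh (ae_integrable2 ih) => x -> ix _.
  by rewrite [LHS]fineK//; exact: (integrable_fin_num measurableT ix).
Qed.

End real_fubini.

Section complex_fubini.
Context d1 d2 (T1 : measurableType d1) (T2 : measurableType d2) (R : realType).
Context (m1 : {sigma_finite_measure set T1 -> \bar R}) (m2 : {sigma_finite_measure set T2 -> \bar R}).
Implicit Types f : T1 * T2 -> R[i].

Lemma measurable_cint1 f : measurable_fun setT f ->
  measurable_fun setT (fun x => cint m2 (fun y => f (x, y))).
Proof.
move=> mf; apply: measurable_fun_complex => /=.
- exact: (measurable_Rintegral m2 (measurable_funRe mf)).
- exact: (measurable_Rintegral m2 (measurable_funIm mf)).
Qed.

Lemma measurable_cint2 f : measurable_fun setT f ->
  measurable_fun setT (fun y => cint m1 (fun x => f (x, y))).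
Proof.
move=> mf; have mfs := measurableT_comp mf (@measurable_swap _ _ T2 T1).
apply: measurable_fun_complex => /=.
- exact: (measurable_Rintegral m1 (measurable_funRe mfs)).
- exact: (measurable_Rintegral m1 (measurable_funIm mfs)).
Qed.

(** The condition on [g] bears on integrable slices only, which are almost all of them. This form
    identifies a partial Fourier transform with a slice integral in the induction on the
    dimension. *)
Lemma cint_fubini1 f (g : T1 -> R[i]) : cintegrable (m1 \x m2)%E f -> measurable_fun setT g ->
  (forall x, cintegrable m2 (fun y => f (x, y)) -> g x = cint m2 (fun y => f (x, y))) ->
  cint m1 g = cint (m1 \x m2)%E f.
Proof.
move=> cf mg gf; have ir := cintegrable_Re cf; have ii := cintegrable_Im cf.
have aeg : {ae m1, forall x, g x = cint m2 (fun y => f (x, y))}.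
  by apply: filterS2 (ae_integrable1 ir) (ae_integrable1 ii) => x irx iix; apply/gf/cintegrableP.
congr (_ +i* _)%C; apply: Rintegral_fubini1 => //.
- exact: measurable_funRe.
- by apply: filterS aeg => x ->.
- exact: measurable_funIm.
- by apply: filterS aeg => x ->.
Qed.

Lemma cint_swap f : cintegrable (m1 \x m2)%E f ->
  cint m1 (fun x => cint m2 (fun y => f (x, y))) = cint m2 (fun y => cint m1 (fun x => f (x, y))).
Proof.
move=> cf; have ir := cintegrable_Re cf; have ii := cintegrable_Im cf.
have mf := cf.1.
rewrite (@cint_fubini1 f)//; last exact: measurable_cint1.
congr (_ +i* _)%C; apply/esym/Rintegral_fubini2 => //.
- exact: (measurable_funRe (measurable_cint2 mf)).
- exact: nearW.
- exact: (measurable_funIm (measurable_cint2 mf)).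
- exact: nearW.
Qed.

Lemma cintegrable_prodP f : measurable_fun setT f ->
  (\int[m1]_x \int[m2]_y (Normc.normc (f (x, y)))%:E < +oo)%E -> cintegrable (m1 \x m2)%E f.
Proof.
move=> mf fi; split => //; rewrite fubini_tonelli1//; first exact: measurable_normcE.
by move=> x; rewrite lee_fin normc_ge0.
Qed.

(** The shape of the double integrands in the Poisson argument: two integrable factors coupled by a
    unimodular kernel. *)
Lemma cintegrable_tensor (a : T1 -> R[i]) (b : T2 -> R[i]) (c : T1 * T2 -> R[i]) :
  cintegrable m1 a -> cintegrable m2 b -> measurable_fun setT c ->
  (forall p, Normc.normc (c p) <= 1) ->
  cintegrable (m1 \x m2)%E (fun p => a p.1 * b p.2 * c p).
Proof.
move=> ca cb mc c1; apply: cintegrableM_bounded => //.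
apply: cintegrable_prodP.
  by apply: measurable_funcM; apply: measurableT_comp => //; [exact: ca.1|exact: cb.1].
have -> : (\int[m1]_x \int[m2]_y (Normc.normc (a x * b y))%:E =
   \int[m1]_x ((Normc.normc (a x))%:E * \int[m2]_y (Normc.normc (b y))%:E))%E.
  apply: eq_integral => x _; rewrite -ge0_integralZl//.
  - by apply: eq_integral => y _; rewrite Normc.normcM EFinM.
  - exact: measurable_normcE cb.1.
  - by move=> y _; rewrite lee_fin normc_ge0.
  - by rewrite lee_fin normc_ge0.
rewrite ge0_integralZr//; last 3 first.
  - exact: measurable_normcE ca.1.
  - by move=> y _; rewrite lee_fin normc_ge0.
  - by apply: integral_ge0 => y _; rewrite lee_fin normc_ge0.
rewrite lte_mul_pinfty//; last exact: cb.2.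
  by apply: integral_ge0 => y _; rewrite lee_fin normc_ge0.
rewrite ge0_fin_numE; first exact: ca.2.
by apply: integral_ge0 => y _; rewrite lee_fin normc_ge0.
Qed.

End complex_fubini.

(** * Plancherel's identity on the line *)

Section scaling_map.
Context d (T : measurableType d) (R : realType) (mu : {measure set T -> \bar R}).
Variables (phi : T -> T) (k : R).
Hypothesis mphi : measurable_fun setT phi.
Hypothesis k0 : 0 <= k.
Hypothesis phiE : forall F : T -> \bar R, measurable_fun setT F -> (forall x, (0 <= F x)%E) ->
  (\int[mu]_x F (phi x) = k%:E * \int[mu]_x F x)%E.

(** The change of variables is assumed for nonnegative functions; positive and negative parts carry
    it to real and complex ones. It is applied to affine maps of the line and of column vectors
    alike. *)
Lemma Rintegral_comp_scale (h : T -> R) : mu.-integrable setT (EFin \o h) ->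
  \int[mu]_x h (phi x) = k * \int[mu]_x h x.
Proof.
move=> ih; have mh := measurable_int _ ih.
have pE := phiE (measurable_funepos mh) (funepos_ge0 _).
have nE := phiE (measurable_funeneg mh) (funeneg_ge0 _).
rewrite /Rintegral [in LHS]integralE [in RHS]integralE.
have -> : (\int[mu]_x (fun x => (h (phi x))%:E)^\+ x = k%:E * \int[mu]_x (EFin \o h)^\+ x)%E.
  by rewrite -pE; apply: eq_integral => x _; rewrite !funeposE.
have -> : (\int[mu]_x (fun x => (h (phi x))%:E)^\- x = k%:E * \int[mu]_x (EFin \o h)^\- x)%E.
  by rewrite -nE; apply: eq_integral => x _; rewrite !funenegE.
have pf := integrable_pos_fin_num measurableT ih.
have nf := integrable_neg_fin_num measurableT ih.
rewrite -muleBr//; last by rewrite fin_num_adde_defr// fin_numN.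
by rewrite fineM//= fin_numB pf nf.
Qed.

Lemma cintegrable_comp_scale (f : T -> R[i]) : cintegrable mu f -> cintegrable mu (fun x => f (phi x)).
Proof.
move=> [mf fi]; split; first exact: (measurableT_comp mf mphi).
rewrite (phiE (measurable_normcE mf)); last by move=> x; rewrite lee_fin normc_ge0.
by rewrite lte_mul_pinfty ?lee_fin.
Qed.

Lemma cint_comp_scale (f : T -> R[i]) : cintegrable mu f ->
  cint mu (fun x => f (phi x)) = k%:C%C * cint mu f.
Proof.
move=> cf; apply/eqP; rewrite eq_complex ReM ImM /= !mul0r subr0 addr0.
rewrite (Rintegral_comp_scale (cintegrable_Re cf)) (Rintegral_comp_scale (cintegrable_Im cf)).
by rewrite !eqxx.
Qed.

End scaling_map.

Section affine_line.
Context {R : realType}.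
Local Notation mu := (@lebesgue_measure R).

Definition affine (a b : R) : measurableTypeR R -> measurableTypeR R := fun x => a * x + b.

Lemma measurable_affine a b : measurable_fun setT (affine a b).
Proof. by apply: measurable_funD => //; apply: measurable_funM. Qed.

(** The generated instance is named explicitly in order to supply [measurable_affine] as the
    measurability proof. *)
Definition affine_image (a b : R) : {measure set (measurableTypeR R) -> \bar R} :=
  measure_function_pushforward__canonical__measure_function_Measure mu (@measurable_affine a b).

(** By uniqueness of Lebesgue measure it is enough to compare both sides on half-open intervals. *)
Lemma lebesgue_affine (a b : R) (A : set (measurableTypeR R)) : a != 0 -> measurable A ->
  (mu A = `|a|%:E * mu (affine a b @^-1` A))%E.
Proof.
move=> a0 mA; pose m : {measure set (measurableTypeR R) -> \bar R} :=
  mscale (NngNum (normr_ge0 a)) (affine_image a b).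
rewrite [LHS](@lebesgue_measure_unique _ m)// => _ [[x y] _ <-].
change (mu `]x, y]%classic = `|a|%:E * mu (affine a b @^-1` `]x, y]%classic))%E.
have /orP[ap|an] : (0 < a) || (a < 0) by rewrite orbC -neq_lt.
  have -> : affine a b @^-1` `]x, y]%classic = `](x - b) / a, (y - b) / a]%classic.
    apply/seteqP; split => t /=; rewrite /affine !in_itv/=;
      by rewrite ltr_pdivrMr// ler_pdivlMr// ltrBlDr lerBrDr (mulrC t).
  rewrite !lebesgue_measure_itv/= !lte_fin ltr_pM2r ?invr_gt0// ltrD2r.
  case: ifPn => _; last by rewrite mule0.
  by rewrite -!EFinD -EFinM gtr0_norm//; congr EFin; field.
(* For negative [a] the endpoints are exchanged and the interval is closed on the other side, with
   the same length. *)
have -> : affine a b @^-1` `]x, y]%classic = `[(y - b) / a, (x - b) / a[%classic.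
  apply/seteqP; split => t /=; rewrite /affine !in_itv/= andbC;
    by rewrite ltr_ndivlMr// ler_ndivrMr// ltrBlDr lerBrDr (mulrC t).
rewrite !lebesgue_measure_itv/= !lte_fin ltr_nM2r ?invr_lt0// ltrD2r.
case: ifPn => _; last by rewrite mule0.
by rewrite -!EFinD -EFinM ltr0_norm//; congr EFin; field.
Qed.

Lemma ge0_integral_affine (a b : R) (F : measurableTypeR R -> \bar R) : a != 0 ->
  measurable_fun setT F -> (forall x, (0 <= F x)%E) ->
  (\int[mu]_x F (a * x + b)%R = (`|a|^-1)%:E * \int[mu]_x F x)%E.
Proof.
move=> a0 mF F0.
pose m : {measure set (measurableTypeR R) -> \bar R} :=
  mscale (NngNum (normr_ge0 a)) (affine_image a b).
have -> : (\int[mu]_x F x = \int[m]_x F x)%E.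
  by apply: eq_measure_integral => A mA _; exact: lebesgue_affine.
rewrite ge0_integral_mscale//= ge0_integral_pushforward//; last exact: measurable_affine.
by rewrite preimage_setT muleA -EFinM mulVf ?normr_eq0// mul1e.
Qed.

(** Reduces even integrands to the half-line, where the fundamental theorem with limit at +oo
    applies. *)
Lemma ge0_integral_line_split (F : measurableTypeR R -> \bar R) :
  measurable_fun setT F -> (forall x, (0 <= F x)%E) ->
  (\int[mu]_x F x = \int[mu]_(x in `[0%R, +oo[) F x + \int[mu]_(x in `[0%R, +oo[) F (- x)%R)%E.
Proof.
move=> mF F0.
have mFN : measurable_fun setT (F \o -%R) by apply: measurableT_comp.
rewrite (ge0_integration_by_substitution0 mFN)//=.
under [X in (_ + X)%E]eq_integral do rewrite opprK.
rewrite -integral_itv_bndo_bndc//; last exact: measurable_funTS.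
rewrite -ge0_integral_setU//.
- by congr (integral _ _ _); apply/seteqP; split => x //= _; rewrite !in_itv/= andbT; case: (ltP x 0); [right|left].
- exact: measurable_funTS.
- by apply/disj_setPS => x /=; rewrite !in_itv/= andbT => -[x0]; rewrite ltNge x0.
Qed.

End affine_line.

(** * The Poisson kernel as the Fourier transform of exp(-eps |t|) *)

Section poisson_kernel.
Context {R : realType}.
Local Notation mu := (@lebesgue_measure R).
Implicit Types (eps a s t : R).

Definition expabs eps t : R := expR (- (eps * `|t|)).

(** Normalized for the characters e^(2 pi i s t): it is the Fourier transform of [expabs eps] and
    has mass 1. *)
Definition poisson eps s : R := 2 * eps / (eps ^+ 2 + (2 * pi * s) ^+ 2).

(** The antiderivative of exp(-eps t) (1 + cos (a t)) that vanishes at +oo. *)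
Let damped eps a t : R :=
  expR (- (eps * t)) * ((a * sin (a * t) - eps * cos (a * t)) / (eps ^+ 2 + a ^+ 2) - eps^-1).

Let cvg_expRM eps : 0 < eps -> expR (- (eps * t)) @[t --> +oo%R] --> (0 : R).
Proof.
move=> e0; apply: (@cvg_comp _ _ _ (fun t => eps * t) (fun z => expR (- z)) _ (pinfty_nbhs R)).
  exact: gt0_cvgMry.
exact: cvgr_expR.
Qed.

Let den_gt0 eps a : 0 < eps -> 0 < eps ^+ 2 + a ^+ 2.
Proof. by move=> e0; rewrite ltr_wpDr ?sqr_ge0// exprn_gt0. Qed.

Let is_derive_damped eps a t : 0 < eps ->
  is_derive t 1 (damped eps a) (expR (- (eps * t)) * (1 + cos (a * t))).
Proof.
move=> e0; have d0 := den_gt0 a e0; have dn0 := lt0r_neq0 d0.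
have D1 : is_derive t 1 (fun t => expR (- (eps * t))) (expR (- (eps * t)) * - eps).
  by apply: is_derive1_comp; apply: is_derive_eq; rewrite ?mulr0 ?addr0 /GRing.scale/= ?mulr1.
have D2 : is_derive t 1 (fun t => sin (a * t)) (cos (a * t) * a).
  by apply: is_derive1_comp; apply: is_derive_eq; rewrite ?mulr0 ?addr0 /GRing.scale/= ?mulr1.
have D3 : is_derive t 1 (fun t => cos (a * t)) (- sin (a * t) * a).
  by apply: is_derive1_comp; apply: is_derive_eq; rewrite ?mulr0 ?addr0 /GRing.scale/= ?mulr1.
rewrite /damped; apply: is_derive_eq.
rewrite /GRing.scale/=; field.
by rewrite lt0r_neq0.
Qed.

Let cvg_damped eps a : 0 < eps -> damped eps a t @[t --> +oo%R] --> (0 : R).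
Proof.
move=> e0; have d0 := den_gt0 a e0.
pose C := (`|a| + eps) / (eps ^+ 2 + a ^+ 2) + eps^-1.
apply/norm_cvg0P; apply: (@squeeze_cvgr _ _ _ _ (fun=> 0) (fun t => expR (- (eps * t)) * C)).
- apply: nearW => t; rewrite normr_ge0/= normrM ger0_norm ?expR_ge0// ler_wpM2l ?expR_ge0//.
  apply: (le_trans (ler_normB _ _)); rewrite /C [`|eps^-1|]gtr0_norm ?invr_gt0// lerD2r.
  rewrite normrM [`|_^-1|]gtr0_norm ?invr_gt0// ler_wpM2r ?invr_ge0 ?(ltW d0)//.
  apply: (le_trans (ler_normB _ _)); rewrite !normrM (gtr0_norm e0) lerD//.
    by rewrite ler_piMr// ler_norml sin_geN1 sin_le1.
  by rewrite ler_piMr ?(ltW e0)// ler_norml cos_geN1 cos_le1.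
- exact: cvg_cst.
- rewrite -[X in _ --> X](mul0r C); apply: cvgM; last exact: cvg_cst.
  exact: cvg_expRM.
Qed.

(** The summand 1 makes the integrand nonnegative, as the fundamental theorem on the half-line
    requires; it is subtracted again once integrability is known. *)
Lemma integral_exp_cos eps a : 0 < eps ->
  (\int[mu]_(t in `[0%R, +oo[) (expR (- (eps * t)) * (1 + cos (a * t)))%:E =
   (eps^-1 + eps / (eps ^+ 2 + a ^+ 2))%:E)%E.
Proof.
move=> e0; have d0 := den_gt0 a e0.
have cD x : {for x, continuous (damped eps a)}.
  by apply/differentiable_continuous/derivable1_diffP; have := is_derive_damped a x e0; move=> [].
rewrite (@ge0_continuous_FTC2y R _ (damped eps a) 0 0).
- rewrite /damped mulr0 oppr0 expR0 mul1r mulr0 sin0 cos0 mulr0 mulr1 sub0r -EFinB; congr EFin.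
  by field; rewrite !lt0r_neq0.
- by move=> x _; rewrite mulr_ge0 ?expR_ge0// -lerBlDl sub0r cos_geN1.
- apply: continuous_subspaceT => x; apply: cvgM.
    apply: continuous_comp; last exact: continuous_expR.
    by apply: cvgN; exact: mulrl_continuous.
  apply: cvgD; first exact: cvg_cst.
  by apply: continuous_comp; [exact: mulrl_continuous|exact: continuous_cos].
- exact: cvg_damped.
- by move=> x _; have [] := is_derive_damped a x e0.
- by apply: cvg_at_right_filter; exact: cD.
- by move=> x _; rewrite derive1E; have [_] := is_derive_damped a x e0.
Qed.

Lemma expabs_ge0 eps t : 0 <= expabs eps t. Proof. exact: expR_ge0. Qed.

Lemma expabs_le1 eps t : 0 < eps -> expabs eps t <= 1.
Proof. by move=> e0; rewrite -expR0 ler_expR oppr_le0 mulr_ge0// ltW. Qed.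

Lemma measurable_expabs eps : measurable_fun [set: measurableTypeR R] (expabs eps).
Proof.
apply: measurableT_comp; first exact: measurable_expR.
by apply: measurableT_comp => //; apply: measurable_funM => //; apply: measurableT_comp.
Qed.

Lemma poisson_ge0 eps s : 0 < eps -> 0 <= poisson eps s.
Proof. by move=> e0; rewrite /poisson divr_ge0 ?mulr_ge0 ?addr_ge0 ?sqr_ge0// ltW. Qed.

Lemma poissonN eps s : poisson eps (- s) = poisson eps s.
Proof. by rewrite /poisson mulrN sqrrN. Qed.

Lemma poisson_scale eps t : 0 < eps -> eps * poisson eps (eps * t) = poisson 1 t.
Proof.
move=> e0; rewrite /poisson expr1n.
have -> : eps ^+ 2 + (2 * pi * (eps * t)) ^+ 2 = eps ^+ 2 * (1 + (2 * pi * t) ^+ 2) by ring.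
have := den_gt0 (2 * pi * t) ltr01; rewrite expr1n; set D := 1 + _ => D0.
by field; rewrite !lt0r_neq0.
Qed.

Lemma continuous_poisson eps : 0 < eps -> continuous (poisson eps).
Proof.
move=> e0 x; rewrite /poisson; apply: cvgM; first exact: cvg_cst.
apply: cvgV; first by rewrite lt0r_neq0// den_gt0.
apply: cvgD; first exact: cvg_cst.
by apply: cvgM; exact: mulrl_continuous.
Qed.

Lemma measurable_poisson eps : 0 < eps -> measurable_fun [set: measurableTypeR R] (poisson eps).
Proof. by move=> e0; apply: continuous_measurable_fun; exact: continuous_poisson. Qed.

Lemma integral_expabs_cos eps a : 0 < eps ->
  (\int[mu]_t (expabs eps t * (1 + cos (a * t)))%:E =
   (2 * (eps^-1 + eps / (eps ^+ 2 + a ^+ 2)))%:E)%E.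
Proof.
move=> e0; rewrite ge0_integral_line_split.
- rewrite mulr_natl mulr2n EFinD -integral_exp_cos//.
  by congr (_ + _)%E; apply: eq_integral => t; rewrite inE/= in_itv/= andbT => t0;
    rewrite /expabs ?normrN ?mulrN ?cosN ger0_norm.
- apply/measurable_EFinP; apply: measurable_funM; first exact: measurable_expabs.
  apply: measurable_funD => //; apply: continuous_measurable_fun => x.
  by apply: continuous_comp; [exact: mulrl_continuous|exact: continuous_cos].
- by move=> t; rewrite lee_fin mulr_ge0 ?expabs_ge0// -lerBlDl sub0r cos_geN1.
Qed.

Lemma integral_expabs eps : 0 < eps -> (\int[mu]_t (expabs eps t)%:E = (2 / eps)%:E)%E.
Proof.
(* At a = 0 the factor 1 + cos is 2; the division by 2 is carried out in the extended reals as a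
   multiplication by the inverse. *)
move=> e0; have := integral_expabs_cos 0 e0.
under eq_integral do rewrite mul0r cos0 mulrC EFinM.
rewrite ge0_integralZl//; last 2 first.
- by apply/measurable_EFinP; exact: measurable_expabs.
- by move=> x _; rewrite lee_fin expabs_ge0.
have -> : 2 * (eps^-1 + eps / (eps ^+ 2 + 0 ^+ 2)) = (1 + 1) * (2 / eps) by field; rewrite lt0r_neq0.
rewrite EFinM => /(congr1 (fun x => (1 + 1)^-1%:E * x)%E).
have V : (((1 + 1)^-1)%:E * (1 + 1)%:E = 1 :> \bar R)%E.
  by rewrite -EFinM mulVf// lt0r_neq0// addr_gt0.
by rewrite !muleA V !mul1e.
Qed.

Lemma cintegrable_expabs eps : 0 < eps -> cintegrable mu (fun t => (expabs eps t)%:C%C).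
Proof.
move=> e0; split; first by apply: measurable_fun_realc; exact: measurable_expabs.
under eq_integral do rewrite normc_real ger0_norm ?expabs_ge0//.
by rewrite integral_expabs// ltry.
Qed.

Lemma cint_expabs_cis eps s : 0 < eps ->
  cint mu (fun t => (expabs eps t)%:C%C * cis (s * t)) = (poisson eps s)%:C%C.
Proof.
move=> e0; pose f t := (expabs eps t)%:C%C * cis (s * t).
have cf : cintegrable mu f.
  apply: cintegrableM_bounded; first exact: cintegrable_expabs.
    by apply: measurable_fun_cis; apply: measurable_funM.
  by move=> x; rewrite normc_cis.
(* Reflection t -> -t preserves the integral and turns [f] into its conjugate, so the integral is
   real. *)
have imf : complex.Im (cint mu f) = 0.
  have h : cint mu (fun t => f (affine (-1) 0 t)) = (`|-1|^-1)%:C%C * cint mu f.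
    by apply: cint_comp_scale => // F mF F0; rewrite ge0_integral_affine ?oppr_eq0 ?oner_eq0.
  move: h; rewrite normrN1 invr1 mul1r => h.
  have : cint mu (fun t => conjc (f t)) = cint mu f.
    rewrite -h; apply: eq_cint => t.
    rewrite /f /affine /expabs addr0 mulN1r normrN mulrN -conjc_cis rmorphM.
    by congr (_ * _); exact: conjc_real.
  rewrite cint_conjc// => /(congr1 (@complex.Im R)); rewrite ImJ => /eqP.
  by rewrite eq_sym -addr_eq0 -mulr2n mulrn_eq0/= => /eqP.
apply/eqP; rewrite eq_complex imf eqxx andbT; apply/eqP => /=.
have ie := cintegrable_Re (cintegrable_expabs e0).
have i1 : mu.-integrable setT (EFin \o (fun t => expabs eps t * (1 + cos (2 * pi * s * t)))).
  apply/integrableP; split.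
    apply/measurable_EFinP; apply: measurable_funM; first exact: measurable_expabs.
    apply: measurable_funD => //; apply: continuous_measurable_fun => x.
    by apply: continuous_comp; [exact: mulrl_continuous|exact: continuous_cos].
  under eq_integral.
    move=> t _; rewrite gee0_abs; last first.
      by rewrite lee_fin mulr_ge0 ?expabs_ge0// -lerBlDl sub0r cos_geN1.
    over.
  by rewrite integral_expabs_cos// ltry.
have -> : \int[mu]_t complex.Re (f t) = \int[mu]_t (expabs eps t * (1 + cos (2 * pi * s * t)) - expabs eps t).
  by apply: eq_Rintegral => t _; rewrite /f ReM /= !mulrA; move: (cos _) (sin _) => c d; ring.
rewrite RintegralB// /Rintegral integral_expabs_cos// integral_expabs//= /poisson.
by field; rewrite !lt0r_neq0// den_gt0.
Qed.

Lemma integral_poisson eps : 0 < eps -> (\int[mu]_s (poisson eps s)%:E = 1)%E.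
Proof.
move=> e0; rewrite ge0_integral_line_split; last 2 first.
- by apply/measurable_EFinP; exact: measurable_poisson.
- by move=> x; rewrite lee_fin poisson_ge0.
under [X in (_ + X)%E]eq_integral do rewrite poissonN.
have pi0 : 0 < pi :> R by exact: pi_gt0.
have c0 : 0 < 2 * pi / eps by rewrite divr_gt0// mulr_gt0.
(* The antiderivative atan (2 pi s / eps) / pi increases from 0 at the origin to 1/2 at +oo. *)
have D (x : R) : is_derive x 1 (fun s => pi^-1 * atan (2 * pi / eps * s)) (poisson eps x).
  have D1 : is_derive x 1 (fun s => atan (2 * pi / eps * s)) ((1 + (2 * pi / eps * x) ^+ 2)^-1 * (2 * pi / eps)).
    by apply: is_derive1_comp; apply: is_derive_eq; rewrite ?mulr0 ?addr0 /GRing.scale/= ?mulr1.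
  apply: is_derive_eq; rewrite /GRing.scale/= /poisson.
  move: (pi : R) pi0 {c0 D1} => p p0; field.
  by rewrite !lt0r_neq0//= den_gt0.
have -> : (\int[mu]_(x in `[0%R, +oo[) (poisson eps x)%:E = (2^-1)%:E)%E.
  rewrite (@ge0_continuous_FTC2y R _ (fun s => pi^-1 * atan (2 * pi / eps * s)) 0 2^-1).
  - by rewrite mulr0 atan0 mulr0 sube0.
  - by move=> x _; exact: poisson_ge0.
  - by apply: continuous_subspaceT; exact: continuous_poisson.
  - have -> : 2^-1 = pi^-1 * (pi / 2) :> R by rewrite mulrA mulVf ?mul1r// lt0r_neq0.
    apply: cvgM; first exact: cvg_cst.
    apply: (@cvg_comp _ _ _ (fun t => 2 * pi / eps * t) atan _ (pinfty_nbhs R)); last exact: cvgy_atan.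
    exact: gt0_cvgMry.
  - by move=> x _; have [] := D x.
  - apply: cvg_at_right_filter; apply: cvgM; first exact: cvg_cst.
    by apply: continuous_comp; [exact: mulrl_continuous|exact: continuous_atan].
  - by move=> x _; rewrite derive1E; have [_] := D x.
by rewrite -EFinD; congr EFin; field.
Qed.

End poisson_kernel.

(** * Continuity of translations in L1 *)

Section translation_L1.
Context {R : realType}.
Local Notation mu := (@lebesgue_measure R).

Let in_ball (A x : R) : (x \in (`[- A, A]%classic : set R)) = (`|x| <= A).
Proof. by rewrite ler_norml; apply/idP/idP; rewrite inE/= in_itv. Qed.

(** Approximation by a continuous function on a bounded interval says nothing outside it. So the
    tail of [f] beyond [k] is first made small, [f] is approximated by [g] on [-(k+1), k+1], and [g]
    is multiplied by a cutoff supported there. The bound [M] serves for domination later. *)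
Lemma integral_compact_support_approx (f : measurableTypeR R -> R) (e : R) : 0 < e ->
  mu.-integrable setT (EFin \o f) ->
  exists h : R -> R, exists A : R, exists M : R,
    [/\ continuous h, forall x, `|h x| <= M, forall x, A < `|x| -> h x = 0 &
        (\int[mu]_x `|f x - h x|%:E <= e%:E)%E].
Proof.
move=> e0 intf.
have mf : measurable_fun setT f by apply/measurable_EFinP; exact: measurable_int intf.
pose I k : set (measurableTypeR R) := `[- (k%:R : R), k%:R]%classic.
have mI k : measurable (I k) by rewrite /I; exact: measurable_itv.
(* The part of |f| outside [-k, k]; its integral tends to 0 by dominated convergence. *)
pose u k x := (`|f x| * (1 - \1_(I k) x))%:E.
have mu_ k : measurable_fun setT (u k).
  apply/measurable_EFinP; apply: measurable_funM; first exact: measurableT_comp.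
  by apply: measurable_funB.
have [k uk] : exists k : nat, (\int[mu]_x u k x <= (e / 2)%:E)%E.
  have := @dominated_convergence _ _ _ mu setT measurableT u (cst 0%E) (fun x => `|f x|%:E) mu_.
  case=> //.
  - apply: aeW => x _; apply: cvg_near_cst.
    near=> k; rewrite /u indicE mem_set ?subrr ?mulr0// /I/= in_itv/= -ler_norml.
    by apply/ltW; near: k; exact: nbhs_infty_gtr.
  - by have := integrable_abse intf; exact: eq_integrable.
  - apply: aeW => x k _; rewrite lee_fin normrM normr_id ler_piMr//.
    by rewrite indicE; case: (_ \in _); rewrite /= ?subrr ?subr0 ?normr0 ?normr1.
  - move=> _ _ /=; rewrite integral0 => uc.
    have e20 : 0 < e / 2 by rewrite divr_gt0.
    have [N _ /(_ N (leqnn N)) /= /ltW ?] := ge0_cvge0_near uc e20.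
    by exists N.
pose E : set (measurableTypeR R) := `[- (k%:R + 1 : R), k%:R + 1]%classic.
have mE : measurable E by rewrite /E; exact: measurable_itv.
have [g [cg ig gf]] : exists g : R -> R, [/\ continuous g, mu.-integrable E (EFin \o g) &
    (\int[mu]_(x in E) `|(f x - g x)%:E| <= (e / 2)%:E)%E].
  have Efin : (mu E < +oo)%E.
    by rewrite /E lebesgue_measure_itv/= -EFinD; case: ifP => // _; rewrite ltry.
  have [g_ [cg ig gc]] := approximation_continuous_integrable mE Efin (integrableS measurableT mE (@subsetT _ _) intf).
  have e20 : 0 < e / 2 by rewrite divr_gt0.
  have [N _ /(_ N (leqnn N)) /= /ltW ?] := ge0_cvge0_near gc e20.
  by exists (g_ N); split.
(* Piecewise linear cutoff: 1 for |x| <= k and 0 for |x| >= k + 1. *)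
pose chi (x : R) : R := Num.max 0 (Num.min 1 (k%:R + 1 - `|x|)).
have chi0 x : 0 <= chi x by rewrite le_max lexx.
have chi1 x : chi x <= 1 by rewrite ge_max ler01 ge_min lexx.
have cchi : continuous chi.
  move=> x; apply: (@continuous_max _ _ (fun=> 0) (fun x => Num.min 1 (k%:R + 1 - `|x|))) => //; first exact: cvg_cst.
  apply: (@continuous_min _ _ (fun=> 1) (fun x => k%:R + 1 - `|x|)) => //; first exact: cvg_cst.
  by apply: cvgB; [exact: cvg_cst|exact: norm_continuous].
pose h x := g x * chi x.
have ch : continuous h by move=> x; apply: cvgM; [exact: cg|exact: cchi].
have h0 x : k%:R + 1 < `|x| -> h x = 0.
  move=> kx; rewrite /h /chi; have -> : Num.max 0 (Num.min 1 (k%:R + 1 - `|x|)) = 0 :> R.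
    by apply/max_idPl; rewrite ge_min subr_le0 (ltW kx) orbT.
  by rewrite mulr0.
have k1 : - (k%:R + 1) <= k%:R + 1 :> R by rewrite ge0_cp ?addr_ge0.
have [c _ hc] := @EVT_max R (fun x => `|h x|) _ _ k1
  (continuous_subspaceT (fun x => continuous_comp (ch x) (@norm_continuous _ _ (h x)))).
exists h, (k%:R + 1), `|h c|; split => //.
  move=> x; have [kx|kx] := ltP (k%:R + 1) `|x|; first by rewrite h0// normr0.
  by apply: hc; rewrite in_itv/= -ler_norml.
rewrite (splitr e) EFinD.
apply: (@le_trans _ _ (\int[mu]_x u k x + \int[mu]_(x in E) `|(f x - g x)%:E|)%E); last exact: leeD.
rewrite [X in (_ + X)%E]integral_mkcond -ge0_integralD//; first last.
- apply/(measurable_restrictT _ mE).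
  apply: measurable_funTS; apply: measurableT_comp => //; apply/measurable_EFinP.
  by apply: measurable_funB => //; exact: continuous_measurable_fun.
- by move=> x _; rewrite patchE; case: ifP.
- by move=> x _; rewrite lee_fin mulr_ge0// indicE; case: (_ \in _); rewrite ?subrr ?subr0.
apply: ge0_le_integral => //.
- apply/measurable_EFinP; apply: measurableT_comp => //.
  by apply: measurable_funB => //; exact: continuous_measurable_fun.
- apply: emeasurable_funD => //; apply/(measurable_restrictT _ mE).
  apply: measurable_funTS; apply: measurableT_comp => //; apply/measurable_EFinP.
  by apply: measurable_funB => //; exact: continuous_measurable_fun.
suff H : forall x : R, (`|f x - h x|%:E <= u k x + ((fun x0 => `|(f x0 - g x0)%:E|) \_ E) x)%E.
  by move=> x _; exact: H.
move=> x; rewrite patchE in_ball /u indicE in_ball; have [kx|kx] := leP `|x| k%:R.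
  have -> : h x = g x.
    rewrite /h /chi; have -> : Num.min 1 (k%:R + 1 - `|x|) = 1 :> R.
      by apply/min_idPl; rewrite addrAC lerDr subr_ge0.
    by rewrite (_ : Num.max 0 1 = 1) ?mulr1//; apply/max_idPr.
  by rewrite ifT ?(le_trans kx) ?lerDl// subrr mulr0 add0e.
rewrite subr0 mulr1; case: ifPn => [kx1|]; last first.
  by rewrite -ltNge => kx1; rewrite h0// subr0 adde0.
rewrite -EFinD lee_fin.
(* On the transition zone both weights [1 - chi x] and [chi x] lie in [0, 1], so the two errors
   simply add. *)
have -> : f x - h x = f x * (1 - chi x) + (f x - g x) * chi x by rewrite /h; ring.
apply: (le_trans (ler_normD _ _)); rewrite !normrM lerD// ler_piMr//.
  by rewrite ger0_norm ?subr_ge0// gerBl.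
by rewrite ger0_norm.
Unshelve. all: by end_near. Qed.

(** Replace [f] by a continuous compactly supported [h] at a cost of e/4 on either side of the
    difference. The bound [S] on the shifts keeps the supports of all translates of [h] in one
    interval, which is what dominated convergence needs. *)
Lemma translation_cvg_L1 (f : measurableTypeR R -> R) (s : nat -> R) (S : R) :
  mu.-integrable setT (EFin \o f) -> (forall k, `|s k| <= S) -> s k @[k --> \oo] --> 0 ->
  (\int[mu]_x `|f (x - s k) - f x|%:E)%E @[k --> \oo] --> 0%E.
Proof.
move=> intf sS s0.
have mf : measurable_fun setT f by apply/measurable_EFinP; exact: measurable_int intf.
have msub k : measurable_fun [set: measurableTypeR R] (fun x : measurableTypeR R => x - s k : measurableTypeR R).
  by apply: measurable_funB.
apply: ge0_cvge0P => [k|e e0]; first by apply: integral_ge0.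
have e40 : 0 < e / 4 by rewrite divr_gt0.
have [h [A [M [ch hM hA hf]]]] := integral_compact_support_approx e40 intf.
have mh : measurable_fun [set: measurableTypeR R] h by exact: continuous_measurable_fun.
have hcvg : (\int[mu]_x `|h (x - s k) - h x|%:E)%E @[k --> \oo] --> 0%E.
  (* Contains the support of [h], which lies in [-A, A], together with all its translates. *)
  pose J : set (measurableTypeR R) := `[- (A + S), A + S]%classic.
  have := @dominated_convergence _ _ _ mu setT measurableT
    (fun k x => `|h (x - s k) - h x|%:E) (cst 0%E) (fun x => (2 * M * \1_J x)%:E).
  case=> //.
  - move=> k; apply/measurable_EFinP; apply: measurableT_comp => //.
    by apply: measurable_funB => //; exact: (measurableT_comp mh (msub k)).
  - apply: aeW => x _; apply: cvg_EFin; first exact: nearW.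
    suff hc : h (x - s k) - h x @[k --> \oo] --> 0 by exact/(norm_cvg0P (fun k => h (x - s k) - h x)).
    rewrite -(subrr (h x)); apply: cvgB; last exact: cvg_cst.
    apply: (@cvg_comp _ _ _ (fun k => x - s k) h _ (nbhs x)); last exact: ch.
    by rewrite -{2}[x]subr0; apply: cvgB; [exact: cvg_cst|].
  - under eq_fun do rewrite EFinM; apply: integrableZl => //; exact: integrable_indic_itv.
  - apply: aeW => x k _; rewrite gee0_abs ?lee_fin//.
    rewrite indicE in_ball.
    have [xA|xA] := leP `|x| (A + S).
      by rewrite mulr1 mulr_natl mulr2n (le_trans (ler_normB _ _))// lerD.
    rewrite mulr0 !hA ?subrr ?normr0//.
      by apply: le_lt_trans xA; rewrite lerDl (le_trans _ (sS 0%N)).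
    rewrite -(ltrD2r S); apply: (lt_le_trans xA).
    rewrite -{1}(subrK (s k) x) (le_trans (ler_normD _ _))// lerD2l; exact: sS.
  by move=> _ _; rewrite /= integral0.
have e20 : 0 < e / 2 by rewrite divr_gt0.
near=> k.
have hk : (\int[mu]_x `|h (x - s k) - h x|%:E <= (e / 2)%:E)%E.
  by apply/ltW; near: k; exact: ge0_cvge0_near.
have mfh : measurable_fun setT (fun x => `|f x - h x|%:E).
  by apply/measurable_EFinP; apply: measurableT_comp => //; exact: measurable_funB.
have mfhs : measurable_fun setT (fun x : measurableTypeR R => `|f (x - s k) - h (x - s k)|%:E).
  exact: (measurableT_comp mfh (msub k)).
have mhs : measurable_fun setT (fun x : measurableTypeR R => `|h (x - s k) - h x|%:E).
  apply/measurable_EFinP; apply: measurableT_comp => //.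
  by apply: measurable_funB => //; exact: (measurableT_comp mh (msub k)).
have shift : (\int[mu]_x `|f (x - s k) - h (x - s k)|%:E = \int[mu]_x `|f x - h x|%:E)%E.
  have nn (x : measurableTypeR R) : (0 <= `|f x - h x|%:E)%E by rewrite lee_fin.
  have := @ge0_integral_affine R 1 (- s k) _ (oner_neq0 _) mfh nn.
  rewrite normr1 invr1 mul1e => <-//.
  by apply: eq_integral => x _; rewrite mul1r.
apply: (@le_trans _ _ (\int[mu]_x (`|f (x - s k) - h (x - s k)|%:E + (`|h (x - s k) - h x|%:E + `|f x - h x|%:E)))%E).
  apply: ge0_le_integral => //.
  - apply/measurable_EFinP; apply: measurableT_comp => //.
    by apply: measurable_funB => //; exact: (measurableT_comp mf (msub k)).
  - by apply: emeasurable_funD => //; exact: emeasurable_funD.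
  - move=> x _; rewrite -!EFinD lee_fin -(distrC (h x)) addrA.
    rewrite -{1}(subrKA (h (x - s k))) -addrA -(subrKA (h x) (h (x - s k))) addrA.
    apply: (le_trans (ler_normD _ _)); rewrite -addrA lerD2l; apply: le_trans (ler_normD _ _) _.
    by rewrite (distrC (h x) (f x)) (distrC (h (x - s k))).
rewrite ge0_integralD//; last 2 first.
- by move=> x _; rewrite adde_ge0.
- by apply: emeasurable_funD.
rewrite ge0_integralD// shift.
have -> : e%:E = ((e / 4)%:E + ((e / 2)%:E + (e / 4)%:E))%E.
  by rewrite -!EFinD; congr EFin; field.
by apply: leeD => //; exact: leeD.
Unshelve. all: by end_near. Qed.

Lemma translation_cvg_L1C (f : measurableTypeR R -> R[i]) (s : nat -> R) (S : R) :
  cintegrable mu f -> (forall k, `|s k| <= S) -> s k @[k --> \oo] --> 0 ->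
  (\int[mu]_x (Normc.normc (f (x - s k) - f x))%:E)%E @[k --> \oo] --> 0%E.
Proof.
move=> cf sS s0; have mf := cf.1.
have msub k : measurable_fun [set: measurableTypeR R] (fun x : measurableTypeR R => x - s k : measurableTypeR R).
  by apply: measurable_funB.
have r0 := translation_cvg_L1 (cintegrable_Re cf) sS s0.
have i0 := translation_cvg_L1 (cintegrable_Im cf) sS s0.
have mD (g : measurableTypeR R -> R) : measurable_fun setT g -> forall k, measurable_fun setT (fun x : measurableTypeR R => `|g (x - s k) - g x|%:E).
  move=> mg k; apply/measurable_EFinP; apply: measurableT_comp => //.
  by apply: measurable_funB => //; exact: (measurableT_comp mg (msub k)).
apply: ge0_cvge0_leD r0 i0 => k; first by apply: integral_ge0 => x _; rewrite lee_fin normc_ge0.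
rewrite -ge0_integralD//; last 2 first.
- by apply: mD; exact: measurable_funRe.
- by apply: mD; exact: measurable_funIm.
apply: ge0_le_integral => //.
- by move=> x _; rewrite lee_fin normc_ge0.
- by apply: measurable_normcE; apply: measurable_funcB => //; exact: (measurableT_comp mf (msub k)).
- by apply: emeasurable_funD; apply: mD; [exact: measurable_funRe|exact: measurable_funIm].
- move=> x _; rewrite -EFinD lee_fin; apply: le_trans (normc_leReIm _) _.
  by case: (f (x - s k)) (f x) => a b [].
Qed.

End translation_L1.

Section plancherel_line.
Context {R : realType}.
Local Notation mu := (@lebesgue_measure R).
Local Notation T := (measurableTypeR R).
Implicit Types (phi : T -> R[i]) (eps : R).

Definition fourier_line phi (gamma : T) : R[i] := cint mu (fun x => phi x * cis (- (gamma * x))).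

Definition poisson_conv phi eps (x : T) : R[i] :=
  cint mu (fun y => phi y * (poisson eps (x - y))%:C%C).

Lemma measurable_fourier_line phi : measurable_fun setT phi -> measurable_fun setT (fourier_line phi).
Proof.
move=> mphi.
apply: (@measurable_cint1 _ _ _ _ _ mu (fun p : T * T => phi p.2 * cis (- (p.1 * p.2)))).
apply: measurable_funcM; first exact: (measurableT_comp mphi measurable_snd).
by apply: measurable_fun_cis; apply: measurableT_comp => //; apply: measurable_funM.
Qed.

Lemma measurable_poisson_conv phi eps : 0 < eps -> measurable_fun setT phi ->
  measurable_fun setT (poisson_conv phi eps).
Proof.
move=> e0 mphi.
apply: (@measurable_cint1 _ _ _ _ _ mu (fun p : T * T => phi p.2 * (poisson eps (p.1 - p.2))%:C%C)).
apply: measurable_funcM; first exact: (measurableT_comp mphi measurable_snd).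
apply: measurable_fun_realc; apply: (measurableT_comp (measurable_poisson e0)).
by apply: measurable_funB.
Qed.

Lemma normc_fourier_line_le phi gamma : cintegrable mu phi ->
  ((Normc.normc (fourier_line phi gamma))%:E <= \int[mu]_x (Normc.normc (phi x))%:E)%E.
Proof.
move=> [mphi _]; apply: le_trans (normc_cint_le _ _) _.
  apply: measurable_funcM => //.
  by apply: measurable_fun_cis; apply: measurableT_comp => //; apply: measurable_funM.
by under eq_integral do rewrite Normc.normcM normc_cis mulr1.
Qed.

Lemma cintegrable_fourier_damped phi eps : 0 < eps -> cintegrable mu phi ->
  cintegrable mu (fun gamma => fourier_line phi gamma * (expabs eps gamma)%:C%C).
Proof.
move=> e0 cphi; have mphi := cphi.1.
pose C := (\int[mu]_x (Normc.normc (phi x))%:E)%E.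
have C0 : (0 <= C)%E by apply: integral_ge0 => x _; rewrite lee_fin normc_ge0.
have mE : measurable_fun setT (fun t : T => (expabs eps t)%:E) by apply/measurable_EFinP; exact: measurable_expabs.
apply: (@le_cintegrable _ _ _ mu _ (fun gamma : T => (C * (expabs eps gamma)%:E)%E)).
- apply: measurable_funcM; first exact: measurable_fourier_line.
  by apply: measurable_fun_realc; exact: measurable_expabs.
- by apply: emeasurable_funM.
- move=> g; rewrite Normc.normcM EFinM normc_real ger0_norm ?expabs_ge0//.
  by apply: lee_wpmul2r; [rewrite lee_fin expabs_ge0|exact: normc_fourier_line_le].
- rewrite ge0_integralZl//; last by move=> x _; rewrite lee_fin expabs_ge0.
  rewrite integral_expabs// lte_mul_pinfty ?ge0_fin_numE ?ltry//.
  exact: cphi.2.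
Qed.

(** The damping makes the double integral absolutely convergent; integrating the frequency first
    produces the Fourier transform of [expabs eps] at x - y, which is the Poisson kernel. *)
Lemma cint_fourier_damped phi eps x : 0 < eps -> cintegrable mu phi ->
  cint mu (fun gamma => fourier_line phi gamma * (expabs eps gamma)%:C%C * cis (gamma * x)) =
  poisson_conv phi eps x.
Proof.
move=> e0 cphi.
pose f (p : T * T) := (expabs eps p.1)%:C%C * phi p.2 * cis (p.1 * (x - p.2)).
have cf : cintegrable (mu \x mu)%E f.
  apply: (cintegrable_tensor (cintegrable_expabs e0) cphi) => [|p]; last by rewrite normc_cis.
  by apply: measurable_fun_cis; apply: measurable_funM => //; apply: measurable_funB.
have cphic g : cintegrable mu (fun y => phi y * cis (- (g * y))).
  apply: cintegrableM_bounded => //; last by move=> y; rewrite normc_cis.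
  by apply: measurable_fun_cis; apply: measurableT_comp => //; apply: measurable_funM.
transitivity (cint mu (fun g => cint mu (fun y => f (g, y)))).
  apply: eq_cint => g; rewrite /fourier_line -mulrA -cintZr//.
  by apply: eq_cint => y; rewrite /f /= mulrBr cisD; ring.
rewrite cint_swap//; apply: eq_cint => y; rewrite /f /= -(cint_expabs_cis _ e0) -cintZ.
  by apply: eq_cint => g; rewrite (mulrC g (x - y)); ring.
apply: cintegrableM_bounded; first exact: cintegrable_expabs.
  by apply: measurable_fun_cis; apply: measurable_funM.
by move=> g; rewrite normc_cis.
Qed.

Lemma integral_poisson_shift eps x : 0 < eps -> (\int[mu]_y (poisson eps (x - y))%:E = 1)%E.
Proof.
move=> e0; have mp : measurable_fun setT (fun y : T => (poisson eps y)%:E).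
  by apply/measurable_EFinP; exact: measurable_poisson.
have p0 y : (0 <= (poisson eps y)%:E)%E by rewrite lee_fin poisson_ge0.
have N10 : -1 != 0 :> R by rewrite oppr_eq0 oner_eq0.
have := ge0_integral_affine x N10 mp p0; rewrite normrN1 invr1 mul1e integral_poisson// => <-.
by apply: eq_integral => y _; rewrite mulN1r addrC.
Qed.

Lemma integral_sqr_normc_poisson phi eps : 0 < eps -> measurable_fun setT phi ->
  (\int[mu]_x \int[mu]_y (Normc.normc (phi x) ^+ 2 * poisson eps (x - y))%:E =
   \int[mu]_x (Normc.normc (phi x) ^+ 2)%:E)%E.
Proof.
move=> e0 mphi; apply: eq_integral => x _; under eq_integral do rewrite EFinM.
rewrite ge0_integralZl ?lee_fin ?exprn_ge0 ?normc_ge0//.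
- by rewrite integral_poisson_shift// mule1.
- apply/measurable_EFinP; apply: (measurableT_comp (measurable_poisson e0)).
  by apply: measurable_funB.
- by move=> y _; rewrite lee_fin poisson_ge0.
Qed.

Lemma normc_poisson_conv_le phi eps x : 0 < eps -> measurable_fun setT phi ->
  ((Normc.normc (poisson_conv phi eps x))%:E <= \int[mu]_y (Normc.normc (phi y) * poisson eps (x - y))%:E)%E.
Proof.
move=> e0 mphi; apply: le_trans (normc_cint_le _ _) _.
  apply: measurable_funcM => //; apply: measurable_fun_realc.
  by apply: (measurableT_comp (measurable_poisson e0)); apply: measurable_funB.
by under eq_integral do rewrite Normc.normcM normc_real ger0_norm ?poisson_ge0//.
Qed.

(* The left-hand side is <phi, P_eps phi>; use 2 |phi x| |phi y| <= |phi x|^2 + |phi y|^2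
   under the unit-mass kernel P_eps. *)
Lemma integral_damped_energy_le phi eps : 0 < eps -> cintegrable mu phi ->
  (\int[mu]_g (Normc.normc (fourier_line phi g) ^+ 2 * expabs eps g)%:E <=
   \int[mu]_x (Normc.normc (phi x) ^+ 2)%:E)%E.
Proof.
move=> e0 cphi; have mphi := cphi.1.
pose a g := fourier_line phi g * (expabs eps g)%:C%C.
have ca : cintegrable mu a by exact: cintegrable_fourier_damped.
have cb := cintegrable_conjc cphi.
pose f (p : T * T) := a p.1 * conjc (phi p.2) * cis (p.1 * p.2).
have mc : measurable_fun setT (fun p : T * T => cis (p.1 * p.2)).
  by apply: measurable_fun_cis; apply: measurable_funM.
have cf : cintegrable (mu \x mu)%E f.
  by apply: (cintegrable_tensor ca cb) => // p; rewrite normc_cis.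
pose w g := Normc.normc (fourier_line phi g) ^+ 2 * expabs eps g.
have w0 g : 0 <= w g by rewrite mulr_ge0 ?exprn_ge0 ?normc_ge0 ?expabs_ge0.
have mw : measurable_fun setT w.
  apply: measurable_funM; last exact: measurable_expabs.
  by apply/measurable_funX/measurable_fun_normc; exact: measurable_fourier_line.
(* One factor of |phi^|^2 stays damped as [a]; the conjugate of the other is expanded as an integral
   over x. After the exchange, the integral over the frequency is [poisson_conv phi eps x]. *)
have E1 : cint mu (fun g => (w g)%:C%C) = cint mu (fun x => conjc (phi x) * poisson_conv phi eps x).
  transitivity (cint mu (fun g => cint mu (fun y => f (g, y)))).
    apply: eq_cint => g.
    have -> : (w g)%:C%C = a g * conjc (fourier_line phi g).
      by rewrite /a mulrAC mulc_conjc /w rmorphM.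
    have cg : cintegrable mu (fun y => phi y * cis (- (g * y))).
      apply: cintegrableM_bounded => //; last by move=> y; rewrite normc_cis.
      by apply: measurable_fun_cis; apply: measurableT_comp => //; apply: measurable_funM.
    rewrite /fourier_line -cint_conjc// -cintZ; last exact: cintegrable_conjc.
    by apply: eq_cint => y; rewrite /f conjcM conjc_cis opprK mulrA.
  rewrite cint_swap//; apply: eq_cint => x.
  rewrite -cint_fourier_damped// -cintZ.
    by apply: eq_cint => g; rewrite /f /= /a; ring.
  apply: cintegrableM_bounded => //; last by move=> y; rewrite normc_cis.
  by apply: measurable_fun_cis; apply: measurable_funM.
(* The transform is bounded by the L1 norm [C], hence [w] by [C] times |a|. Finiteness lets the real
   integral in [E1] be read back as an extended one. *)
have iw : mu.-integrable setT (EFin \o w).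
  apply/integrableP; split; first exact/measurable_EFinP.
  pose C := (\int[mu]_x (Normc.normc (phi x))%:E)%E.
  have C0 : (0 <= C)%E by apply: integral_ge0 => x _; rewrite lee_fin normc_ge0.
  apply: (@le_lt_trans _ _ (\int[mu]_g (C * (Normc.normc (a g))%:E))%E).
    apply: ge0_le_integral => //.
    - by apply/measurable_EFinP; apply: measurableT_comp.
    - by apply: emeasurable_funM => //; exact: measurable_normcE ca.1.
    - move=> g _; rewrite gee0_abs; last by rewrite lee_fin.
      rewrite /comp /w /a Normc.normcM normc_real ger0_norm ?expabs_ge0//.
      rewrite expr2 -mulrA EFinM; apply: lee_wpmul2r; last exact: normc_fourier_line_le.
      by rewrite lee_fin mulr_ge0 ?normc_ge0 ?expabs_ge0.
  rewrite ge0_integralZl//; last 2 first.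
  - exact: measurable_normcE ca.1.
  - by move=> x _; rewrite lee_fin normc_ge0.
  rewrite lte_mul_pinfty ?ge0_fin_numE//; first exact: cphi.2.
  exact: ca.2.
have Rw0 : 0 <= \int[mu]_g w g by apply: Rintegral_ge0.
have mP := measurable_poisson_conv e0 mphi.
apply: (@le_trans _ _ (\int[mu]_x (Normc.normc (conjc (phi x) * poisson_conv phi eps x))%:E)%E).
  apply: le_trans (normc_cint_le mu _); last by apply: measurable_funcM => //; exact: measurable_fun_conjc.
  rewrite -E1 cint_real normc_real ger0_norm// /Rintegral fineK//.
  exact: (integrable_fin_num measurableT iw).
have mpb : measurable_fun setT (fun p : T * T => poisson eps (p.1 - p.2)).
  by apply: (measurableT_comp (measurable_poisson e0)); apply: measurable_funB.
have mn1 : measurable_fun setT (fun p : T * T => Normc.normc (phi p.1)).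
  exact: (measurableT_comp (measurable_fun_normc mphi) measurable_fst).
have mn2 : measurable_fun setT (fun p : T * T => Normc.normc (phi p.2)).
  exact: (measurableT_comp (measurable_fun_normc mphi) measurable_snd).
pose F1 (p : T * T) := (Normc.normc (phi p.1) ^+ 2 * poisson eps (p.1 - p.2))%:E.
pose F2 (p : T * T) := (Normc.normc (phi p.2) ^+ 2 * poisson eps (p.1 - p.2))%:E.
have F10 p : (0 <= F1 p)%E by rewrite lee_fin mulr_ge0 ?poisson_ge0// exprn_ge0 ?normc_ge0.
have F20 p : (0 <= F2 p)%E by rewrite lee_fin mulr_ge0 ?poisson_ge0// exprn_ge0 ?normc_ge0.
have mF1 : measurable_fun setT F1 by apply/measurable_EFinP; apply: measurable_funM => //; exact: measurable_funX.
have mF2 : measurable_fun setT F2 by apply/measurable_EFinP; apply: measurable_funM => //; exact: measurable_funX.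
have half0 : (0 <= (2^-1)%:E :> \bar R)%E by rewrite lee_fin invr_ge0.
apply: (@le_trans _ _ (\int[mu]_x \int[mu]_y ((2^-1)%:E * (F1 (x, y) + F2 (x, y))))%E).
  apply: ge0_le_integral => //.
  - by move=> x _; rewrite lee_fin normc_ge0.
  - by apply: measurable_normcE; apply: measurable_funcM => //; exact: measurable_fun_conjc.
  - apply: (measurable_fun_fubini_tonelli_F (m2 := mu) (fun p => (2^-1)%:E * (F1 p + F2 p)))%E.
      by apply: emeasurable_funM => //; exact: emeasurable_funD.
    by move=> p; rewrite mule_ge0// adde_ge0.
  - move=> x _; rewrite Normc.normcM normc_conjc EFinM.
    apply: (@le_trans _ _ ((Normc.normc (phi x))%:E * \int[mu]_y (Normc.normc (phi y) * poisson eps (x - y))%:E)%E).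
      by apply: lee_wpmul2l; [rewrite lee_fin normc_ge0|exact: normc_poisson_conv_le].
    have mq : measurable_fun setT (fun y : T => poisson eps (x - y)).
      by apply: (measurableT_comp (measurable_poisson e0)); apply: measurable_funB.
    have mk : measurable_fun setT (fun y : T => (Normc.normc (phi y) * poisson eps (x - y))%:E).
      by apply/measurable_EFinP; apply: measurable_funM => //; exact: measurable_fun_normc.
    rewrite -ge0_integralZl ?lee_fin ?normc_ge0//; last by move=> y _; rewrite lee_fin mulr_ge0 ?normc_ge0 ?poisson_ge0.
    apply: ge0_le_integral => //.
    - move=> y _; apply: mule_ge0; first by rewrite lee_fin normc_ge0.
      by rewrite lee_fin mulr_ge0 ?normc_ge0 ?poisson_ge0.
    - by apply: emeasurable_funM.
    - apply: emeasurable_funM => //; apply: emeasurable_funD;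
        apply/measurable_EFinP; apply: measurable_funM => //.
        exact: (measurable_cst (Normc.normc (phi x) ^+ 2)).
      by apply: measurable_funX; exact: measurable_fun_normc.
    - move=> y _; rewrite -EFinM /F1 /F2 -EFinD -EFinM lee_fin.
      change (Normc.normc (phi x) * (Normc.normc (phi y) * poisson eps (x - y)) <=
        2^-1 * (Normc.normc (phi x) ^+ 2 * poisson eps (x - y) + Normc.normc (phi y) ^+ 2 * poisson eps (x - y))).
      move: (poisson eps _) (poisson_ge0 (x - y) e0) => K nK.
      move: (Normc.normc (phi x)) (Normc.normc (phi y)) => p q.
      rewrite -subr_ge0.
      have -> : 2^-1 * (p ^+ 2 * K + q ^+ 2 * K) - p * (q * K) = 2^-1 * ((p - q) ^+ 2 * K) by field.
      by rewrite mulr_ge0 ?invr_ge0// mulr_ge0// sqr_ge0.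
have mFx F : measurable_fun setT F -> forall x : T, measurable_fun setT (fun y : T => F (x, y) : \bar R).
  by move=> mF x; apply: (measurableT_comp mF); exact: pair1_measurable.
under eq_integral => x _.
  rewrite ge0_integralZl//; last 2 first.
    by apply: emeasurable_funD; exact: mFx.
    by move=> y _; rewrite adde_ge0.
  rewrite ge0_integralD//; [|exact: mFx|exact: mFx].
  over.
rewrite ge0_integralZl//; last 2 first.
- by apply: emeasurable_funD; exact: (measurable_fun_fubini_tonelli_F (m2 := mu)).
- by move=> x _; rewrite adde_ge0// integral_ge0.
rewrite ge0_integralD//; last 4 first.
- by move=> x _; rewrite integral_ge0.
- exact: (measurable_fun_fubini_tonelli_F (m2 := mu)).
- by move=> x _; rewrite integral_ge0.
- exact: (measurable_fun_fubini_tonelli_F (m2 := mu)).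
(* Exchanging the variables in the second term and using that the kernel is even makes both terms
   equal to the energy of phi. *)
rewrite [X in (_ * (_ + X))%E](fubini_tonelli (m1 := mu) (m2 := mu) F2)//.
have I1 : (\int[mu]_x \int[mu]_y F1 (x, y) = \int[mu]_x (Normc.normc (phi x) ^+ 2)%:E)%E.
  by rewrite -(integral_sqr_normc_poisson e0 mphi); apply: eq_integral => x _; apply: eq_integral => y _.
have I2 : (\int[mu]_y \int[mu]_x F2 (x, y) = \int[mu]_x (Normc.normc (phi x) ^+ 2)%:E)%E.
  rewrite -(integral_sqr_normc_poisson e0 mphi); apply: eq_integral => y _; apply: eq_integral => x _.
  by rewrite /F2 -poissonN opprB.
rewrite I1 I2 -mule2n -mule_natl muleA -EFinM mulVf ?mul1e//.
Qed.

(** The damping exp(-|g| / (k + 1)) tends to 1, and the bound on the damped energy is uniform in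
    k. *)
Lemma integral_sqr_fourier_line_le phi : cintegrable mu phi ->
  (\int[mu]_g (Normc.normc (fourier_line phi g) ^+ 2)%:E <= \int[mu]_x (Normc.normc (phi x) ^+ 2)%:E)%E.
Proof.
move=> cphi; have mF := measurable_fourier_line cphi.1.
pose F k g := (Normc.normc (fourier_line phi g) ^+ 2 * expabs k.+1%:R^-1 g)%:E.
apply: (@cvg_integral_le _ _ _ mu F) => //.
- move=> k; apply/measurable_EFinP; apply: measurable_funM; last exact: measurable_expabs.
  by apply: measurable_funX; exact: measurable_fun_normc.
- by move=> k g; rewrite lee_fin mulr_ge0 ?expabs_ge0// exprn_ge0 ?normc_ge0.
- move=> g; apply: cvg_EFin; first exact: nearW.
  rewrite -[X in _ --> X]mulr1; apply: cvgM; first exact: cvg_cst.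
  rewrite -[X in _ --> X]expR0.
  apply: (@cvg_comp _ _ _ (fun k => - (k.+1%:R^-1 * `|g : R|)) expR _ (nbhs (0 : R))); last exact: continuous_expR.
  have gc : k.+1%:R^-1 * `|g : R| @[k --> \oo] --> (0 * `|g : R| : R).
    by apply: cvgM; [exact: cvg_harmonic|exact: cvg_cst].
  have := cvgN gc; rewrite mul0r oppr0; exact.
- by apply: nearW => k; exact: integral_damped_energy_le.
Qed.

(* P_eps phi is the (reflected) Fourier transform of the damped function phi^ exp(-eps |g|). *)
Lemma integral_sqr_poisson_conv_le phi eps : 0 < eps -> cintegrable mu phi ->
  (\int[mu]_x (Normc.normc (poisson_conv phi eps x) ^+ 2)%:E <=
   \int[mu]_g (Normc.normc (fourier_line phi g) ^+ 2)%:E)%E.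
Proof.
move=> e0 cphi; have ca := cintegrable_fourier_damped e0 cphi.
have mF := measurable_fourier_line cphi.1.
pose a g := fourier_line phi g * (expabs eps g)%:C%C.
have H x : Normc.normc (poisson_conv phi eps x) = Normc.normc (fourier_line (fun g => conjc (a g)) x).
  rewrite -cint_fourier_damped// -[LHS]normc_conjc -cint_conjc.
    congr Normc.normc; apply: eq_cint => g; rewrite conjcM conjc_cis -/(a g).
    by congr (_ * cis (- _)); rewrite mulrC.
  apply: cintegrableM_bounded => //; last by move=> y; rewrite normc_cis.
  by apply: measurable_fun_cis; apply: measurable_funM.
under eq_integral do rewrite H.
apply: le_trans (integral_sqr_fourier_line_le (cintegrable_conjc ca)) _.
apply: ge0_le_integral => //.
- by move=> x _; rewrite lee_fin exprn_ge0 ?normc_ge0.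
- by apply: measurable_sqr_normc; apply: measurable_fun_conjc; exact: ca.1.
- exact: measurable_sqr_normc.
- move=> g _; rewrite lee_fin normc_conjc Normc.normcM normc_real ger0_norm ?expabs_ge0//.
  rewrite ler_pXn2r ?nnegrE ?mulr_ge0 ?normc_ge0 ?expabs_ge0//.
  by rewrite ler_piMr ?normc_ge0// expabs_le1.
Qed.

(** The substitution y = x - eps t writes P_eps phi as the mean of the translates phi(x - eps t)
    with weight P_1(t). The L1 distance to phi is then at most the mean of the translation errors
    [om k t], which tend to 0 for each t and are bounded by 2 C. *)
Lemma cvg_poisson_conv phi : cintegrable mu phi ->
  (\int[mu]_x (Normc.normc (phi x - poisson_conv phi k.+1%:R^-1 x))%:E)%E @[k --> \oo] --> 0%E.
Proof.
move=> cphi; have mphi := cphi.1.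
pose e k : R := k.+1%:R^-1.
have e0 k : 0 < e k by rewrite invr_gt0.
pose om k (t : T) := (\int[mu]_x (Normc.normc (phi (x - e k * t) - phi x))%:E)%E.
pose D k (p : T * T) := Normc.normc (phi (p.2 - e k * p.1) - phi p.2).
have mD k : measurable_fun setT (D k).
  apply: measurable_fun_normc; apply: measurable_funcB; last exact: (measurableT_comp mphi measurable_snd).
  apply: (measurableT_comp mphi); apply: measurable_funB => //; exact: measurable_funM.
have D0 k p : (0 <= (D k p)%:E)%E by rewrite lee_fin normc_ge0.
have om0 k t : (0 <= om k t)%E by apply: integral_ge0 => x _; rewrite lee_fin normc_ge0.
have mom k : measurable_fun setT (om k).
  apply: (measurable_fun_fubini_tonelli_F (m2 := mu) (EFin \o D k)).
    exact/measurable_EFinP.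
  exact: D0.
pose C := (\int[mu]_x (Normc.normc (phi x))%:E)%E.
have C0 : (0 <= C)%E by apply: integral_ge0 => x _; rewrite lee_fin normc_ge0.
have Cfin : C \is a fin_num by rewrite ge0_fin_numE//; exact: cphi.2.
have mshift a : measurable_fun setT (fun x : T => x - a : T) by exact: measurable_funB.
have omC k t : (om k t <= 2%:E * C)%E.
  have shift : (\int[mu]_x (Normc.normc (phi (x - e k * t)%R))%:E = C)%E.
    have nn (x : T) : (0 <= (Normc.normc (phi x))%:E)%E by rewrite lee_fin normc_ge0.
    have := @ge0_integral_affine R 1 (- (e k * t)) _ (oner_neq0 _) (measurable_normcE mphi) nn.
    by rewrite normr1 invr1 mul1e => h; rewrite /C -h; apply: eq_integral => x _; rewrite mul1r.
  apply: (@le_trans _ _ (\int[mu]_x ((Normc.normc (phi (x - e k * t)%R))%:E + (Normc.normc (phi x))%:E))%E).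
    apply: ge0_le_integral => //.
    - by move=> x _; rewrite lee_fin normc_ge0.
    - by apply: measurable_normcE; apply: measurable_funcB => //; exact: (measurableT_comp mphi (mshift _)).
    - apply: emeasurable_funD; first by apply: measurable_normcE; exact: (measurableT_comp mphi (mshift _)).
      exact: measurable_normcE.
    - by move=> x _; rewrite -EFinD lee_fin ler_normcB.
  rewrite ge0_integralD//.
  - by rewrite shift mule_natl mule2n.
  - by move=> x _; rewrite lee_fin normc_ge0.
  - by apply: measurable_normcE; exact: (measurableT_comp mphi (mshift _)).
  - by move=> x _; rewrite lee_fin normc_ge0.
  - exact: measurable_normcE.
have mK : measurable_fun setT (fun t : T => (poisson 1 t)%:E).
  by apply/measurable_EFinP; exact: measurable_poisson.
have K0 t : (0 <= (poisson 1 t)%:E :> \bar R)%E by rewrite lee_fin poisson_ge0.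
have lim0 : (\int[mu]_t (om k t * (poisson 1 t)%:E))%E @[k --> \oo] --> 0%E.
  have := @dominated_convergence _ _ _ mu setT measurableT
    (fun k t => om k t * (poisson 1 t)%:E)%E (cst 0%E) (fun t => 2%:E * C * (poisson 1 t)%:E)%E.
  case=> //.
  - by move=> k; exact: emeasurable_funM.
  - apply: aeW => t _; rewrite /= -(mul0e (poisson 1 t)%:E); apply: cvgeZr => //.
    apply: (@translation_cvg_L1C _ _ (fun k => e k * t) `|t : R|) => //.
    + move=> k; rewrite normrM ler_piMl// ger0_norm ?(ltW (e0 k))// /e.
      by rewrite invf_le1 ?ltr0n// ler1n.
    + rewrite -(mul0r (t : R)); apply: cvgM; [exact: cvg_harmonic|exact: cvg_cst].
  - apply/integrableP; split; first exact: emeasurable_funM.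
    under eq_integral do rewrite gee0_abs ?mule_ge0//.
    rewrite ge0_integralZl ?mule_ge0// integral_poisson// mule1 -ge0_fin_numE ?mule_ge0//.
    by rewrite fin_numM.
  - apply: aeW => t k _; rewrite gee0_abs ?mule_ge0//.
    exact: lee_wpmul2r.
  by move=> _ _; rewrite /= integral0.
apply: ge0_cvge0_le lim0 => k; first by apply: integral_ge0 => x _; rewrite lee_fin normc_ge0.
have mP := measurable_poisson_conv (e0 k) mphi.
have ek0 := lt0r_neq0 (e0 k).
have convE x : cintegrable mu (fun t => (poisson 1 t)%:C%C * phi (x - e k * t)) /\
    poisson_conv phi (e k) x = cint mu (fun t => (poisson 1 t)%:C%C * phi (x - e k * t)).
  pose F (y : T) := (e k)%:C%C * (phi y * (poisson (e k) (x - y))%:C%C).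
  have cF0 : cintegrable mu (fun y => phi y * (poisson (e k) (x - y))%:C%C).
    (* The kernel is at most 2 / eps, so rescaling by eps / 2 brings it below 1, the bound that
       [cintegrableM_bounded] asks for. *)
    have -> : (fun y => phi y * (poisson (e k) (x - y))%:C%C) =
      (fun y => (2 / e k)%:C%C * (phi y * (e k / 2 * poisson (e k) (x - y))%:C%C)).
      apply/funext => y; rewrite mulrCA -rmorphM/= mulrA; congr (_ * _%:C%C).
      by field.
    apply: cintegrableZ; apply: cintegrableM_bounded => //.
      apply: measurable_fun_realc; apply: measurable_funM => //.
      by apply: (measurableT_comp (measurable_poisson (e0 k))); apply: measurable_funB.
    move=> y; rewrite normc_real ger0_norm; last by rewrite mulr_ge0 ?poisson_ge0// divr_ge0// ltW.
    rewrite /poisson mulrA; have -> : e k / 2 * (2 * e k) = e k ^+ 2 by field.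
    by rewrite ler_pdivrMr ?mul1r ?lerDl ?sqr_ge0// ltr_wpDr ?sqr_ge0// exprn_gt0.
  have ekN : - e k != 0 by rewrite oppr_eq0.
  have FE t : F (affine (- e k) x t) = (poisson 1 t)%:C%C * phi (x - e k * t).
    rewrite /F /affine; have -> : - e k * t + x = x - e k * t by rewrite mulNr addrC.
    rewrite mulrCA mulrC -rmorphM/=; congr (_%:C%C * _).
    by rewrite opprB addrCA subrr addr0 poisson_scale.
  have affE (G : T -> \bar R) : measurable_fun setT G -> (forall y, (0 <= G y)%E) ->
      (\int[mu]_y G (affine (- e k) x y) = ((e k)^-1)%:E * \int[mu]_y G y)%E.
    by move=> mG G0; rewrite ge0_integral_affine// normrN ger0_norm// ltW.
  have cF := cintegrableZ (e k)%:C%C cF0.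
  have ek1 : 0 <= (e k)^-1 by rewrite invr_ge0 ltW.
  split.
    have := cintegrable_comp_scale (measurable_affine _ _) ek1 affE cF.
    by under eq_fun do rewrite -/(F _) FE.
  rewrite -(eq_cint _ FE) (cint_comp_scale affE cF) cintZ// mulrA -rmorphM/= mulVf//.
  by rewrite mul1r.
apply: (@le_trans _ _ (\int[mu]_x \int[mu]_t ((D k (t, x))%:E * (poisson 1 t)%:E))%E).
  apply: ge0_le_integral => //.
  - by move=> x _; rewrite lee_fin normc_ge0.
  - by apply: measurable_normcE; exact: measurable_funcB.
  - apply: (measurable_fun_fubini_tonelli_G (m1 := mu) (fun p => (D k p)%:E * (poisson 1 p.1)%:E)%E).
      apply: emeasurable_funM; first exact/measurable_EFinP.
      exact: (measurableT_comp mK measurable_fst).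
    by move=> p; rewrite mule_ge0.
  - move=> x _; have [cx ->] := convE x.
    have cK : cintegrable mu (fun t => (poisson 1 t)%:C%C * - phi x).
      apply: cintegrableZr; split.
        by apply: measurable_fun_realc; exact: measurable_poisson.
      under eq_integral do rewrite normc_real ger0_norm ?poisson_ge0//.
      by rewrite integral_poisson// ltry.
    (* Since P_1 has mass 1, phi x is its own mean against P_1. *)
    have -> : phi x - cint mu (fun t => (poisson 1 t)%:C%C * phi (x - e k * t)) =
        - cint mu (fun t => (poisson 1 t)%:C%C * (phi (x - e k * t) - phi x)).
      have -> : cint mu (fun t => (poisson 1 t)%:C%C * (phi (x - e k * t) - phi x)) =
        cint mu (fun t => (poisson 1 t)%:C%C * phi (x - e k * t) + (poisson 1 t)%:C%C * - phi x).
        by apply: eq_cint => t; rewrite mulrDr.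
      rewrite cintD// cintZr; last first.
        split; first by apply: measurable_fun_realc; exact: measurable_poisson.
        under eq_integral do rewrite normc_real ger0_norm ?poisson_ge0//.
        by rewrite integral_poisson// ltry.
      by rewrite cint_real /Rintegral integral_poisson//= mul1r opprD opprK addrC.
    rewrite normcN; apply: le_trans (normc_cint_le _ _) _.
      apply: measurable_funcM; first by apply: measurable_fun_realc; exact: measurable_poisson.
      apply: measurable_funcB => //; apply: (measurableT_comp mphi).
      by apply: measurable_funB => //; apply: measurable_funM.
    rewrite le_eqVlt; apply/orP; left; apply/eqP; apply: eq_integral => t _.
    by rewrite Normc.normcM normc_real ger0_norm ?poisson_ge0// EFinM muleC.
rewrite -(fubini_tonelli (m1 := mu) (m2 := mu) (fun p => (D k p)%:E * (poisson 1 p.1)%:E)%E)//; last 2 first.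
- apply: emeasurable_funM; first exact/measurable_EFinP.
  exact: (measurableT_comp mK measurable_fst).
- by move=> p; rewrite mule_ge0.
rewrite le_eqVlt; apply/orP; left; apply/eqP; apply: eq_integral => t _ /=.
rewrite ge0_integralZr//.
apply/measurable_EFinP; exact: (measurableT_comp (mD k) (pair1_measurable t)).
Qed.

(* For >=, phi need not be square integrable: on {|phi| <= m} one has
   2 |phi|^2 <= |phi|^2 + |P_eps phi|^2 + 2 m |phi - P_eps phi|, where the last term tends to 0
   in L1; then m tends to infinity. *)
Theorem plancherel_line phi : cintegrable mu phi ->
  (\int[mu]_g (Normc.normc (fourier_line phi g) ^+ 2)%:E = \int[mu]_x (Normc.normc (phi x) ^+ 2)%:E)%E.
Proof.
move=> cphi; have mphi := cphi.1; apply/eqP; rewrite eq_le integral_sqr_fourier_line_le// andTb.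
pose M := (\int[mu]_g (Normc.normc (fourier_line phi g) ^+ 2)%:E)%E.
rewrite -/M; have [Moo|Moo] := eqVneq M +oo%E; first by rewrite Moo leey.
have M0 : (0 <= M)%E by apply: integral_ge0 => x _; rewrite lee_fin exprn_ge0 ?normc_ge0.
have Mfin : M \is a fin_num by rewrite ge0_fin_numE// ltey.
have mn := measurable_fun_normc mphi.
pose ind m (x : T) : R := (Normc.normc (phi x) <= m%:R)%R%:R.
have mind m : measurable_fun setT (ind m).
  rewrite (_ : ind m = \1_[set x | Normc.normc (phi x) <= m%:R]).
    apply: measurable_indic.
    rewrite (_ : [set x | _] = setT `&` (fun x => Normc.normc (phi x)) @^-1` `]-oo, m%:R]%classic).
      by apply: mn => //; exact: measurable_itv.
    by rewrite setTI; apply/seteqP; split=> x /=; rewrite in_itv.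
  by apply/funext => x; rewrite indicE; congr (nat_of_bool _)%:R; apply/idP/idP; rewrite inE.
have ind0 m x : 0 <= ind m x by [].
pose F m x := (Normc.normc (phi x) ^+ 2 * ind m x)%:E.
have F0 m x : (0 <= F m x)%E by rewrite lee_fin mulr_ge0// exprn_ge0 ?normc_ge0.
have mF m : measurable_fun setT (F m).
  by apply/measurable_EFinP; apply: measurable_funM => //; exact: measurable_funX.
apply: (@cvg_integral_le _ _ _ mu F) => //.
  move=> x; apply: cvg_near_cst; near=> m.
  rewrite /F /ind; have -> : Normc.normc (phi x) <= m%:R.
    by apply/ltW; near: m; exact: nbhs_infty_gtr.
  by rewrite mulr1.
apply: nearW => m.
(* On {|phi| <= m} one has |phi|^2 <= m |phi|, which is integrable. Finiteness is what allows the
   truncated energy to be cancelled from [key]. *)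
have Ffin : (\int[mu]_x F m x)%E \is a fin_num.
  rewrite ge0_fin_numE ?integral_ge0//.
  apply: (@le_lt_trans _ _ (\int[mu]_x (m%:R%:E * (Normc.normc (phi x))%:E))%E).
    apply: ge0_le_integral => //; first by apply: emeasurable_funM => //; exact: measurable_normcE.
    move=> x _; rewrite -EFinM lee_fin /ind; case: (leP (Normc.normc (phi x)) m%:R) => xm; last by rewrite mulr0n mulr0 mulr_ge0 ?normc_ge0.
    by rewrite mulr1 expr2 ler_wpM2r ?normc_ge0.
  rewrite ge0_integralZl//; last 2 first.
  - exact: measurable_normcE.
  - by move=> x _; rewrite lee_fin normc_ge0.
  by rewrite lte_mul_pinfty//; exact: cphi.2.
apply/lee_addgt0Pr => e e0.
have Nc := cvg_poisson_conv cphi.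
(* The L1 error is going to be multiplied by 2 (m + 1); the successor keeps this constant positive
   at m = 0. *)
have d0 : 0 < e / (2 * m.+1%:R) by rewrite divr_gt0// mulr_gt0.
have [N _ /(_ N (leqnn N)) /=] := ge0_cvge0_near Nc d0.
have eN0 : 0 < N.+1%:R^-1 :> R by rewrite invr_gt0.
set P := poisson_conv _ _ => /ltW PN.
have mP : measurable_fun setT P by exact: measurable_poisson_conv.
have PM : (\int[mu]_x (Normc.normc (P x) ^+ 2)%:E <= M)%E by exact: integral_sqr_poisson_conv_le.
have key : (\int[mu]_x F m x + \int[mu]_x F m x <= \int[mu]_x F m x + (M + e%:E))%E.
  apply: (@le_trans _ _ (\int[mu]_x (F m x + ((Normc.normc (P x) ^+ 2)%:E +
      (2 * m.+1%:R)%:E * (Normc.normc (phi x - P x))%:E)))%E).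
    rewrite -ge0_integralD//; apply: ge0_le_integral => //.
    - by move=> x _; rewrite adde_ge0.
    - exact: emeasurable_funD.
    - apply: emeasurable_funD => //; apply: emeasurable_funD; first exact: measurable_sqr_normc.
      by apply: emeasurable_funM => //; apply: measurable_normcE; exact: measurable_funcB.
    - move=> x _; rewrite /F -EFinM -!EFinD lee_fin /ind; case: (leP (Normc.normc (phi x)) m%:R) => xm; last first.
        by rewrite mulr0n !mulr0 !add0r addr_ge0 ?exprn_ge0 ?mulr_ge0 ?normc_ge0.
      rewrite !mulr1 lerD2l.
      have tri : Normc.normc (phi x) <= Normc.normc (P x) + Normc.normc (phi x - P x).
        by rewrite -{1}(subrK (P x) (phi x)) addrC le_normcD.
      have xm1 : Normc.normc (phi x) <= m.+1%:R by rewrite (le_trans xm)// ler_nat.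
      move: tri xm1 (normc_ge0 (phi x)) (normc_ge0 (P x)) (normc_ge0 (phi x - P x)).
      move: (Normc.normc (phi x)) (Normc.normc (P x)) (Normc.normc (phi x - P x)) (m.+1%:R) => a b c q.
      move=> abc aq a0 b0 c0.
      (* From a^2 <= a b + a c, 2 a b <= a^2 + b^2 and a c <= q c follows a^2 <= b^2 + 2 q c. *)
      have h1 : a * a <= a * (b + c) by rewrite ler_wpM2l.
      have h2 : a * c <= q * c by rewrite ler_wpM2r.
      have h3 : 0 <= (a - b) ^+ 2 by rewrite sqr_ge0.
      nra.
  rewrite ge0_integralD//; last 2 first.
  - by move=> x _; rewrite adde_ge0 ?mule_ge0 ?lee_fin ?exprn_ge0 ?normc_ge0 ?mulr_ge0.
  - apply: emeasurable_funD; first exact: measurable_sqr_normc.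
    by apply: emeasurable_funM => //; apply: measurable_normcE; exact: measurable_funcB.
  rewrite ge0_integralD//; last 4 first.
  - by move=> x _; rewrite lee_fin exprn_ge0 ?normc_ge0.
  - exact: measurable_sqr_normc.
  - by move=> x _; rewrite mule_ge0 ?lee_fin ?normc_ge0 ?mulr_ge0.
  - by apply: emeasurable_funM => //; apply: measurable_normcE; exact: measurable_funcB.
  apply: leeD => //; apply: leeD => //.
  rewrite ge0_integralZl//; last 2 first.
  - by apply: measurable_normcE; exact: measurable_funcB.
  - by move=> x _; rewrite lee_fin normc_ge0.
  apply: (@le_trans _ _ ((2 * m.+1%:R)%:E * (e / (2 * m.+1%:R))%:E)%E).
    by apply: lee_wpmul2l => //; rewrite lee_fin mulr_ge0.
  by rewrite -EFinM mulrCA mulfV ?mulr1// lt0r_neq0// mulr_gt0.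
by move: key; rewrite leeD2lE.
Unshelve. all: by end_near. Qed.

End plancherel_line.

(** * Plancherel's identity and linear changes of variables in dimension n *)

Section integral_cV.
Context {R : realType}.
Local Notation mu := (@lebesgue_measure R).

Lemma cV0_eq0 (v : 'cV[R]_0) : v = 0. Proof. exact: flatmx0. Qed.

Lemma ge0_integral_cV0 (F : 'cV[R]_0 -> \bar R) : measurable_fun setT F -> (forall v, (0 <= F v)%E) ->
  (\int[lebesgue_cV 0]_v F v = F 0%R)%E.
Proof. by move=> mF F0; rewrite integral_dirac// diracT mul1e. Qed.

Lemma ge0_integral_cVS n (F : 'cV[R]_n.+1 -> \bar R) : measurable_fun setT F -> (forall v, (0 <= F v)%E) ->
  (\int[lebesgue_cV n.+1]_v F v = \int[mu]_x \int[lebesgue_cV n]_w F (cons_cV (x, w)))%E.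
Proof.
move=> mF F0.
rewrite (@ge0_integral_pushforward _ _ _ _ _ _ (@measurable_cons_cV R n) (mu \x lebesgue_cV n)%E)//.
rewrite preimage_setT fubini_tonelli1//.
  exact: (measurableT_comp mF (@measurable_cons_cV R n)).
by move=> p; exact: F0.
Qed.

Lemma cintegrable_cVS n (f : 'cV[R]_n.+1 -> R[i]) : cintegrable (lebesgue_cV n.+1) f ->
  cintegrable (mu \x lebesgue_cV n)%E (f \o @cons_cV R n).
Proof.
move=> [mf fi]; have mfc := measurableT_comp mf (@measurable_cons_cV R n).
apply: cintegrable_prodP => //.
by rewrite -(ge0_integral_cVS (measurable_normcE mf))// => v; rewrite lee_fin normc_ge0.
Qed.

Lemma cint_cVS n (f : 'cV[R]_n.+1 -> R[i]) : cintegrable (lebesgue_cV n.+1) f ->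
  cint (lebesgue_cV n.+1) f = cint (mu \x lebesgue_cV n)%E (f \o @cons_cV R n).
Proof.
move=> cf; have cfc := cintegrable_cVS cf; rewrite /cint /Rintegral.
congr (fine _ +i* fine _)%C.
- rewrite (@integral_pushforward _ _ _ _ _ _ (@measurable_cons_cV R n) (mu \x lebesgue_cV n)%E)//.
  + by apply/measurable_EFinP; apply: measurable_funRe; exact: cf.1.
  + exact: (cintegrable_Re cfc).
- rewrite (@integral_pushforward _ _ _ _ _ _ (@measurable_cons_cV R n) (mu \x lebesgue_cV n)%E)//.
  + by apply/measurable_EFinP; apply: measurable_funIm; exact: cf.1.
  + exact: (cintegrable_Im cfc).
Qed.

Lemma measurable_dotp d (T : measurableType d) n (f g : T -> 'cV[R]_n) :
  measurable_fun setT f -> measurable_fun setT g -> measurable_fun setT (fun x => dotp (f x) (g x)).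
Proof.
move=> mf mg; apply: measurable_sum => i; apply: measurable_funM.
- exact: (measurableT_comp (measurable_entry i 0) mf).
- exact: (measurableT_comp (measurable_entry i 0) mg).
Qed.

Lemma dotp_cons n (x y : R) (v w : 'cV[R]_n) : dotp (cons_cV (x, v)) (cons_cV (y, w)) = x * y + dotp v w.
Proof.
rewrite /dotp big_ord_recl !mxE unlift_none/=; congr (_ + _).
by apply: eq_bigr => i _; rewrite !mxE liftK.
Qed.

Lemma measurable_fourier n (f : 'cV[R]_n -> R[i]) : measurable_fun setT f -> measurable_fun setT (fourier f).
Proof.
move=> mf.
apply: (@measurable_cint1 _ _ _ _ _ (lebesgue_cV n) (fun p : 'cV[R]_n * 'cV[R]_n => f p.2 * cis (- dotp p.1 p.2))).
apply: measurable_funcM; first exact: (measurableT_comp mf measurable_snd).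
by apply: measurable_fun_cis; apply: measurableT_comp => //; exact: measurable_dotp.
Qed.

Lemma cintegrable_cis n (f : 'cV[R]_n -> R[i]) (g : 'cV[R]_n) : cintegrable (lebesgue_cV n) f ->
  cintegrable (lebesgue_cV n) (fun x => f x * cis (- dotp g x)).
Proof.
move=> cf; apply: cintegrableM_bounded => //; last by move=> x; rewrite normc_cis.
by apply: measurable_fun_cis; apply: measurableT_comp => //; exact: measurable_dotp.
Qed.

Lemma normc_fourier_le n (f : 'cV[R]_n -> R[i]) g : measurable_fun setT f ->
  ((Normc.normc (fourier f g))%:E <= \int[lebesgue_cV n]_x (Normc.normc (f x))%:E)%E.
Proof.
move=> mf; apply: le_trans (normc_cint_le _ _) _.
  apply: measurable_funcM => //.
  by apply: measurable_fun_cis; apply: measurableT_comp => //; exact: measurable_dotp.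
by under eq_integral do rewrite Normc.normcM normc_cis mulr1.
Qed.

(** [G] is the Fourier transform in the last n variables. The identity on the line handles the first
    variable for every frequency g', and the induction hypothesis handles the others for almost
    every x. *)
Let plancherel_L1_step n :
  (forall f : 'cV[R]_n -> R[i], cintegrable (lebesgue_cV n) f ->
    (\int[lebesgue_cV n]_g (Normc.normc (fourier f g) ^+ 2)%:E =
     \int[lebesgue_cV n]_x (Normc.normc (f x) ^+ 2)%:E)%E) ->
  forall f : 'cV[R]_n.+1 -> R[i], cintegrable (lebesgue_cV n.+1) f ->
    (\int[lebesgue_cV n.+1]_g (Normc.normc (fourier f g) ^+ 2)%:E =
     \int[lebesgue_cV n.+1]_x (Normc.normc (f x) ^+ 2)%:E)%E.
Proof.
move=> IH f cf; have mf := cf.1.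
have mF := measurable_fourier mf.
have cfc := cintegrable_cVS cf; have mfc := cfc.1.
pose fx (x : measurableTypeR R) (w : 'cV[R]_n) := f (cons_cV (x, w)).
have mfx x : measurable_fun setT (fx x) by exact: (measurableT_comp mfc (pair1_measurable x)).
pose G (p : measurableTypeR R * 'cV[R]_n) := fourier (fx p.1) p.2.
have mG : measurable_fun setT G.
  apply: (@measurable_cint1 _ _ _ _ _ (lebesgue_cV n)
    (fun q : (measurableTypeR R * 'cV[R]_n) * 'cV[R]_n => f (cons_cV (q.1.1, q.2)) * cis (- dotp q.1.2 q.2))).
  apply: measurable_funcM.
    apply: (measurableT_comp mfc); apply: measurable_fun_pair => //.
    exact: (measurableT_comp measurable_fst measurable_fst).
  apply: measurable_fun_cis; apply: measurableT_comp => //; apply: measurable_dotp => //.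
  exact: (measurableT_comp measurable_snd measurable_fst).
have mI : measurable_fun setT (fun x : measurableTypeR R => \int[lebesgue_cV n]_w (Normc.normc (fx x w))%:E)%E.
  apply: (measurable_fun_fubini_tonelli_F (m2 := lebesgue_cV n) (fun p => (Normc.normc (f (cons_cV p)))%:E)).
    exact: measurable_normcE.
  by move=> p; rewrite lee_fin normc_ge0.
have Ifin : (\int[mu]_x \int[lebesgue_cV n]_w (Normc.normc (fx x w))%:E < +oo)%E.
  rewrite -(ge0_integral_cVS (measurable_normcE mf)); last by move=> v; rewrite lee_fin normc_ge0.
  exact: cf.2.
(* The bound by the L1 norm of the slice holds even where that norm is infinite, so no exceptional
   set appears here. *)
have cG g' : cintegrable mu (fun x => G (x, g')).
  apply: (@le_cintegrable _ _ _ mu _ (fun x : measurableTypeR R => \int[lebesgue_cV n]_w (Normc.normc (fx x w))%:E)%E) => //.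
    exact: (measurableT_comp mG (pair2_measurable g')).
  by move=> x; exact: normc_fourier_le.
have FE (g : measurableTypeR R) (g' : 'cV[R]_n) : fourier f (cons_cV (g, g')) = fourier_line (fun x => G (x, g')) g.
  rewrite /fourier -[cintegral _]/(cint (lebesgue_cV n.+1) _) cint_cVS; last exact: cintegrable_cis.
  apply/esym/cint_fubini1.
  - exact: (cintegrable_cVS (cintegrable_cis _ cf)).
  - apply: measurable_funcM; first exact: (cG g').1.
    by apply: measurable_fun_cis; apply: measurableT_comp => //; apply: measurable_funM.
  - move=> x cx; have cfx : cintegrable (lebesgue_cV n) (fx x).
      (* The slice is known to be integrable only after multiplication by a character; the inverse
         character undoes this. *)
      have -> : fx x = fun w => (f \o @cons_cV R n) (x, w) * cis (- dotp (cons_cV (g, g')) (cons_cV (x, w)))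
                   * cis (dotp (cons_cV (g, g')) (cons_cV (x, w))).
        by apply/funext => w; rewrite -mulrA -cisD addNr cis0 mulr1.
      apply: cintegrableM_bounded cx _ _; last by move=> w; rewrite normc_cis.
      apply: measurable_fun_cis; apply: measurable_dotp => //.
      exact: (measurableT_comp (@measurable_cons_cV R n) (pair1_measurable x)).
    rewrite /G /fourier -[cintegral _]/(cint (lebesgue_cV n) _) -cintZr; last exact: cintegrable_cis.
    apply: eq_cint => w; rewrite /= dotp_cons opprD cisD /fx; ring.
have mN : measurable_fun setT (fun p : measurableTypeR R * 'cV[R]_n => (Normc.normc (fourier f (cons_cV p)) ^+ 2)%:E).
  exact: (measurable_sqr_normc (measurableT_comp mF (@measurable_cons_cV R n))).
have mGs : measurable_fun setT (fun p => (Normc.normc (G p) ^+ 2)%:E) by exact: measurable_sqr_normc.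
have mfs : measurable_fun setT (fun p => (Normc.normc (f (cons_cV p)) ^+ 2)%:E) by exact: measurable_sqr_normc.
have sq0 (z : R[i]) : (0 <= (Normc.normc z ^+ 2)%:E)%E by rewrite lee_fin exprn_ge0 ?normc_ge0.
rewrite (ge0_integral_cVS (measurable_sqr_normc mF))//.
rewrite (fubini_tonelli (m1 := mu) (m2 := lebesgue_cV n) (fun p => (Normc.normc (fourier f (cons_cV p)) ^+ 2)%:E))//.
transitivity (\int[lebesgue_cV n]_g' \int[mu]_x (Normc.normc (G (x, g')) ^+ 2)%:E)%E.
  apply: eq_integral => g' _; rewrite -(plancherel_line (cG g')).
  by apply: eq_integral => g _; rewrite FE.
rewrite -(fubini_tonelli (m1 := mu) (m2 := lebesgue_cV n) (fun p => (Normc.normc (G p) ^+ 2)%:E))//.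
rewrite (ge0_integral_cVS (measurable_sqr_normc mf))//.
(* Only almost every slice of f is integrable, hence an almost everywhere comparison. *)
apply: ae_eq_integral => //.
- exact: (measurable_fun_fubini_tonelli_F (m2 := lebesgue_cV n) (fun p => (Normc.normc (G p) ^+ 2)%:E)).
- exact: (measurable_fun_fubini_tonelli_F (m2 := lebesgue_cV n) (fun p => (Normc.normc (f (cons_cV p)) ^+ 2)%:E)).
have ir := cintegrable_Re cfc; have ii := cintegrable_Im cfc.
apply: filterS2 (ae_integrable1 ir) (ae_integrable1 ii) => x irx iix _.
exact/(IH (fx x))/cintegrableP.
Qed.

Theorem plancherel_L1 n (f : 'cV[R]_n -> R[i]) : cintegrable (lebesgue_cV n) f ->
  (\int[lebesgue_cV n]_g (Normc.normc (fourier f g) ^+ 2)%:E =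
   \int[lebesgue_cV n]_x (Normc.normc (f x) ^+ 2)%:E)%E.
Proof.
elim: n f => [|n IH] f cf; last exact: plancherel_L1_step.
have mf := cf.1; have sq0 (z : R[i]) : (0 <= (Normc.normc z ^+ 2)%:E)%E by rewrite lee_fin exprn_ge0 ?normc_ge0.
rewrite (ge0_integral_cV0 (measurable_sqr_normc (measurable_fourier mf)) (fun v => sq0 _)).
rewrite (ge0_integral_cV0 (measurable_sqr_normc mf) (fun v => sq0 _)).
congr ((Normc.normc _ ^+ 2)%:E).
(* On the one-point space the transform is the identity, both measures being the unit mass. *)
have -> : fourier f 0 = cint (lebesgue_cV 0) f.
  by apply: eq_cint => v; rewrite /dotp big_ord0 oppr0 cis0 mulr1.
rewrite /cint /Rintegral !integral_dirac//; last 2 first.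
- by apply/measurable_EFinP; exact: measurable_funIm.
- by apply/measurable_EFinP; exact: measurable_funRe.
by rewrite diracT !mul1e /=; case: (f 0).
Qed.

End integral_cV.

(** * Translations and invertible linear maps *)

Section change_of_variables.
Context {R : realType}.
Local Notation mu := (@lebesgue_measure R).

Lemma measurable_cVD n (a : 'cV[R]_n) : measurable_fun setT (fun v : 'cV[R]_n => v + a).
Proof.
apply: measurable_fun_mx => i j; under eq_fun do rewrite mxE.
by apply: measurable_funD => //; exact: measurable_entry.
Qed.

Lemma measurable_mulmxl m n (h : 'M[R]_(m, n)) : measurable_fun setT (fun v : 'cV[R]_n => h *m v).
Proof.
apply: measurable_fun_mx => i j; under eq_fun do rewrite mxE.
by apply: measurable_sum => k; apply: measurable_funM => //; exact: measurable_entry.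
Qed.

(** Turns the encoding of the product measure into a block column, on which block matrices act by
    block multiplication. *)
Lemma cons_cVE n (x : R) (w : 'cV[R]_n) : cons_cV (x, w) = col_mx (x%:M : 'M[R]_1) w :> 'cV[R]_(1 + n).
Proof.
apply/colP => i; rewrite mxE; case: (unliftP ord0 i) => [j|] -> /=.
  by rewrite (_ : lift ord0 j = rshift 1 j) ?col_mxEd//; apply/val_inj.
have E : (lshift n (ord0 : 'I_1) : 'I_(1 + n)) = @ord0 n by exact/val_inj.
by rewrite -E col_mxEu mxE.
Qed.

Lemma ge0_integral_cV_translate n (a : 'cV[R]_n) (F : 'cV[R]_n -> \bar R) : measurable_fun setT F ->
  (forall v, (0 <= F v)%E) -> (\int[lebesgue_cV n]_v F (v + a)%R = \int[lebesgue_cV n]_v F v)%E.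
Proof.
elim: n a F => [|n IH] a F mF F0.
  by apply: eq_integral => v _; rewrite (cV0_eq0 (v + a)) (cV0_eq0 v).
have mFa := measurableT_comp mF (@measurable_cVD n.+1 a).
have mFc := measurableT_comp mF (@measurable_cons_cV R n).
rewrite (ge0_integral_cVS mFa (fun v => F0 _)) (ge0_integral_cVS mF F0).
have aE : a = cons_cV (a ord0 0, \col_i a (lift ord0 i) 0).
  by apply/colP => i; rewrite mxE; case: (unliftP ord0 i) => [j|] -> //=; rewrite mxE.
pose I (x : measurableTypeR R) := (\int[lebesgue_cV n]_w F (cons_cV (x, w)))%E.
have mI : measurable_fun setT I.
  apply: (measurable_fun_fubini_tonelli_F (m2 := lebesgue_cV n) (F \o @cons_cV R n)) => // p.
  exact: F0.
have I0 x : (0 <= I x)%E by exact: integral_ge0.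
have := ge0_integral_affine (a ord0 0) (oner_neq0 R) mI I0.
rewrite normr1 invr1 mul1e => <-; apply: eq_integral => x _.
rewrite mul1r /I -[RHS](IH (\col_i a (lift ord0 i) 0)).
- apply: eq_integral => w _; rewrite /=; congr (F _); rewrite {1}aE.
  by apply/colP => i; rewrite !mxE; case: (unlift ord0 i) => [j|] //=; rewrite !mxE.
- exact: (measurableT_comp mFc (pair1_measurable _)).
- by move=> w; exact: F0.
Qed.

(** The change of variables formula as a property of the matrix, in order to prove it for elementary
    factors and close it under products. *)
Let scales n (h : 'M[R]_n) := forall F : 'cV[R]_n -> \bar R, measurable_fun setT F ->
  (forall v, (0 <= F v)%E) ->
  (\int[lebesgue_cV n]_v F (h *m v)%R = (`|\det h|^-1)%:E * \int[lebesgue_cV n]_v F v)%E.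

Let scalesM n (h1 h2 : 'M[R]_n) : scales h1 -> scales h2 -> scales (h1 *m h2).
Proof.
move=> s1 s2 F mF F0; under eq_integral do rewrite -mulmxA.
have mF1 := measurableT_comp mF (measurable_mulmxl h1).
rewrite (s2 (fun v => F (h1 *m v)))// s1// muleA -EFinM; congr ((_)%:E * _)%E.
by rewrite det_mulmx normrM invfM mulrC.
Qed.

Let scales_lower n (A : 'M[R]_n) : scales A -> scales (block_mx (1%:M : 'M[R]_1) 0 0 A : 'M[R]_(1 + n)).
Proof.
move=> sA F mF F0.
have mFc := measurableT_comp mF (@measurable_cons_cV R n).
have mFh := measurableT_comp mF (measurable_mulmxl (block_mx (1%:M : 'M[R]_1) 0 0 A : 'M[R]_(1 + n))).
rewrite (ge0_integral_cVS mFh (fun v => F0 _)) (ge0_integral_cVS mF F0) det_ublock det1 mul1r.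
have mI : measurable_fun setT (fun x : measurableTypeR R => \int[lebesgue_cV n]_w F (cons_cV (x, w)))%E.
  apply: (measurable_fun_fubini_tonelli_F (m2 := lebesgue_cV n) (F \o @cons_cV R n)) => // p.
  exact: F0.
rewrite -ge0_integralZl//; last by move=> x _; exact: integral_ge0.
apply: eq_integral => x _; rewrite -sA//; last exact: (measurableT_comp mFc (pair1_measurable x)).
apply: eq_integral => w _ /=; congr (F _).
by rewrite !cons_cVE mul_block_col !mul0mx mul1mx addr0 add0r.
Qed.

(** With w fixed, the first coordinate undergoes the affine map x -> a x + b w of the line; hence x
    is integrated innermost. *)
Let scales_row n (a : R) (b : 'M[R]_(1, n)) : a != 0 ->
  scales (block_mx (a%:M : 'M[R]_1) b 0 (1%:M : 'M[R]_n) : 'M[R]_(1 + n)).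
Proof.
move=> a0 F mF F0.
have mFc := measurableT_comp mF (@measurable_cons_cV R n).
have mFh := measurableT_comp mF (measurable_mulmxl (block_mx (a%:M : 'M[R]_1) b 0 (1%:M : 'M[R]_n) : 'M[R]_(1 + n))).
have mFhc := measurableT_comp mFh (@measurable_cons_cV R n).
rewrite (ge0_integral_cVS mFh (fun v => F0 _)) (ge0_integral_cVS mF F0) det_ublock det1 mulr1 det_scalar1.
rewrite (fubini_tonelli (m1 := mu) (m2 := lebesgue_cV n) ((fun v => F (block_mx a%:M b 0 1%:M *m v)) \o @cons_cV R n) mFhc (fun p => F0 _)).
rewrite (fubini_tonelli (m1 := mu) (m2 := lebesgue_cV n) (F \o @cons_cV R n) mFc (fun p => F0 _)).
have mI : measurable_fun setT (fun w => \int[mu]_x F (cons_cV (x, w)))%E.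
  apply: (measurable_fun_fubini_tonelli_G (m1 := mu) (F \o @cons_cV R n)) => // p.
  exact: F0.
rewrite -ge0_integralZl//; last by move=> w _; apply: integral_ge0 => x _; exact: F0.
apply: eq_integral => w _.
have mFw : measurable_fun setT (fun x : measurableTypeR R => F (cons_cV (x, w))).
  exact: (measurableT_comp mFc (pair2_measurable w)).
have := ge0_integral_affine ((b *m w) 0 0) a0 mFw (fun=> F0 _) => <-.
apply: eq_integral => x _ /=; congr (F _).
rewrite !cons_cVE mul_block_col mul0mx mul1mx add0r; congr col_mx.
rewrite -scalar_mxM raddfD/=; congr (_ + _).
by rewrite [LHS]mx11_scalar.
Qed.

(** With x fixed, the remaining coordinates are translated by x c. *)
Let scales_col n (c : 'cV[R]_n) : scales (block_mx (1%:M : 'M[R]_1) 0 c (1%:M : 'M[R]_n) : 'M[R]_(1 + n)).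
Proof.
move=> F mF F0.
have mFc := measurableT_comp mF (@measurable_cons_cV R n).
have mFh := measurableT_comp mF (measurable_mulmxl (block_mx (1%:M : 'M[R]_1) 0 c (1%:M : 'M[R]_n) : 'M[R]_(1 + n))).
rewrite (ge0_integral_cVS mFh (fun v => F0 _)) (ge0_integral_cVS mF F0) det_lblock !det1 mulr1 normr1 invr1 mul1e.
apply: eq_integral => x _.
rewrite -(ge0_integral_cV_translate (x *: c) (F := fun w => F (cons_cV (x, w))))//; last first.
  exact: (measurableT_comp mFc (pair1_measurable x)).
apply: eq_integral => w _ /=; congr (F _).
rewrite !cons_cVE mul_block_col mul0mx !mul1mx addr0; congr col_mx.
by rewrite addrC mul_mx_scalar.
Qed.

Let block_row_ul n (s : 'M[R]_(1, n)) (g : 'M[R]_(1 + n)) :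
  ulsubmx (block_mx (1%:M : 'M[R]_1) s 0 (1%:M : 'M[R]_n) *m g) = ulsubmx g + s *m dlsubmx g.
Proof. by rewrite -{1}(submxK g) mulmx_block block_mxKul mul1mx. Qed.

(* Induction on n by block elimination: h is a product of shears, of a row scaling and of
   a block-diagonal matrix, once a shear has made the upper left entry nonzero. *)
Theorem ge0_integral_mulmx n (h : 'M[R]_n) (F : 'cV[R]_n -> \bar R) : h \in unitmx ->
  measurable_fun setT F -> (forall v, (0 <= F v)%E) ->
  (\int[lebesgue_cV n]_v F (h *m v)%R = (`|\det h|^-1)%:E * \int[lebesgue_cV n]_v F v)%E.
Proof.
suff : h \in unitmx -> scales h by move=> H hu; exact: H.
elim: n h {F} => [|n IH] h hu.
  move=> F mF F0; rewrite det_mx00 normr1 invr1 mul1e.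
  by apply: eq_integral => v _; rewrite (cV0_eq0 (h *m v)) (cV0_eq0 v).
have pivot (g : 'M[R]_(1 + n)) : g \in unitmx -> ulsubmx g 0 0 != 0 -> scales g.
  move=> gu; set a := ulsubmx g 0 0 => a0.
  (* The Schur complement of the pivot: det g = a det S, so [S] is invertible and the induction
     hypothesis applies to it. *)
  pose S := drsubmx g - a^-1 *: (dlsubmx g *m ursubmx g).
  have gE : g = block_mx (1%:M : 'M[R]_1) 0 (a^-1 *: dlsubmx g) (1%:M : 'M[R]_n) *m
      (block_mx (1%:M : 'M[R]_1) 0 0 S *m block_mx (a%:M : 'M[R]_1) (ursubmx g) 0 (1%:M : 'M[R]_n)).
    rewrite !mulmx_block !mul0mx !mulmx0 !mul1mx !mulmx1 !addr0 !add0r.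
    rewrite -{1}(submxK g); congr block_mx; first by rewrite [LHS]mx11_scalar.
      by rewrite mul_mx_scalar scalerA mulfV// scale1r.
    by rewrite -scalemxAl /S addrC subrK.
  rewrite gE; apply: scalesM; first exact: scales_col.
  apply: scalesM; last exact: scales_row.
  apply/scales_lower/IH; move: gu; rewrite !unitmxE gE !det_mulmx det_lblock !det_ublock !det1.
  by rewrite !mul1r !mulr1 unitrM => /andP[].
have [a0|a0] := eqVneq ((ulsubmx (h : 'M[R]_(1 + n))) 0 0) 0; last exact: pivot.
(* With a zero pivot, a first column that vanishes altogether would make the determinant zero. *)
have [i ci0] : exists i, dlsubmx (h : 'M[R]_(1 + n)) i 0 != 0.
  apply/existsP; apply: contraLR hu; rewrite negb_exists => /forallP c0.
  rewrite unitmxE unitfE negbK -(submxK (h : 'M[R]_(1 + n))).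
  have -> : dlsubmx (h : 'M[R]_(1 + n)) = 0.
    by apply/matrixP => i j; rewrite ord1 [RHS]mxE; apply/eqP; rewrite -[_ == _]negbK c0.
  have := det_ublock (ulsubmx (h : 'M[R]_(1 + n))) (ursubmx (h : 'M[R]_(1 + n))) (drsubmx (h : 'M[R]_(1 + n))).
  by rewrite [X in \det X * _]mx11_scalar a0 det_scalar1 mul0r => /eqP.
pose r : 'M[R]_(1, n) := delta_mx 0 i.
(* [U r] adds the row of the nonzero entry to the first row, so that this entry becomes the
   pivot. *)
pose U (s : 'M[R]_(1, n)) : 'M[R]_(1 + n) := block_mx (1%:M : 'M[R]_1) s 0 (1%:M : 'M[R]_n).
have hE : h = U (- r) *m (U r *m h).
  rewrite mulmxA mulmx_block !mul0mx !mulmx0 !mul1mx !mulmx1 !addr0 !add0r subrr.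
  by have := mul1mx (h : 'M[R]_(1 + n)); rewrite scalar_mx_block => /esym.
have sU s : scales (U s) by apply: scales_row; exact: oner_neq0.
rewrite hE; apply: scalesM => //; apply: pivot.
  by rewrite unitmx_mul hu andbT unitmxE det_ublock !det1 mulr1 unitr1.
suff -> : ulsubmx ((U r *m h) : 'M[R]_(1 + n)) 0 0 = dlsubmx (h : 'M[R]_(1 + n)) i 0 by [].
have := block_row_ul r (h : 'M[R]_(1 + n)) => /(congr1 (fun A : 'M[R]_1 => A 0 0)) => E.
by apply: etrans E _; rewrite mxE a0 add0r -rowE mxE.
Qed.

End change_of_variables.

(** * The Fourier-Plancherel transform *)

Section riesz_fischer.
Context {R : realType}.

Lemma cvg_geometric_steps (a : nat -> R) (c : R) :
  (forall k, `|a k.+1 - a k| <= c * 2^-1 ^+ k) -> cvgn a.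
Proof.
move=> ac; have c0 : 0 <= c by have := ac 0%N; rewrite expr0 mulr1; exact: le_trans.
have : cvgn (series (telescope a)).
  apply: normed_cvg; apply: (@series_le_cvg _ _ (geometric c 2^-1)) => //.
  - by move=> k; exact: normr_ge0.
  - by move=> k; rewrite /geometric/= mulr_ge0// exprn_ge0// invr_ge0.
  - apply: is_cvg_geometric_series; rewrite ger0_norm ?invr_ge0//.
    by rewrite invf_lt1// ltr1n.
move=> cs; rewrite (_ : a = (fun n => a 0%N + series (telescope a) n)).
  by apply: is_cvgD => //; exact: is_cvg_cst.
by apply/funext => k; exact: eq_sum_telescope.
Qed.

Context d (T : measurableType d) (mu : {measure set T -> \bar R}).

Lemma ae_cvg_integral_le (f_ : nat -> T -> \bar R) (f : T -> \bar R) (M : \bar R) :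
  (forall k, measurable_fun setT (f_ k)) -> measurable_fun setT f ->
  (forall k x, (0 <= f_ k x)%E) ->
  {ae mu, forall x, f_ k x @[k --> \oo] --> f x} ->
  (\forall k \near \oo, (\int[mu]_x f_ k x <= M)%E) -> (\int[mu]_x f x <= M)%E.
Proof.
move=> mf_ mf f0 ff fM.
have -> : (\int[mu]_x f x = \int[mu]_x limn_einf (f_ ^~ x))%E.
  apply: ae_eq_integral => //; last first.
    by apply: filterS ff => x fx _; rewrite (cvg_limn_einf_sup fx).
  have -> : (fun x => limn_einf (f_ ^~ x)) = (fun x => - limn_esup (-%E \o (f_ ^~ x)))%E.
    by apply/funext => x; rewrite limn_esupN oppeK.
  apply: measurableT_comp => //; apply: (measurable_fun_limn_esup (f := fun k x => - f_ k x))%E => k.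
  exact: measurableT_comp.
apply: le_trans (fatou mu measurableT mf_ _) _ => //.
rewrite limn_einf_lim; apply: lime_le; first exact: is_cvg_einfs.
near=> k; apply: le_trans (_ : (\int[mu]_x f_ k x <= M)%E); last by near: k.
by apply: ereal_inf_lbound; exists k => /=.
Unshelve. all: by end_near. Qed.

(** The rate 8^-(k+1) beats the weight 4^k: the sum S of 4^k |g (k+1) - g k|^2 is integrable, so
    almost everywhere the steps are at most sqrt(S) 2^-k and the sequence converges. Fatou's lemma
    then transfers the Cauchy bound to the limit. *)
Lemma riesz_fischer (g : nat -> T -> R[i]) : (forall k, measurable_fun setT (g k)) ->
  (forall k m, (k <= m)%N -> (\int[mu]_x (Normc.normc (g m x - g k x) ^+ 2)%:E <= (((8 ^ k.+1)%:R)^-1)%:E)%E) ->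
  exists2 l : T -> R[i], measurable_fun setT l &
    forall k, (\int[mu]_x (Normc.normc (g k x - l x) ^+ 2)%:E <= (((8 ^ k.+1)%:R)^-1)%:E)%E.
Proof.
move=> mg gC.
(* Upper limits give a measurable function defined everywhere; it is the limit wherever the sequence
   converges. *)
pose l x : R[i] := (fine (limn_esup (fun k => (complex.Re (g k x))%:E)) +i*
                   fine (limn_esup (fun k => (complex.Im (g k x))%:E)))%C.
have ml : measurable_fun setT l.
  apply: measurable_fun_complex => /=; apply: measurableT_comp; try exact: fine_measurable.
  - by apply: measurable_fun_limn_esup => k; apply/measurable_EFinP; exact: measurable_funRe.
  - by apply: measurable_fun_limn_esup => k; apply/measurable_EFinP; exact: measurable_funIm.
exists l => // k0.
pose w k x := ((4 ^ k)%:R * Normc.normc (g k.+1 x - g k x) ^+ 2)%:E.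
have w0 k x : (0 <= w k x)%E by rewrite lee_fin mulr_ge0 ?exprn_ge0 ?normc_ge0.
have mw k : measurable_fun setT (w k).
  apply/measurable_EFinP; apply: measurable_funM => //.
  by apply: measurable_funX; apply: measurable_fun_normc; exact: measurable_funcB.
pose S x := (\sum_(0 <= k <oo) w k x)%E.
have mS : measurable_fun setT S by apply: ge0_emeasurable_sum => // k x _ _; exact: w0.
have S0 x : (0 <= S x)%E by apply: nneseries_ge0 => k _ _; exact: w0.
have Sfin : (\int[mu]_x S x < +oo)%E.
  rewrite integral_nneseries//.
  apply: (@le_lt_trans _ _ 1%:E); last exact: ltry.
  apply: (@le_trans _ _ (\sum_(0 <= k <oo) (1 / (2 ^ k.+1)%:R)%:E)%E); last exact: epsilon_trick0.
  apply: lee_nneseries => [k _ _|k _]; first exact: integral_ge0.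
  under eq_integral do rewrite /w EFinM.
  rewrite ge0_integralZl//; last 2 first.
  - by apply: measurable_sqr_normc; exact: measurable_funcB.
  - by move=> x _; rewrite lee_fin exprn_ge0 ?normc_ge0.
  (* The k-th term is at most 4^k / 8^(k+1), hence at most 2^-(k+1), and these sum to at most 1. *)
  apply: (@le_trans _ _ ((4 ^ k)%:R%:E * (((8 ^ k.+1)%:R)^-1)%:E)%E).
    by apply: lee_wpmul2l; [rewrite lee_fin|exact: gC].
  rewrite -EFinM lee_fin mul1r -lef_pV2 ?posrE ?invr_gt0 ?divr_gt0 ?ltr0n ?expn_gt0//.
  rewrite invrK invf_div ler_pdivlMr ?ltr0n ?expn_gt0// -natrM ler_nat.
  rewrite (_ : 8 = 2 * 4)%N// expnMn leq_mul2l; apply/orP; right.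
  by rewrite leq_exp2l.
have aeS : {ae mu, forall x, S x \is a fin_num}.
  have iS : mu.-integrable setT S.
    by apply/integrableP; split => //; under eq_integral do rewrite gee0_abs//.
  by apply: filterS (integrable_ae measurableT iS) => x; apply.
have aecvg : {ae mu, forall x, complex.Re (g k x) @[k --> \oo] --> complex.Re (l x) /\
    complex.Im (g k x) @[k --> \oo] --> complex.Im (l x)}.
  apply: filterS aeS => x Sx.
  have [c c0 cx] : exists2 c : R, 0 <= c & forall k, Normc.normc (g k.+1 x - g k x) <= c * 2^-1 ^+ k.
    exists (Num.sqrt (fine (S x))); first exact: sqrtr_ge0.
    move=> k; rewrite -(ler_pXn2r (n := 2)) ?nnegrE ?normc_ge0 ?mulr_ge0 ?sqrtr_ge0 ?exprn_ge0 ?invr_ge0//.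
    rewrite exprMn sqr_sqrtr ?fine_ge0// -exprM mulnC exprM.
    have -> : (2^-1 ^+ 2) ^+ k = ((4 ^ k)%:R)^-1 :> R by rewrite natrX -exprVn; congr (_ ^+ k); rewrite exprVn -natrX.
    rewrite ler_pdivlMr ?ltr0n ?expn_gt0// mulrC -lee_fin fineK//.
    have -> : S x = (\sum_(0 <= i < k.+1) w i x + \sum_(k.+1 <= i <oo) w i x)%E.
      by apply: nneseries_split => // i _; exact: w0.
    rewrite big_nat_recr//= addeAC -/(w k x) leeDr// adde_ge0//.
    - by apply: sume_ge0.
    - by apply: nneseries_ge0.
  have cvgl (h : R[i] -> R) : (forall y z, `|h y - h z| <= Normc.normc (y - z)) ->
      h (g k x) @[k --> \oo] --> fine (limn_esup (fun k => (h (g k x))%:E)).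
    move=> h1; have : cvgn (fun k => h (g k x)).
      by apply: (@cvg_geometric_steps _ c) => k; exact: le_trans (h1 _ _) (cx k).
    move=> /cvg_ex[/= lh hl]; have := hl.
    have E : (h (g k x))%:E @[k --> \oo] --> lh%:E by apply: cvg_EFin => //; exact: nearW.
    by rewrite (cvg_limn_einf_sup E).2.
  split.
  - by apply: cvgl => y z; have := normrRe_le (y - z); case: y z => a b [].
  - by apply: cvgl => y z; have := normrIm_le (y - z); case: y z => a b [].
apply: (ae_cvg_integral_le (f_ := fun m x => (Normc.normc (g k0 x - g m x) ^+ 2)%:E)).
- by move=> m; apply: measurable_sqr_normc; exact: measurable_funcB.
- by apply: measurable_sqr_normc; exact: measurable_funcB.
- by move=> m x; rewrite lee_fin exprn_ge0 ?normc_ge0.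
- apply: filterS aecvg => x [rx ix]; apply: cvg_EFin; first exact: nearW.
  rewrite sqr_normcE; under eq_fun do rewrite /= sqr_normcE.
  have D (y z : R[i]) : complex.Re (y - z) = complex.Re y - complex.Re z by case: y z => a b [].
  have D' (y z : R[i]) : complex.Im (y - z) = complex.Im y - complex.Im z by case: y z => a b [].
  rewrite D D'; under eq_fun do rewrite D D'.
  by apply: cvgD; rewrite expr2; under eq_fun do rewrite expr2;
    apply: cvgM; apply: cvgB => //; exact: cvg_cst.
- exists k0 => // m /= km; apply: le_trans (gC _ _ km).
  rewrite le_eqVlt; apply/orP; left; apply/eqP; apply: eq_integral => x _.
  by rewrite -normcN opprB.
Qed.

End riesz_fischer.

Section L2_space.
Context {R : realType} {n : nat}.
Local Notation mu := (@lebesgue_cV R n).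
Implicit Types f g u : 'cV[R]_n -> R[i].

Lemma sqnorm_ge0 f : (0 <= sqnorm f)%E.
Proof. by apply: integral_ge0 => x _; rewrite lee_fin exprn_ge0 ?normc_ge0. Qed.

Lemma sqnormB_sym f g : sqnorm (fun x => f x - g x) = sqnorm (fun x => g x - f x).
Proof. by rewrite /sqnorm; under eq_integral do rewrite -normcN opprB. Qed.

Lemma sqnormZ (c : R[i]) f : measurable_fun setT f ->
  sqnorm (fun x => c * f x) = ((Normc.normc c ^+ 2)%:E * sqnorm f)%E.
Proof.
move=> mf; rewrite /sqnorm; under eq_integral do rewrite Normc.normcM exprMn EFinM.
rewrite ge0_integralZl//; last by rewrite lee_fin exprn_ge0 ?normc_ge0.
- exact: measurable_sqr_normc.
- by move=> x _; rewrite lee_fin exprn_ge0 ?normc_ge0.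
Qed.

(* Peter-Paul: 2 a b <= t a^2 + b^2 / t *)
Lemma sqnormD_le (t : R) f g : 0 < t -> measurable_fun setT f -> measurable_fun setT g ->
  (sqnorm (fun x => f x + g x)%R <= (1 + t)%:E * sqnorm f + (1 + t^-1)%:E * sqnorm g)%E.
Proof.
move=> t0 mf mg; have t1 : 0 <= 1 + t by rewrite addr_ge0// ltW.
have ti0 : 0 < t^-1 by rewrite invr_gt0.
have ti1 : 0 <= 1 + t^-1 by rewrite addr_ge0// ltW.
rewrite /sqnorm -!ge0_integralZl ?lee_fin//; try by [exact: measurable_sqr_normc|move=> x _; rewrite lee_fin exprn_ge0 ?normc_ge0].
rewrite -ge0_integralD//; try by [move=> x _; rewrite mule_ge0// lee_fin exprn_ge0 ?normc_ge0|apply: emeasurable_funM => //; exact: measurable_sqr_normc].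
apply: ge0_le_integral => //.
- by move=> x _; rewrite lee_fin exprn_ge0 ?normc_ge0.
- by apply: measurable_sqr_normc; exact: measurable_funcD.
- by apply: emeasurable_funD; apply: emeasurable_funM => //; exact: measurable_sqr_normc.
- move=> x _; rewrite -!EFinM -EFinD lee_fin.
  apply: (@le_trans _ _ ((Normc.normc (f x) + Normc.normc (g x)) ^+ 2)).
    by rewrite ler_pXn2r ?nnegrE ?addr_ge0 ?normc_ge0// le_normcD.
  move: (Normc.normc (f x)) (Normc.normc (g x)) => a b; rewrite -subr_ge0.
  have -> : (1 + t) * a ^+ 2 + (1 + t^-1) * b ^+ 2 - (a + b) ^+ 2 = t * (a - t^-1 * b) ^+ 2.
    by field; rewrite lt0r_neq0.
  by rewrite mulr_ge0 ?sqr_ge0// ltW.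
Qed.

Lemma sqnormD_le2 f g : measurable_fun setT f -> measurable_fun setT g ->
  (sqnorm (fun x => f x + g x)%R <= 2%:E * sqnorm f + 2%:E * sqnorm g)%E.
Proof. by move=> mf mg; have := sqnormD_le ltr01 mf mg; rewrite invr1. Qed.

Lemma L2D f g : L2 f -> L2 g -> L2 (fun x => f x + g x).
Proof.
move=> [mf fi] [mg gi]; split; first exact: measurable_funcD.
apply: le_lt_trans (sqnormD_le2 mf mg) _.
by apply: lte_add_pinfty; apply: lte_mul_pinfty.
Qed.

Lemma L2Z (c : R[i]) f : L2 f -> L2 (fun x => c * f x).
Proof.
move=> [mf fi]; split; first exact: measurable_funcM.
by rewrite sqnormZ//; apply: lte_mul_pinfty => //; rewrite lee_fin exprn_ge0 ?normc_ge0.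
Qed.

Lemma L2M_cintegrable f g : L2 f -> L2 g -> cintegrable mu (fun x => f x * conjc (g x)).
Proof.
move=> [mf fi] [mg gi].
apply: (@le_cintegrable _ _ _ mu _ (fun x => (Normc.normc (f x) ^+ 2)%:E + (Normc.normc (g x) ^+ 2)%:E)%E).
- by apply: measurable_funcM => //; exact: measurable_fun_conjc.
- by apply: emeasurable_funD; exact: measurable_sqr_normc.
- move=> x; rewrite Normc.normcM normc_conjc -EFinD lee_fin -subr_ge0.
  move: (Normc.normc (f x)) (Normc.normc (g x)) (normc_ge0 (f x)) (normc_ge0 (g x)) => a b a0 b0.
  have -> : a ^+ 2 + b ^+ 2 - a * b = (a - b) ^+ 2 + a * b by ring.
  by rewrite addr_ge0 ?sqr_ge0// mulr_ge0.
- rewrite ge0_integralD//; try by [exact: measurable_sqr_normc|move=> x _; rewrite lee_fin exprn_ge0 ?normc_ge0].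
  exact: lte_add_pinfty.
Qed.

(** Truncation to the set where |f| > 1 / (k + 1): there |f| <= (k + 1) |f|^2, so the truncated
    function is integrable, and it converges to f by domination. *)
Lemma L2_approx f : L2 f -> exists u : nat -> 'cV[R]_n -> R[i],
  (forall k, L1 (u k) /\ L2 (u k)) /\ sqnorm (fun x => u k x - f x) @[k --> \oo] --> 0%E.
Proof.
move=> [mf fi]; have mn := measurable_fun_normc mf.
pose A k : set 'cV[R]_n := [set x | k.+1%:R^-1 < Normc.normc (f x)].
have mA k : measurable (A k).
  rewrite (_ : A k = setT `&` (fun x => Normc.normc (f x)) @^-1` `]k.+1%:R^-1, +oo[%classic).
    by apply: mn => //; exact: measurable_itv.
  by rewrite setTI; apply/seteqP; split=> x /=; rewrite in_itv/= andbT.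
pose u k x : R[i] := f x * (\1_(A k) x)%:C%C.
have mu_ k : measurable_fun setT (u k).
  by apply: measurable_funcM => //; apply: measurable_fun_realc.
have nu k x : Normc.normc (u k x) = if x \in A k then Normc.normc (f x) else 0.
  rewrite Normc.normcM normc_real indicE; case: ifP => _; by rewrite ?normr1 ?normr0 ?mulr1 ?mulr0.
have sq0 (z : R[i]) : (0 <= (Normc.normc z ^+ 2)%:E)%E by rewrite lee_fin exprn_ge0 ?normc_ge0.
exists u; split.
  move=> k; split; split => //.
    apply: (@le_lt_trans _ _ (\int[mu]_x (k.+1%:R%:E * (Normc.normc (f x) ^+ 2)%:E))%E).
      apply: ge0_le_integral => //.
      - by move=> x _; rewrite lee_fin normc_ge0.
      - exact: measurable_normcE.
      - by apply: emeasurable_funM => //; exact: measurable_sqr_normc.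
      - move=> x _; rewrite -EFinM lee_fin nu; case: ifPn; last by rewrite mulr_ge0// exprn_ge0 ?normc_ge0.
        rewrite inE /A/= => kx; rewrite expr2 mulrA ler_peMl ?normc_ge0//.
        by rewrite -ler_pdivrMl ?ltr0n// mulr1 ltW.
    rewrite ge0_integralZl//; last exact: measurable_sqr_normc.
    exact: lte_mul_pinfty.
  apply: le_lt_trans fi; apply: ge0_le_integral => //; try exact: measurable_sqr_normc.
  move=> x _; rewrite lee_fin nu; case: ifP => // _.
  by rewrite expr0n/= exprn_ge0 ?normc_ge0.
have nd k x : Normc.normc (u k x - f x) = if x \in A k then 0 else Normc.normc (f x).
  rewrite /u indicE; case: ifP => _ /=.
    by rewrite (_ : (1 : R)%:C%C = 1)// mulr1 subrr Normc.normc0.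
  by rewrite (_ : (0 : R)%:C%C = 0)// mulr0 sub0r normcN.
have := @dominated_convergence _ _ _ mu setT measurableT
  (fun k x => (Normc.normc (u k x - f x) ^+ 2)%:E) (cst 0%E) (fun x => (Normc.normc (f x) ^+ 2)%:E).
case=> //.
- by move=> k; apply: measurable_sqr_normc; exact: measurable_funcB.
- apply: aeW => x _; apply: cvg_near_cst.
  have [fx0|fx0] := eqVneq (Normc.normc (f x)) 0.
    by apply: nearW => k; rewrite nd fx0 if_same expr0n.
  have fxp : 0 < Normc.normc (f x) by rewrite lt0r fx0 normc_ge0.
  near=> k; rewrite nd ifT ?expr0n// inE /A/=.
  rewrite invf_plt ?posrE// -natr1.
  apply: (@lt_trans _ _ k%:R); last by rewrite ltrDl.
  by near: k; exact: nbhs_infty_gtr.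
- by apply/integrableP; split; [exact: measurable_sqr_normc|under eq_integral do rewrite gee0_abs//].
- apply: aeW => x k _; rewrite gee0_abs// lee_fin nd; case: ifP => // _.
  by rewrite expr0n/= exprn_ge0 ?normc_ge0.
by move=> _ _; rewrite /= integral0.
Unshelve. all: by end_near. Qed.

Lemma fourierD f g (c : R[i]) gamma : L1 f -> L1 g ->
  fourier (fun x => f x + c * g x) gamma = fourier f gamma + c * fourier g gamma.
Proof.
move=> cf cg; have cfc := cintegrable_cis gamma cf; have cgc := cintegrable_cis gamma cg.
rewrite /fourier -[cintegral _]/(cint mu _) -[cintegral (fun x => f x * _)]/(cint mu _) -[cintegral (fun x => g x * _)]/(cint mu _).
rewrite -cintZ// -cintD//; last exact: cintegrableZ.
by apply: eq_cint => x; rewrite mulrDl mulrA.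
Qed.

Lemma fourierB f g gamma : L1 f -> L1 g ->
  fourier (fun x => f x - g x) gamma = fourier f gamma - fourier g gamma.
Proof.
move=> cf cg; rewrite -mulN1r -(fourierD _ _ cf cg); congr (fourier _ _).
by apply/funext => x; rewrite mulN1r.
Qed.

Lemma L1B f g : L1 f -> L1 g -> L1 (fun x => f x - g x).
Proof.
move=> cf cg; have : cintegrable mu (fun x => f x + -1 * g x).
  by apply: cintegrableD => //; exact: cintegrableZ.
by congr (L1 _); apply/funext => x; rewrite mulN1r.
Qed.

Lemma sqnorm_fourier f : L1 f -> sqnorm (fourier f) = sqnorm f.
Proof. exact: plancherel_L1. Qed.

(** A rapidly converging choice of approximants is Cauchy at the rate asked by [riesz_fischer]; by
    isometry on L1 so are the transforms, whose limit is the desired function. *)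
Lemma is_plancherel_exists f : L2 f -> exists g, is_plancherel f g.
Proof.
move=> L2f; have [v [Lv vf]] := L2_approx L2f.
(* A quarter of the target rate, because |p + q|^2 <= 2 |p|^2 + 2 |q|^2 is applied to two errors of
   size [b k]. *)
pose b k : R := ((8 ^ k.+1)%:R)^-1 / 4.
have b0 k : 0 < b k by rewrite divr_gt0// invr_gt0 ltr0n expn_gt0.
have /choice[N HN] : forall k, exists N, (sqnorm (fun x => v N x - f x)%R <= (b k)%:E)%E.
  move=> k; have [N _ /(_ N (leqnn N)) /= /ltW ?] := ge0_cvge0_near vf (b0 k).
  by exists N.
pose u k := v (N k); have Lu k : L1 (u k) /\ L2 (u k) by exact: Lv.
have mu_ k := (Lu k).1.1.
have bd k m : (k <= m)%N -> b m <= b k.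
  move=> km; rewrite ler_pM2r ?invr_gt0// lef_pV2 ?posrE ?ltr0n ?expn_gt0// ler_nat.
  by rewrite leq_exp2l.
have uC k m : (k <= m)%N -> (sqnorm (fun x => u m x - u k x)%R <= (((8 ^ k.+1)%:R)^-1)%:E)%E.
  move=> km.
  have -> : (fun x => u m x - u k x) = (fun x => (u m x - f x) + (f x - u k x)).
    by apply/funext => x; rewrite addrA subrK.
  apply: le_trans (sqnormD_le2 _ _) _; try by apply: measurable_funcB => //; exact: L2f.1.
  have -> : ((((8 ^ k.+1)%:R)^-1)%:E = 2%:E * (b k)%:E + 2%:E * (b k)%:E :> \bar R)%E.
    by rewrite -!EFinM -EFinD; congr EFin; rewrite /b; field; rewrite pnatr_eq0 -lt0n expn_gt0.
  apply: leeD; apply: lee_wpmul2l => //.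
    by apply: le_trans (HN m) _; rewrite lee_fin bd.
  by rewrite sqnormB_sym; exact: HN.
have FC k m : (k <= m)%N ->
    (\int[mu]_x (Normc.normc (fourier (u m) x - fourier (u k) x) ^+ 2)%:E <= (((8 ^ k.+1)%:R)^-1)%:E)%E.
  move=> km; apply: le_trans (uC k m km); rewrite -(sqnorm_fourier (L1B (Lu m).1 (Lu k).1)).
  rewrite le_eqVlt; apply/orP; left; apply/eqP; apply: eq_integral => x _.
  by rewrite (fourierB x (Lu m).1 (Lu k).1).
have [l ml lC] := riesz_fischer (fun k => measurable_fourier (mu_ k)) FC.
have pow8 (e : R) : 0 < e -> \forall k \near \oo, ((8 ^ k.+1)%:R)^-1 <= e.
  move=> e0; near=> k; rewrite invf_ple ?posrE ?ltr0n ?expn_gt0//.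
  apply: (@le_trans _ _ k%:R); first by apply/ltW; near: k; exact: nbhs_infty_gtr.
  by rewrite ler_nat; apply: ltnW; apply: ltn_trans (ltnSn k) _; exact: ltn_expl.
exists l; split.
  (* The limit is square integrable, being a transform of an L2 function plus an error of finite
     energy. *)
  split => //; have -> : l = (fun x => fourier (u 0%N) x + (l x - fourier (u 0%N) x)).
    by apply/funext => x; rewrite addrC subrK.
  have mF := measurable_fourier (mu_ 0%N).
  apply: le_lt_trans (sqnormD_le2 mF (measurable_funcB ml mF)) _.
  apply: lte_add_pinfty; apply: lte_mul_pinfty => //.
    by rewrite sqnorm_fourier; [exact: (Lu 0%N).2.2|exact: (Lu 0%N).1].
  by rewrite sqnormB_sym; apply: le_lt_trans (lC 0%N) _; exact: ltry.
exists u; split => //.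
- apply: ge0_cvge0P => [k|e e0]; first exact: sqnorm_ge0.
  near=> k; apply: le_trans (HN k) _; rewrite lee_fin /b.
  apply: (@le_trans _ _ ((8 ^ k.+1)%:R)^-1); last by near: k; exact: pow8.
  by rewrite ler_pdivrMr// ler_peMr ?ler1n// invr_ge0.
- apply: ge0_cvge0P => [k|e e0]; first exact: sqnorm_ge0.
  by near=> k; apply: le_trans (lC k) _; rewrite lee_fin; near: k; exact: pow8.
Unshelve. all: by end_near. Qed.

Lemma plancherelP f : L2 f -> is_plancherel f (plancherel f).
Proof. by move=> /is_plancherel_exists[g fg]; exact: (@xgetI _ (fun=> 0) [set g | is_plancherel f g] g fg). Qed.

(** Continuity of the squared norm in a form that avoids square roots of extended reals: the factor
    1 + t comes from the Peter-Paul inequality. *)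
Let sqnorm_le_of_cvg (a : nat -> 'cV[R]_n -> R[i]) f : L2 f ->
  (forall k, measurable_fun setT (a k)) -> sqnorm (fun x => a k x - f x) @[k --> \oo] --> 0%E ->
  forall t : R, 0 < t -> forall e : R, 0 < e ->
  \forall k \near \oo, (sqnorm f <= (1 + t)%:E * sqnorm (a k) + e%:E)%E /\
                       (sqnorm (a k) <= (1 + t)%:E * sqnorm f + e%:E)%E.
Proof.
move=> [mf fi] ma af t t0 e e0.
have d0 : 0 < e / (1 + t^-1) by rewrite divr_gt0// addr_gt0// invr_gt0.
have t1 : 0 < 1 + t^-1 by rewrite addr_gt0// invr_gt0.
near=> k.
have ak : (sqnorm (fun x => a k x - f x)%R <= (e / (1 + t^-1))%:E)%E.
  by apply/ltW; near: k; exact: ge0_cvge0_near.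
have bd : ((1 + t^-1)%:E * sqnorm (fun x => a k x - f x)%R <= e%:E)%E.
  apply: (@le_trans _ _ ((1 + t^-1)%:E * (e / (1 + t^-1))%:E)%E).
    by apply: lee_wpmul2l => //; rewrite lee_fin ltW.
  by rewrite -EFinM mulrC divfK// lt0r_neq0.
split.
- have -> : f = (fun x => a k x + (f x - a k x)) by apply/funext => x; rewrite addrC subrK.
  apply: le_trans (sqnormD_le t0 (ma k) (measurable_funcB mf (ma k))) _.
  by rewrite sqnormB_sym; apply: leeD.
- have -> : a k = (fun x => f x + (a k x - f x)) by apply/funext => x; rewrite addrC subrK.
  apply: le_trans (sqnormD_le t0 mf (measurable_funcB (ma k) mf)) _.
  by apply: leeD => //; move: bd; congr (_ <= _)%E; congr (_ * sqnorm _)%E; apply/funext => x; rewrite [X in _ = X - _]addrC subrK.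
Unshelve. all: by end_near. Qed.

(** The isometry on the approximants passes to the limit; [key] is stated for two arbitrary
    sequences of equal norms so that it yields both inequalities. *)
Lemma sqnorm_plancherel f g : L2 f -> is_plancherel f g -> sqnorm g = sqnorm f.
Proof.
move=> L2f [L2g [u [Lu uf ug]]].
have mu_ k := (Lu k).1.1.
have mF k := measurable_fourier (mu_ k).
have fin (h : 'cV[R]_n -> R[i]) : L2 h -> sqnorm h \is a fin_num by move=> [_ hi]; rewrite ge0_fin_numE//; exact: sqnorm_ge0.
have key (h1 h2 : 'cV[R]_n -> R[i]) (a b : nat -> 'cV[R]_n -> R[i]) : L2 h1 -> L2 h2 ->
  (forall k, measurable_fun setT (a k)) -> (forall k, measurable_fun setT (b k)) ->
  (forall k, sqnorm (a k) = sqnorm (b k)) ->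
  sqnorm (fun x => a k x - h1 x) @[k --> \oo] --> 0%E ->
  sqnorm (fun x => b k x - h2 x) @[k --> \oo] --> 0%E -> (sqnorm h1 <= sqnorm h2)%E.
  move=> L1' L2' ma mb ab a1 b2.
  rewrite -(fineK (fin _ L1')) -(fineK (fin _ L2')) lee_fin.
  set p := fine (sqnorm h1); set q := fine (sqnorm h2).
  have q0 : 0 <= q by rewrite fine_ge0// sqnorm_ge0.
  have H (t : R) : 0 < t -> p <= (1 + t) * ((1 + t) * q + t) + t.
    move=> t0.
    have [N1 _ H1] := sqnorm_le_of_cvg L1' ma a1 t0 t0.
    have [N2 _ H2] := sqnorm_le_of_cvg L2' mb b2 t0 t0.
    pose N := maxn N1 N2.
    have [E1 _] := H1 N (leq_maxl _ _); have [_ E2] := H2 N (leq_maxr _ _).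
    rewrite -lee_fin /p fineK ?fin//; apply: (le_trans E1).
    rewrite [leRHS]EFinD EFinM leeD2r//; apply: lee_wpmul2l; first by rewrite lee_fin addr_ge0// ltW.
    by rewrite ab; apply: (le_trans E2); rewrite [leRHS]EFinD [in leRHS]EFinM /q fineK ?fin.
  apply/ler_addgt0Pr => e e0.
  (* For t <= 1 the right-hand side of [H] is at most q + t (3 q + 3), since t^2 <= t. *)
  pose t := Num.min 1 (e / (3 * q + 3)).
  have D0 : 0 < 3 * q + 3 by rewrite ltr_wpDl// mulr_ge0.
  have t0 : 0 < t by rewrite lt_min ltr01 divr_gt0.
  have t1 : t <= 1 by rewrite ge_min lexx.
  have te : t * (3 * q + 3) <= e by rewrite -ler_pdivlMr// ge_min lexx orbT.
  apply: (le_trans (H t t0)).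
  have tt : t * t <= t by rewrite ler_piMr// ltW.
  have ttq : t * t * q <= t * q by rewrite ler_wpM2r.
  nra.
apply/eqP; rewrite eq_le; apply/andP; split.
- by apply: (key _ _ (fun k => fourier (u k)) u) => // k; apply: sqnorm_fourier; exact: (Lu k).1.
- by apply: (key _ _ u (fun k => fourier (u k))) => // k; rewrite sqnorm_fourier//; exact: (Lu k).1.
Qed.

Lemma is_plancherelD f g F G (c : R[i]) : L2 f -> L2 g -> is_plancherel f F -> is_plancherel g G ->
  is_plancherel (fun x => f x + c * g x) (fun x => F x + c * G x).
Proof.
move=> L2f L2g [L2F [u [Lu uf uF]]] [L2G [v [Lv vg vG]]].
split; first by apply: L2D => //; exact: L2Z.
exists (fun k x => u k x + c * v k x).
have comb (a b : nat -> 'cV[R]_n -> R[i]) (p q : 'cV[R]_n -> R[i]) : (forall k, measurable_fun setT (a k)) ->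
    (forall k, measurable_fun setT (b k)) -> measurable_fun setT p -> measurable_fun setT q ->
    sqnorm (fun x => a k x - p x) @[k --> \oo] --> 0%E ->
    sqnorm (fun x => b k x - q x) @[k --> \oo] --> 0%E ->
    sqnorm (fun x => (a k x + c * b k x) - (p x + c * q x)) @[k --> \oo] --> 0%E.
  move=> ma mb mp mq ap bq.
  apply: (@ge0_cvge0_leD _ _ (fun k => 2%:E * sqnorm (fun x => a k x - p x)%R)%E
    (fun k => 2%:E * ((Normc.normc c ^+ 2)%:E * sqnorm (fun x => b k x - q x)%R))%E).
  - by move=> k; exact: sqnorm_ge0.
  - move=> k; have -> : (fun x => (a k x + c * b k x) - (p x + c * q x)) = (fun x => (a k x - p x) + c * (b k x - q x)).
      by apply/funext => x; ring.
    apply: le_trans (sqnormD_le2 _ _) _.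
    + exact: measurable_funcB.
    + by apply: measurable_funcM => //; exact: measurable_funcB.
    + by rewrite sqnormZ//; exact: measurable_funcB.
  - by rewrite -(mule0 2%:E); apply: cvgeZl.
  - rewrite -(mule0 2%:E) -[X in (_ * X)%E](mule0 (Normc.normc c ^+ 2)%:E).
    by apply: cvgeZl => //; apply: cvgeZl.
split.
- move=> k; split; first by apply: cintegrableD; [exact: (Lu k).1|apply: cintegrableZ; exact: (Lv k).1].
  by apply: L2D; [exact: (Lu k).2|apply: L2Z; exact: (Lv k).2].
- by apply: comb => //; [move=> k; exact: (Lu k).1.1|move=> k; exact: (Lv k).1.1|exact: L2f.1|exact: L2g.1].
- under eq_fun => k.
    under [X in sqnorm X]eq_fun do rewrite (fourierD _ _ (Lu k).1 (Lv k).1).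
    over.
  apply: comb => //; [move=> k|move=> k|exact: L2F.1|exact: L2G.1].
    by apply: measurable_fourier; exact: (Lu k).1.1.
  by apply: measurable_fourier; exact: (Lv k).1.1.
Qed.

Let sqnorm_Rintegral f : fine (sqnorm f) = \int[mu]_x (Normc.normc (f x) ^+ 2).
Proof. by []. Qed.

(** Polarization; the coefficients 1 and -1 are written out to match the shape f + c g of
    [is_plancherelD]. *)
Let Re_inner f g : L2 f -> L2 g ->
  complex.Re (inner f g) = 4^-1 * (fine (sqnorm (fun x => f x + 1 * g x)) - fine (sqnorm (fun x => f x + -1 * g x))).
Proof.
move=> L2f L2g.
have is2 c : mu.-integrable setT (EFin \o (fun x => Normc.normc (f x + c * g x) ^+ 2)).
  have [m i] := L2D L2f (L2Z c L2g).
  apply/integrableP; split; first exact: measurable_sqr_normc.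
  by under eq_integral do rewrite gee0_abs ?lee_fin ?exprn_ge0 ?normc_ge0//.
rewrite !sqnorm_Rintegral -RintegralB// -RintegralZl//.
  apply: eq_Rintegral => x _ /=; rewrite !sqr_normcE.
  by case: (f x) (g x) => a b [a' b'] /=; field.
by have := integrableB measurableT (is2 1) (is2 (-1)); exact: eq_integrable.
Qed.

(** Polarization reduces the real part to [sqnorm_plancherel] and the imaginary part to the real
    one. *)
Theorem parseval f g F G : L2 f -> L2 g -> is_plancherel f F -> is_plancherel g G -> inner f g = inner F G.
Proof.
move=> L2f L2g fF gG; have L2F := fF.1; have L2G := gG.1.
have ReE g' G' : L2 g' -> is_plancherel g' G' -> complex.Re (inner f g') = complex.Re (inner F G').
  move=> L2g' gG'; rewrite Re_inner// Re_inner//; last exact: gG'.1.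
  have E c := sqnorm_plancherel (L2D L2f (L2Z c L2g')) (is_plancherelD c L2f L2g' fF gG').
  by rewrite !E.
pose i : R[i] := (0 +i* 1)%C.
(* Im <f, g> = Re <f, i g>, where i g is written g + (i - 1) g in order to use [is_plancherelD]. *)
have ImE f' g' : complex.Im (inner f' g') = complex.Re (inner f' (fun x => g' x + (i - 1) * g' x)).
  rewrite /inner /cintegral /=; apply: eq_Rintegral => x _ /=.
  by case: (f' x) (g' x) => a b [a' b'] /=; ring.
apply/eqP; rewrite eq_complex; apply/andP; split; apply/eqP; first exact: ReE.
rewrite !ImE; apply: ReE; first by apply: L2D => //; exact: L2Z.
exact: is_plancherelD.
Qed.

End L2_space.

(** * Covariance, and the slices of the wavelet transform *)

Section covariance.
Context {R : realType} {n : nat}.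
Local Notation mu := (@lebesgue_cV R n).
Implicit Types (f g psi u : 'cV[R]_n -> R[i]) (h : 'M[R]_n) (x xi y gamma : 'cV[R]_n).

Lemma dotpC x y : dotp x y = dotp y x.
Proof. by apply: eq_bigr => i _; rewrite mulrC. Qed.

Lemma dotpDl x y gamma : dotp (x + y) gamma = dotp x gamma + dotp y gamma.
Proof. by rewrite -big_split; apply: eq_bigr => i _; rewrite mxE mulrDl. Qed.

Lemma dotpDr gamma x y : dotp gamma (x + y) = dotp gamma x + dotp gamma y.
Proof. by rewrite dotpC dotpDl !(dotpC gamma). Qed.

Lemma dotpNr x y : dotp x (- y) = - dotp x y.
Proof. by rewrite -sumrN; apply: eq_bigr => i _; rewrite mxE mulrN. Qed.

Lemma dotpE x y : dotp x y = (x^T *m y) 0 0.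
Proof. by rewrite mxE; apply: eq_bigr => i _; rewrite mxE. Qed.

Lemma dotp_mulmx h x y : dotp (h *m x) y = dotp x (h^T *m y).
Proof. by rewrite !dotpE trmx_mul mulmxA. Qed.

(** The argument on both sides of the transform: with h^-1 and x in space, with h^T and xi in
    frequency. *)
Definition affine_cV h x y := h *m (y - x).

Lemma measurable_affine_cV h x : measurable_fun setT (affine_cV h x).
Proof. exact: measurableT_comp (measurable_mulmxl h) (measurable_cVD (- x)). Qed.

Lemma ge0_integral_affine_cV h x (F : 'cV[R]_n -> \bar R) : h \in unitmx ->
  measurable_fun setT F -> (forall v, (0 <= F v)%E) ->
  (\int[mu]_v F (affine_cV h x v) = (`|\det h|^-1)%:E * \int[mu]_v F v)%E.
Proof.
move=> hu mF F0; have mFh := measurableT_comp mF (measurable_mulmxl h).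
rewrite -(ge0_integral_mulmx hu mF F0).
by rewrite -(ge0_integral_cV_translate (- x) mFh (fun v => F0 _)).
Qed.

Lemma sqnorm_affine_cV h x f : h \in unitmx -> measurable_fun setT f ->
  sqnorm (fun v => f (affine_cV h x v)) = ((`|\det h|^-1)%:E * sqnorm f)%E.
Proof.
move=> hu mf; rewrite /sqnorm -(ge0_integral_affine_cV x hu (measurable_sqr_normc mf))//.
by move=> v; rewrite lee_fin exprn_ge0 ?normc_ge0.
Qed.

Lemma unitmx_normr_det_gt0 h : h \in unitmx -> 0 < `|\det h|.
Proof. by rewrite unitmxE unitfE normr_gt0. Qed.

Section weighted_affine.
Variables (h : 'M[R]_n) (x : 'cV[R]_n) (c : 'cV[R]_n -> R[i]) (k : R).
Hypotheses (hu : h \in unitmx) (mc : measurable_fun setT c) (ck : forall v, Normc.normc (c v) = k).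
(** Common form of [quasi_regular] and [frequency_side]: an affine change of the argument and a
    weight of constant modulus [k], hence a multiple of an isometry of L2. *)
Let T u v := c v * u (affine_cV h x v).

Lemma measurable_weighted_affine u : measurable_fun setT u -> measurable_fun setT (T u).
Proof.
by move=> mu_; apply: measurable_funcM => //; exact: measurableT_comp mu_ (@measurable_affine_cV h x).
Qed.

Lemma sqnorm_weighted_affine u : measurable_fun setT u ->
  sqnorm (T u) = ((k ^+ 2)%:E * ((`|\det h|^-1)%:E * sqnorm u))%E.
Proof.
move=> mu_; have mua := measurableT_comp mu_ (@measurable_affine_cV h x).
rewrite -(sqnorm_affine_cV x hu mu_) /sqnorm -ge0_integralZl//; last 3 first.
- exact: measurable_sqr_normc.
- by move=> v _; rewrite lee_fin exprn_ge0 ?normc_ge0.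
- by rewrite lee_fin sqr_ge0.
by apply: eq_integral => v _; rewrite /T Normc.normcM ck exprMn EFinM.
Qed.

Lemma L2_weighted_affine u : L2 u -> L2 (T u).
Proof.
move=> [mu_ ui]; split; first exact: measurable_weighted_affine.
rewrite sqnorm_weighted_affine//; apply: lte_mul_pinfty; rewrite ?lee_fin ?sqr_ge0//.
by apply: lte_mul_pinfty; rewrite ?lee_fin ?invr_ge0.
Qed.

Lemma L1_weighted_affine u : L1 u -> L1 (T u).
Proof.
move=> Lu; have [mu_ ui] := Lu; split; first exact: measurable_weighted_affine.
under eq_integral do rewrite /T Normc.normcM ck EFinM.
have mn := measurable_normcE mu_.
have k0 : 0 <= k by rewrite -(ck 0) normc_ge0.
rewrite ge0_integralZl ?lee_fin//; last 2 first.
- exact: measurableT_comp mn (@measurable_affine_cV h x).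
- by move=> v _; rewrite lee_fin normc_ge0.
apply: lte_mul_pinfty; rewrite ?lee_fin//.
rewrite (ge0_integral_affine_cV x hu mn) => [|v]; last by rewrite lee_fin normc_ge0.
by apply: lte_mul_pinfty; rewrite ?lee_fin ?invr_ge0.
Qed.

Lemma cvg_sqnorm_weighted_affine (u : nat -> 'cV[R]_n -> R[i]) f :
  (forall m, measurable_fun setT (u m)) -> measurable_fun setT f ->
  sqnorm (fun v => u m v - f v) @[m --> \oo] --> 0%E ->
  sqnorm (fun v => T (u m) v - T f v) @[m --> \oo] --> 0%E.
Proof.
move=> mu_ mf uf.
have -> : (fun m => sqnorm (fun v => T (u m) v - T f v)) =
    (fun m => ((k ^+ 2)%:E * ((`|\det h|^-1)%:E * sqnorm (fun v => u m v - f v)%R))%E).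
  apply/funext => m; rewrite -sqnorm_weighted_affine; last exact: measurable_funcB.
  by congr sqnorm; apply/funext => v; rewrite /T mulrBr.
rewrite -(mule0 (k ^+ 2)%:E) -[X in (_ * X)%E](mule0 (`|\det h|^-1)%:E).
by apply: cvgeZl => //; apply: cvgeZl.
Qed.

End weighted_affine.

(** The quasi-regular representation conjugated by the Fourier transform. The exponent 1/2 is the
    exponent -1/2 of the dilation plus 1 from the change of variables. *)
Definition frequency_side (p : @awh_type R n) g : 'cV[R]_n -> R[i] :=
  let: (z, x, xi, h) := p in
  fun gamma => z * (`|\det h| `^ 2^-1)%:C%C * cis (- dotp gamma x) * g (affine_cV h^T xi gamma).

Let delta h : R := `|\det h| `^ (- 2^-1).

Lemma quasi_regularE (z : R[i]) x xi h u : quasi_regular (z, x, xi, h) u =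
  fun y => z * (cis (dotp (y - x) xi) * (delta h)%:C%C) * u (affine_cV (invmx h) x y).
Proof. by apply/funext => y; rewrite /= /translation /modulation /dilation !mulrA. Qed.

Let measurable_weight (z : R[i]) x xi (a : R) :
  measurable_fun setT (fun y : 'cV[R]_n => z * (cis (dotp (y - x) xi) * a%:C%C)).
Proof.
apply: measurable_funcM => //; apply: measurable_funcM => //.
by apply: measurable_fun_cis; apply: measurable_dotp => //; exact: measurable_cVD.
Qed.

Let normc_weight (z : R[i]) x xi (a : R) y :
  Normc.normc (z * (cis (dotp (y - x) xi) * a%:C%C)) = Normc.normc z * `|a|.
Proof. by rewrite !Normc.normcM normc_cis mul1r normc_real. Qed.

Lemma L2_quasi_regular (z : R[i]) x xi h u : h \in unitmx -> L2 u -> L2 (quasi_regular (z, x, xi, h) u).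
Proof.
move=> hu Lu; rewrite quasi_regularE.
have hi : invmx h \in unitmx by rewrite unitmx_inv.
exact: (L2_weighted_affine x hi (measurable_weight z x xi (delta h)) (normc_weight z x xi (delta h))) Lu.
Qed.

Let eta_delta h : h \in unitmx -> `|\det h| * delta h = `|\det h| `^ 2^-1.
Proof.
move=> /unitmx_normr_det_gt0 d0; rewrite -{1}(powRr1 (ltW d0)) -powRD; last by apply/implyP => _; rewrite gt_eqF.
by congr (_ `^ _); field.
Qed.

(** Substitute w = h^-1 (y - x); [G] is the integrand in the variable w. *)
Lemma fourier_quasi_regular (z : R[i]) x xi h u : h \in unitmx -> L1 u ->
  fourier (quasi_regular (z, x, xi, h) u) = frequency_side (z, x, xi, h) (fourier u).
Proof.
move=> hu Lu; apply/funext => gamma; rewrite quasi_regularE /frequency_side.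
pose c := z * (delta h)%:C%C * cis (- dotp gamma x).
pose G w := c * (u w * cis (- dotp (affine_cV h^T xi gamma) w)).
have cG : cintegrable mu G by apply: cintegrableZ; exact: cintegrable_cis.
transitivity (cint mu (fun y => G (affine_cV (invmx h) x y))).
  apply: eq_cint => y; rewrite /G /c.
  set w := affine_cV (invmx h) x y.
  have yE : y = h *m w + x by rewrite /w /affine_cV mulmxA mulmxV// mul1mx subrK.
  (* Splits <gamma, y> with y = h w + x; the last phase cancels the modulation. *)
  have -> : - dotp gamma y = - dotp gamma x + (- dotp (affine_cV h^T xi gamma) w - dotp (y - x) xi).
    rewrite {1 2}yE addrK dotpDr /affine_cV dotp_mulmx trmxK.
    rewrite -(dotpC (h *m w)) -(dotpC (h *m w)) dotpDr dotpNr.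
    by ring.
  rewrite !cisD -(conjc_cis (dotp (y - x) xi)); set e := cis (dotp (y - x) xi).
  have ee : e * conjc e = 1 by rewrite mulc_conjc normc_cis expr1n.
  transitivity (e * conjc e * (c * (u w * cis (- dotp (affine_cV h^T xi gamma) w)))).
    by rewrite /c; ring.
  by rewrite ee mul1r.
rewrite (cint_comp_scale (phi := affine_cV (invmx h) x) (k := `|\det h|)) => [|F mF F0|//]; last first.
  by rewrite ge0_integral_affine_cV ?unitmx_inv// det_inv normfV invrK.
rewrite cintZ; last exact: cintegrable_cis.
rewrite -(eta_delta hu) rmorphM /c /fourier -[cintegral _]/(cint mu _); ring.
Qed.

(** Both sides are multiples of isometries of L2, so the intertwining relation passes from L1 to the
    closed graph. *)
Lemma is_plancherel_quasi_regular (z : R[i]) x xi h psi g : h \in unitmx -> L2 psi ->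
  is_plancherel psi g -> is_plancherel (quasi_regular (z, x, xi, h) psi) (frequency_side (z, x, xi, h) g).
Proof.
move=> hu L2psi [L2g [u [Lu uf ug]]].
have hi : invmx h \in unitmx by rewrite unitmx_inv.
have ht : h^T \in unitmx by rewrite unitmx_tr.
pose c gamma := z * (`|\det h| `^ 2^-1)%:C%C * cis (- dotp gamma x).
have mc : measurable_fun setT c.
  by apply: measurable_funcM => //; apply: measurable_fun_cis; apply: measurableT_comp => //; exact: measurable_dotp.
have ck v : Normc.normc (c v) = Normc.normc (z * (`|\det h| `^ 2^-1)%:C%C).
  by rewrite /c Normc.normcM normc_cis mulr1.
have mw := measurable_weight z x xi (delta h).
have wk := normc_weight z x xi (delta h).
split; first exact: (L2_weighted_affine xi ht mc ck).
exists (fun k => quasi_regular (z, x, xi, h) (u k)); split.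
- move=> k; rewrite quasi_regularE; split.
    by apply: (L1_weighted_affine x hi mw wk); exact: (Lu k).1.
  by apply: (L2_weighted_affine x hi mw wk); exact: (Lu k).2.
- rewrite (_ : (fun k => _) = (fun k => sqnorm (fun y =>
    z * (cis (dotp (y - x) xi) * (delta h)%:C%C) * u k (affine_cV (invmx h) x y) -
    z * (cis (dotp (y - x) xi) * (delta h)%:C%C) * psi (affine_cV (invmx h) x y))%R)); last first.
    by apply/funext => k; rewrite !quasi_regularE.
  exact: (cvg_sqnorm_weighted_affine x hi wk (fun k => (Lu k).1.1) L2psi.1 uf).
- rewrite (_ : (fun k => _) = (fun k => sqnorm (fun gamma => frequency_side (z, x, xi, h) (fourier (u k)) gamma -
    frequency_side (z, x, xi, h) g gamma)%R)); last first.
    by apply/funext => k; rewrite (fourier_quasi_regular _ _ _ hu (Lu k).1).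
  exact: (cvg_sqnorm_weighted_affine xi ht ck (fun k => measurable_fourier (Lu k).1.1) L2g.1 ug).
Qed.

Lemma integral_wavelet_slice (z : R[i]) xi h psi f : h \in unitmx -> Normc.normc z = 1 -> L2 psi -> L2 f ->
  (\int[mu]_x (Normc.normc (wavelet_transform psi f (z, x, xi, h)) ^+ 2)%:E =
   \int[mu]_w (Normc.normc (plancherel f w) ^+ 2 *
     (`|\det h| * Normc.normc (plancherel psi (h^T *m (w - xi))) ^+ 2))%:E)%E.
Proof.
move=> hu z1 L2psi L2f.
have Pf := plancherelP L2f; have Ppsi := plancherelP L2psi.
set F := plancherel f; set G := plancherel psi; set e := `|\det h| `^ 2^-1.
pose phi w := e%:C%C * G (affine_cV h^T xi w) * conjc (F w).
have Lphi : cintegrable mu phi.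
  apply: L2M_cintegrable; last exact: Pf.1.
  have ht : h^T \in unitmx by rewrite unitmx_tr.
  by apply: (L2_weighted_affine xi ht (c := cst e%:C%C) (k := Normc.normc e%:C%C)) => //; exact: Ppsi.1.
have WE x : Normc.normc (wavelet_transform psi f (z, x, xi, h)) = Normc.normc (fourier phi x).
  rewrite /wavelet_transform (parseval L2f (L2_quasi_regular z x xi hu L2psi) Pf
    (is_plancherel_quasi_regular z x xi hu L2psi Ppsi)).
  (* Conjugation turns the character of <w, x> into the one with the sign used by [fourier]; the
     conjugate of z, of modulus 1, is absorbed on the right. *)
  rewrite -[LHS]normc_conjc /inner -[cintegral _]/(cint mu _) -cint_conjc; last exact:
    (L2M_cintegrable Pf.1 (is_plancherel_quasi_regular z x xi hu L2psi Ppsi).1).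
  rewrite -[RHS]mul1r -z1 -Normc.normcM /fourier -[cintegral _]/(cint mu _).
  rewrite -cintZ; last exact: cintegrable_cis.
  congr Normc.normc; apply: eq_cint => w; rewrite conjcM conjcK /phi /frequency_side (dotpC x) -/e -/F -/G.
  ring.
under eq_integral do rewrite WE.
rewrite (plancherel_L1 Lphi); apply: eq_integral => w _; congr EFin.
rewrite /phi !Normc.normcM normc_conjc normc_real !exprMn real_normK ?num_real//.
by rewrite /e -powR_mulrn ?powR_ge0// -powRrM mulVf// powRr1// mulrC.
Qed.

End covariance.

(** * Measurability and sigma-finiteness *)

Section matrix_measurability.
Context {R : realType} d (T : measurableType d).

Lemma measurable_fun_entry m n (A : T -> 'M[R]_(m, n)) i j : measurable_fun setT A ->
  measurable_fun setT (fun x => A x i j).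
Proof. exact: measurableT_comp (measurable_entry i j). Qed.

Lemma measurable_fun_mulmx m n p (A : T -> 'M[R]_(m, n)) (B : T -> 'M[R]_(n, p)) :
  measurable_fun setT A -> measurable_fun setT B -> measurable_fun setT (fun x => A x *m B x).
Proof.
move=> mA mB; apply: measurable_fun_mx => i j; under eq_fun do rewrite mxE.
by apply: measurable_sum => k; apply: measurable_funM; exact: measurable_fun_entry.
Qed.

Lemma measurable_fun_submx m n (A B : T -> 'M[R]_(m, n)) :
  measurable_fun setT A -> measurable_fun setT B -> measurable_fun setT (fun x => A x - B x).
Proof.
move=> mA mB; apply: measurable_fun_mx => i j; under eq_fun do rewrite !mxE.
by apply: measurable_funB; exact: measurable_fun_entry.
Qed.

Lemma measurable_fun_trmx m n (A : T -> 'M[R]_(m, n)) :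
  measurable_fun setT A -> measurable_fun setT (fun x => (A x)^T).
Proof.
move=> mA; apply: measurable_fun_mx => i j; under eq_fun do rewrite mxE.
exact: measurable_fun_entry.
Qed.

Lemma measurable_fun_det n (A : T -> 'M[R]_n) :
  measurable_fun setT A -> measurable_fun setT (fun x => \det (A x)).
Proof.
move=> mA; rewrite /determinant; apply: measurable_sum => s.
apply: measurable_funM => //; apply: measurable_prod => i _.
exact: measurable_fun_entry.
Qed.

Lemma measurable_fun_inv (f : T -> R) : measurable_fun setT f -> measurable_fun setT (fun x => (f x)^-1).
Proof.
(* Writing 1/y as y (y^2)^-1 reduces inversion to a real power of a nonnegative number; at y = 0
   both sides are 0. *)
move=> mf; rewrite (_ : (fun _ => _) = fun x => f x * (f x ^+ 2) `^ (-1)).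
  apply: measurable_funM => //; apply: (measurableT_comp (@measurable_powR R (-1))).
  exact: measurable_funX.
apply/funext => x; rewrite powR_inv1 ?sqr_ge0//.
by have [->|fx0] := eqVneq (f x) 0; [rewrite invr0 mul0r|field].
Qed.

Lemma measurable_fun_invmx n (A : T -> 'M[R]_n) :
  measurable_fun setT A -> measurable_fun setT (fun x => invmx (A x)).
Proof.
move=> mA; rewrite /invmx.
(* [invmx] is the identity on singular matrices and given by cofactors on the others. *)
have mU : measurable_fun setT (fun x => A x \in unitmx).
  under eq_fun do rewrite unitmxE unitfE.
  by apply: measurable_neg; apply: measurable_fun_eqr => //; exact: measurable_fun_det.
apply: measurable_fun_ifT => //.
apply: measurable_fun_mx => i j; under eq_fun do rewrite !mxE.
apply: measurable_funM; first by apply: measurable_fun_inv; exact: measurable_fun_det.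
apply: measurable_funM => //; apply: measurable_fun_det.
apply: measurable_fun_mx => k l; under eq_fun do rewrite !mxE.
exact: measurable_fun_entry.
Qed.

End matrix_measurability.

Section matrix_topology.
Context {R : realType}.

(** The sigma-algebra is generated by the entries; an open set is a countable union of boxes with
    rational centres and radii 1 / (k + 1). *)
Lemma open_measurable_mx m n (O : set 'M[R]_(m, n)) : open O -> measurable O.
Proof.
move=> oO.
pose B (q : 'M[rat]_(m, n) * nat) : set 'M[R]_(m, n) :=
  [set M | forall i j, `|ratr (q.1 i j) - M i j| < q.2.+1%:R^-1].
have mB q : measurable (B q).
  rewrite (_ : B q = \bigcap_(ij in [set: 'I_m * 'I_n])
      [set M : 'M[R]_(m, n) | `|ratr (q.1 ij.1 ij.2) - M ij.1 ij.2| < q.2.+1%:R^-1]); last first.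
    apply/seteqP; split=> [M MB [i j] _|M MB i j]; first exact: MB.
    exact: (MB (i, j)).
  apply: fin_bigcap_measurable => [|[i j] _]; first exact: finite_finset.
  rewrite -[X in measurable X]setTI.
  apply: (measurable_fun_ltr (f := fun M : 'M[R]_(m, n) => `|ratr (q.1 i j) - M i j|)) => //.
  apply: measurableT_comp => //; apply: measurable_funB => //; exact: measurable_entry.
have -> : O = \bigcup_(q in [set q | B q `<=` O]) B q.
  apply/seteqP; split=> [M OM|M [q /= + Mq]]; last exact.
  have /nbhs_ballP[e /= e0 eO] : nbhs M O by exact: open_nbhs_nbhs.
  have e20 : 0 < e / 2 by rewrite divr_gt0.
  pose k := Num.truncn (e / 2)^-1.
  have ke : k.+1%:R^-1 < e / 2.
    by rewrite invf_plt ?posrE// truncnS_gt.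
  have /choice[q qM] : forall ij : 'I_m * 'I_n, exists q : rat, `|ratr q - M ij.1 ij.2| < k.+1%:R^-1.
    move=> ij; have k0 : 0 < k.+1%:R^-1 :> R by rewrite invr_gt0.
    have /rat_in_itvoo[q] : M ij.1 ij.2 - k.+1%:R^-1 < M ij.1 ij.2 + k.+1%:R^-1.
      by rewrite ltrD2l gtrN.
    by rewrite in_itv/= => /andP[q1 q2]; exists q; rewrite ltr_distl q1 q2.
  exists (\matrix_(i, j) q (i, j), k) => /=; last by move=> i j; rewrite mxE; exact: (qM (i, j)).
  move=> N NB; apply: eO; split => // i j; rewrite /ball/=.
  have -> : M i j - N i j = - (ratr (q (i, j)) - M i j) + (ratr (q (i, j)) - N i j) by ring.
  apply: le_lt_trans (ler_normD _ _) _; rewrite normrN (splitr e) ltrD//.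
    exact: lt_trans (qM (i, j)) ke.
  by have := NB i j; rewrite mxE => /lt_trans; apply.
rewrite bigcup_mkcond; apply: countable_bigcupT_measurable => [|q]; first exact: countableP.
by case: ifP.
Qed.

Lemma closed_measurable_mx m n (C : set 'M[R]_(m, n)) : closed C -> measurable C.
Proof. by move=> cC; rewrite -[C]setCK; apply: measurableC; apply: open_measurable_mx; exact: closed_openC. Qed.

Lemma continuous_det n : continuous (fun h : 'M[R]_n => \det h).
Proof.
move=> h; rewrite /determinant; apply: (@cvg_big _ _ _ 0 xpredT add_continuous _ (nbhs h)) => s _.
apply: cvgM; first exact: cvg_cst.
have W := @cvg_big R 'I_n _ 1 xpredT mul_continuous _ (nbhs h) (index_enum 'I_n)
  (fun i (x : 'M[R]_n) => x i (perm.fun_of_perm s i)) (fun i => h i (perm.fun_of_perm s i)).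
by apply: W => i _; exact: coord_continuous.
Qed.

(** Transported from row vectors, where a product of segments is compact, by the continuous map
    [vec_mx]. *)
Lemma compact_mx_box m n (k : R) : compact [set h : 'M[R]_(m, n) | forall i j, `|h i j| <= k].
Proof.
pose B := [set v : 'rV[R]_(m * n) | forall i, `[- k, k]%classic (v ord0 i)].
have cB : compact B by apply: (@rV_compact _ _ (fun=> `[- k, k]%classic)) => i; exact: segment_compact.
have cv : {within B, continuous (@vec_mx R m n)}.
  apply: continuous_subspaceT => v A /nbhs_ballP[e /= e0 eA].
  apply/nbhs_ballP; exists e => //= w [_ vw]; apply: eA; split => // i j.
  by rewrite !mxE; exact: vw.
rewrite (_ : mkset _ = @vec_mx R m n @` B); first exact: continuous_compact.
apply/seteqP; split=> [h hk|_ [v vB <-] i j].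
  exists (mxvec h); last exact: mxvecK.
  by move=> i; case/mxvec_indexP: i => i j; rewrite mxvecE /= in_itv/= -ler_norml.
by rewrite mxE ler_norml; have := vB (mxvec_index i j); rewrite /= in_itv.
Qed.

End matrix_topology.

(** * Integration against a measure given by a density *)

Section density.
Context d (T : measurableType d) (R : realType) (mu : {measure set T -> \bar R}) (w : T -> R).
Hypotheses (mw : measurable_fun setT w) (w0 : forall x, 0 <= w x).

(** [tc_haar V nu] converts to this, with the determinant quotient as [w]. *)
Definition density_measure (A : set T) : \bar R := (\int[mu]_(x in A) (w x)%:E)%E.

Let density0 : density_measure set0 = 0%E. Proof. exact: integral_set0. Qed.

Let density_ge0 A : (0 <= density_measure A)%E. Proof. by apply: integral_ge0 => x _; rewrite lee_fin. Qed.

Let density_additive : semi_sigma_additive density_measure.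
Proof.
apply: (semi_sigma_additive_nng_induced (f := fun x => (w x)%:E)) => [|x]; last by rewrite lee_fin.
exact/measurable_EFinP.
Qed.

HB.instance Definition _ := isMeasure.Build _ _ _ density_measure density0 density_ge0 density_additive.

Import HBNNSimple.

Let density_indic E : measurable E ->
  (\int[density_measure]_x (\1_E x)%:E = \int[mu]_x ((w x)%:E * (\1_E x)%:E))%E.
Proof.
move=> mE; rewrite integral_indic//= setIT /density_measure integral_mkcond.
apply: eq_integral => x _; rewrite patchE indicE; case: ifP => _; by rewrite ?mule1 ?mule0.
Qed.

Let density_nnsfun (f : {nnsfun T >-> R}) :
  (\int[density_measure]_x (f x)%:E = \int[mu]_x ((w x)%:E * (f x)%:E))%E.
Proof.
under [LHS]eq_integral do rewrite fimfunE -fsumEFin//.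
rewrite [LHS]ge0_integral_fsum//; last 2 first.
  - by move=> r; exact/measurable_EFinP/measurableT_comp.
  - by move=> m x _; rewrite EFinM nnfun_muleindic_ge0.
under [RHS]eq_integral.
  move=> x xD; rewrite fimfunE -fsumEFin// ge0_mule_fsumr; last first.
    by move=> r; rewrite EFinM nnfun_muleindic_ge0.
  over.
rewrite [RHS]ge0_integral_fsum//; last 2 first.
  - move=> r; apply: emeasurable_funM; apply/measurable_EFinP => //.
    by apply: measurable_funM => //; exact: measurable_indic.
  - by move=> m x _; apply: mule_ge0; [rewrite lee_fin|rewrite EFinM nnfun_muleindic_ge0].
apply: eq_fsbigr => r _.
have mI : measurable_fun setT (fun x => (w x)%:E * (\1_(f @^-1` [set r]) x : R)%:E)%E.
  by apply: emeasurable_funM; apply/measurable_EFinP => //; exact: measurable_indic.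
under [RHS]eq_integral do rewrite EFinM muleCA.
have [r0|r0] := leP 0 r; last first.
  by rewrite !integral0_eq// => x _; rewrite preimage_nnfun0// indic0 ?mulr0 ?mule0.
rewrite [RHS]ge0_integralZl//; last by move=> x _; rewrite mule_ge0 ?lee_fin.
rewrite -density_indic//.
by under eq_integral do rewrite EFinM; rewrite ge0_integralZl//; apply/measurable_EFinP; exact: measurable_indic.
Qed.

Lemma integral_density (f : T -> \bar R) : measurable_fun setT f -> (forall x, (0 <= f x)%E) ->
  (\int[density_measure]_x f x = \int[mu]_x ((w x)%:E * f x))%E.
Proof.
move=> mf f0; pose f_ := nnsfun_approx measurableT mf.
transitivity (lim (\int[density_measure]_x (f_ n x)%:E @[n --> \oo])%E).
  rewrite -monotone_convergence//=.
  - apply: eq_integral => ? /[!inE] xD; apply/esym/cvg_lim => //=.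
    exact: cvg_nnsfun_approx.
  - by move=> n; exact/measurable_EFinP/measurable_funTS.
  - by move=> n ? _; rewrite lee_fin.
  - by move=> ? _ ? ? mn; rewrite lee_fin; exact/lefP/nd_nnsfun_approx.
under eq_fun do rewrite density_nnsfun.
rewrite -monotone_convergence//=.
- apply: eq_integral => x _; apply/cvg_lim => //.
  by apply: cvgeZl => //; exact: cvg_nnsfun_approx.
- by move=> n; apply: emeasurable_funM; exact/measurable_EFinP/measurable_funTS.
- by move=> n x _; rewrite mule_ge0 ?lee_fin.
- by move=> x _ m n mn; apply: lee_wpmul2l; rewrite lee_fin//; exact/lefP/nd_nnsfun_approx.
Qed.

Lemma integral_density_set D (f : T -> \bar R) : measurable D -> measurable_fun setT f ->
  (forall x, (0 <= f x)%E) ->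
  (\int[density_measure]_(x in D) f x = \int[mu]_(x in D) ((w x)%:E * f x))%E.
Proof.
move=> mD mf f0; rewrite [LHS]integral_mkcond [RHS]integral_mkcond integral_density.
- by apply: eq_integral => x _; rewrite !patchE; case: ifP => // _; rewrite mule0.
- by apply/(measurable_restrictT _ _).1 => //; exact: measurable_funTS.
- by move=> x; rewrite patchE; case: ifP.
Qed.

End density.

Section product_integrals.
Context d1 d2 (T1 : measurableType d1) (T2 : measurableType d2) (R : realType).
Context (m1 : {sigma_finite_measure set T1 -> \bar R}) (m2 : {sigma_finite_measure set T2 -> \bar R}).
Variables (A : set T1) (B : set T2) (F : T1 * T2 -> \bar R).
Hypotheses (mA : measurable A) (mB : measurable B) (mF : measurable_fun setT F) (F0 : forall p, (0 <= F p)%E).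

Let G := (F \_ (A `*` B))%E.

Let mG : measurable_fun setT G.
Proof. by apply/(measurable_restrictT _ _).1 => //; [exact: measurableX|exact: measurable_funTS]. Qed.

Let G0 p : (0 <= G p)%E. Proof. by rewrite /G patchE; case: ifP. Qed.

Let GE1 : (fun x => \int[m2]_y G (x, y))%E = (fun x => \int[m2]_(y in B) F (x, y))%E \_ A.
Proof.
apply/funext => x; rewrite patchE /G; case: ifPn => xA.
  rewrite [RHS]integral_mkcond; apply: eq_integral => y _; rewrite !patchE in_setX xA/=.
  by [].
by rewrite integral0_eq// => y _; rewrite patchE in_setX (negbTE xA).
Qed.

Let GE2 : (fun y => \int[m1]_x G (x, y))%E = (fun y => \int[m1]_(x in A) F (x, y))%E \_ B.
Proof.
apply/funext => y; rewrite patchE /G; case: ifPn => yB.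
  rewrite [RHS]integral_mkcond; apply: eq_integral => x _; rewrite !patchE in_setX yB andbT.
  by [].
by rewrite integral0_eq// => x _; rewrite patchE in_setX (negbTE yB) andbF.
Qed.

Lemma ge0_integral_setX1 :
  (\int[(m1 \x m2)]_(p in A `*` B) F p = \int[m1]_(x in A) \int[m2]_(y in B) F (x, y))%E.
Proof. by rewrite [LHS]integral_mkcond [LHS](fubini_tonelli1 G mG G0) [RHS]integral_mkcond -GE1. Qed.

Lemma ge0_integral_setX2 :
  (\int[(m1 \x m2)]_(p in A `*` B) F p = \int[m2]_(y in B) \int[m1]_(x in A) F (x, y))%E.
Proof. by rewrite [LHS]integral_mkcond [LHS](fubini_tonelli2 G mG G0) [RHS]integral_mkcond -GE2. Qed.

Lemma ge0_integral_exchange :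
  (\int[m1]_(x in A) \int[m2]_(y in B) F (x, y) = \int[m2]_(y in B) \int[m1]_(x in A) F (x, y))%E.
Proof. by rewrite -ge0_integral_setX1 ge0_integral_setX2. Qed.

Lemma measurable_integral_set1 : measurable_fun setT (fun x => (\int[m2]_(y in B) F (x, y))%E).
Proof.
rewrite (_ : (fun x => _) = fubini_F m2 (fun p => (F \_ (setT `*` B)) p)).
  apply: measurable_fun_fubini_tonelli_F => [|p]; last by rewrite patchE; case: ifP.
  by apply/(measurable_restrictT _ _).1 => //; [exact: measurableX|exact: measurable_funTS].
apply/funext => x; rewrite /fubini_F [LHS]integral_mkcond; apply: eq_integral => y _.
by rewrite !patchE in_setX in_setT.
Qed.

Lemma measurable_integral_set2 : measurable_fun setT (fun y => (\int[m1]_(x in A) F (x, y))%E).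
Proof.
rewrite (_ : (fun y => _) = fubini_G m1 (fun p => (F \_ (A `*` setT)) p)).
  apply: measurable_fun_fubini_tonelli_G => [|p]; last by rewrite patchE; case: ifP.
  by apply/(measurable_restrictT _ _).1 => //; [exact: measurableX|exact: measurable_funTS].
apply/funext => y; rewrite /fubini_G [LHS]integral_mkcond; apply: eq_integral => x _.
by rewrite !patchE in_setX in_setT andbT.
Qed.

End product_integrals.

Section circle.
Context {R : realType}.

Lemma circle_haar_circle : @circle_haar R circle = 1%E.
Proof.
rewrite /circle_haar /pushforward (_ : _ @^-1` _ = setT).
  by rewrite /mrestr setTI /= lebesgue_measure_itv/= lte_fin ltr01 oppr0 adde0.
by apply/seteqP; split=> // t _; exact: normc_cis.
Qed.

Let circle_haar_sigma_finite : sigma_finite setT (@circle_haar R).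
Proof.
exists (fun=> setT) => [|k]; first by rewrite bigcup_const.
split => //; rewrite /circle_haar /pushforward preimage_setT /mrestr setTI.
by rewrite lebesgue_measure_itv/= lte_fin ltr01 oppr0 adde0 ltry.
Qed.

HB.instance Definition _ := Measure_isSigmaFinite.Build _ _ _ (@circle_haar R) circle_haar_sigma_finite.

Lemma measurable_circle : measurable (@circle R).
Proof.
rewrite (_ : circle = setT `&` (@Normc.normc R) @^-1` [set 1]); last by rewrite setTI.
by apply: measurable_fun_normc => //; exact: measurable_id.
Qed.

Lemma integral_circle_cst (c : \bar R) : (\int[@circle_haar R]_(z in circle) c = c)%E.
Proof.
rewrite (integral_cst _ measurable_circle) -[RHS]mule1; congr (_ * _)%E.
exact: circle_haar_circle.
Qed.

End circle.

(* The library makes a product of measures sigma-finite only when both factors are finite. *)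
Section sigma_finite_prod.
Context d1 d2 (T1 : measurableType d1) (T2 : measurableType d2) (R : realType).
Context (m1 : {sigma_finite_measure set T1 -> \bar R}) (m2 : {sigma_finite_measure set T2 -> \bar R}).

Definition sigma_finite_prod : set (T1 * T2) -> \bar R := (m1 \x m2)%E.

HB.instance Definition _ := Measure.on sigma_finite_prod.

HB.instance Definition _ := Measure_isSigmaFinite.Build _ _ _ sigma_finite_prod (sigma_finite_product m1 m2).

End sigma_finite_prod.

Section as_sigma_finite.
Context d (T : measurableType d) (R : realType) (mu : {measure set T -> \bar R}).

(** Attaches a proof of sigma-finiteness to [mu] as an instance; the copy converts to [mu], so
    results about it are results about [mu]. *)
Definition as_sigma_finite (_ : sigma_finite setT mu) : set T -> \bar R := mu.

HB.instance Definition _ sf := Measure.copy (as_sigma_finite sf) mu.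

HB.instance Definition _ sf := Measure_isSigmaFinite.Build _ _ _ (as_sigma_finite sf) sf.

End as_sigma_finite.

Section left_haar.
Context {R : realType} {n : nat}.
Implicit Types (H : set 'M[R]_n) (V : {vspace 'cV[R]_n}).

Lemma measurable_closed_subgroup_GL H : closed_subgroup_GL H -> measurable H.
Proof.
move=> [_ _ [C cC ->]]; apply: measurableI; first exact: closed_measurable_mx.
apply: open_measurable_mx; rewrite (_ : GL = (fun h : 'M[R]_n => \det h) @^-1` [set x | x != 0]).
  by apply: open_comp => [h _|]; [exact: continuous_det|exact: open_neq].
by apply/funext => h; rewrite /GL/= unitmxE unitfE.
Qed.

(** Bounding the entries by k and |det| from below by 1 / (k + 1) keeps the pieces [K k] compact and
    inside GL, and they exhaust H. *)
Lemma left_haar_sigma_finite H (nu : {measure set 'M[R]_n -> \bar R}) :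
  closed_subgroup_GL H -> left_haar H nu -> sigma_finite setT nu.
Proof.
move=> cH [nuC _ nuK _]; have mH := measurable_closed_subgroup_GL cH.
have [_ _ [C cC HE]] := cH.
pose K (k : nat) : set 'M[R]_n := [set h : 'M[R]_n | forall i j, `|h i j| <= k%:R] `&` (C `&` [set h : 'M[R]_n | k.+1%:R^-1 <= `|\det h|]).
have cK k : compact (K k).
  apply: compact_closedI; first exact: compact_mx_box.
  apply: closedI => //.
  rewrite (_ : mkset _ = (fun h : 'M[R]_n => `|\det h|) @^-1` [set x | k.+1%:R^-1 <= x])//.
  apply: preimage_closed; last exact: closed_ge.
  by move=> h _; apply: continuous_comp; [exact: continuous_det|exact: norm_continuous].
have KH k : K k `<=` H.
  move=> h [_ [Ch hk]]; rewrite HE; split => //; rewrite /GL/= unitmxE unitfE -normr_gt0.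
  exact: lt_le_trans hk.
have mK k : measurable (K k).
  apply: closed_measurable_mx; apply: compact_closed => //; exact: norm_hausdorff.
(* The null complement of H is added to every piece in order to cover all matrices. *)
exists (fun k => K k `|` ~` H).
  apply/seteqP; split=> // h _; have [Hh|] := pselect (H h); last by exists 0%N => //; right.
  have [Ch hu] : C h /\ h \in unitmx by rewrite HE in Hh.
  have d0 := unitmx_normr_det_gt0 hu.
  (* Exceeds the sum of all |h i j|, hence each of them, and the inverse of |det h|. *)
  pose N := (Num.truncn (\sum_i \sum_j `|h i j|) + Num.truncn (`|\det h|^-1)).+1.
  have bd (x : R) m : (Num.truncn x < m)%N -> x <= m%:R.
    by move=> xm; apply/ltW/(lt_le_trans (truncnS_gt x)); rewrite ler_nat.
  exists N => //; left; split; [|split => //].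
    move=> i j; apply: (@le_trans _ _ (\sum_i \sum_j `|h i j|)); last first.
      by apply: bd; rewrite /N ltnS leq_addr.
    rewrite (bigD1 i)//= (bigD1 j)//= -addrA lerDl addr_ge0//; first exact: sumr_ge0.
    by apply: sumr_ge0 => k _; exact: sumr_ge0.
  rewrite /= invf_ple ?posrE//; apply: bd; rewrite /N.
  by rewrite ltnS leqW// leq_addl.
move=> k; split; first by apply: measurableU => //; exact: measurableC.
apply: (@le_lt_trans _ _ (nu (K k) + nu (~` H))%E).
  by apply: measureU2 => //; exact: measurableC.
by rewrite nuC adde0; apply: nuK.
Qed.

End left_haar.

Section group_measurability.
Context {R : realType} {n : nat}.
Implicit Types (H : set 'M[R]_n) (V : {vspace 'cV[R]_n}).

(** V is the set of vectors equal to the combination of their own coordinates in the basis of V, a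
    finite system of equations between measurable functions. *)
Lemma measurable_vspace V : measurable [set xi | xi \in V].
Proof.
have -> : [set xi | xi \in V] = \bigcap_(i in [set: 'I_n]) [set xi : 'cV[R]_n | vs_comb (vs_coord V xi) i 0 == xi i 0].
  apply/seteqP; split=> [xi xiV i _ /=|xi xiE /=].
    rewrite {2}(coord_vbasis xiV) /vs_comb !summxE.
    by apply/eqP; apply: eq_bigr => j _; rewrite !mxE.
  have -> : xi = vs_comb (vs_coord V xi) by apply/colP => i; apply/esym/eqP/(xiE i).
  by apply: memv_suml => i _; rewrite memvZ// vbasis_mem// mem_nth// size_tuple.
apply: fin_bigcap_measurable => [|i _]; first exact: finite_finset.
rewrite -[X in measurable X]setTI.
apply: (measurable_fun_eqr (f := fun xi : 'cV[R]_n => vs_comb (vs_coord V xi) i 0)) => //.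
- apply: (measurable_fun_entry (A := fun xi => vs_comb (vs_coord V xi))).
  by apply: measurableT_comp; [exact: measurable_vs_comb|exact: measurable_vs_coord].
- exact: measurable_entry.
Qed.

Lemma measurable_tc_set V H : closed_subgroup_GL H -> measurable (tc_set V H).
Proof.
move=> cH; apply: measurableX; last exact: measurable_closed_subgroup_GL.
apply: measurableX; last exact: measurable_vspace.
by apply: measurableX => //; exact: measurable_circle.
Qed.

Lemma measurable_fun_tr_restr d (T : measurableType d) V (h : T -> 'M[R]_n) :
  measurable_fun setT h -> measurable_fun setT (fun t => \det (tr_restr V (h t))).
Proof.
move=> mh; apply: measurable_fun_det; apply: measurable_fun_mx => i j.
rewrite (_ : (fun t => _) = fun t => vs_coord V ((h t)^T *m (vbasis V)`_j) i 0); last first.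
  by apply/funext => t; rewrite !mxE.
apply: measurable_fun_entry; apply: measurableT_comp; first exact: measurable_vs_coord.
by apply: measurable_fun_mulmx => //; exact: measurable_fun_trmx.
Qed.

Lemma measurable_wavelet_transform (psi f : 'cV[R]_n -> R[i]) :
  measurable_fun setT psi -> measurable_fun setT f -> measurable_fun setT (wavelet_transform psi f).
Proof.
move=> mpsi mf.
pose k (q : @awh_type R n * 'cV[R]_n) : R[i] := f q.2 * conjc (q.1.1.1.1 *
  (cis (dotp (q.2 - q.1.1.1.2) q.1.1.2) * ((`|\det q.1.2| `^ (- 2^-1))%:C%C * psi (invmx q.1.2 *m (q.2 - q.1.1.1.2))))).
rewrite (_ : wavelet_transform psi f = fun p => cint (lebesgue_cV n) (fun y => k (p, y))); last first.
  by apply/funext => -[[[z x] xi] h].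
apply: measurable_cint1.
have m1 : measurable_fun setT (fun q : @awh_type R n * 'cV[R]_n => q.1) by exact: measurable_fst.
have m11 := measurableT_comp measurable_fst m1.
have m111 := measurableT_comp measurable_fst m11.
have mz := measurableT_comp measurable_fst m111.
have mx := measurableT_comp measurable_snd m111.
have mxi := measurableT_comp measurable_snd m11.
have mh := measurableT_comp measurable_snd m1.
have my : measurable_fun setT (fun q : @awh_type R n * 'cV[R]_n => q.2) by exact: measurable_snd.
have myx := measurable_fun_submx my mx.
apply: measurable_funcM; first exact: measurableT_comp mf my.
apply: measurable_fun_conjc; apply: measurable_funcM => //.
apply: measurable_funcM; first by apply: measurable_fun_cis; exact: measurable_dotp.
apply: measurable_funcM.
  apply: measurable_fun_realc; apply: (measurableT_comp (@measurable_powR R _)).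
  by apply: measurableT_comp => //; exact: measurable_fun_det.
by apply: (measurableT_comp mpsi); apply: measurable_fun_mulmx => //; exact: measurable_fun_invmx.
Qed.

End group_measurability.

(** * Integration over the group *)

Section orthogonality.
Context {R : realType} {n : nat}.
Variables (V : {vspace 'cV[R]_n}) (H : set 'M[R]_n) (nu : {sigma_finite_measure set 'M[R]_n -> \bar R}).
Variables (psi f : 'cV[R]_n -> R[i]).
Hypotheses (cH : closed_subgroup_GL H) (L2psi : L2 psi) (L2f : L2 f).
Local Notation mu := (@lebesgue_cV R n).
Local Notation F := (plancherel f).
Local Notation G := (plancherel psi).

Let w (p : @awh_type R n) : R := `|\det (tr_restr V p.2)| / `|\det p.2|.

Let mw : measurable_fun setT w.
Proof.
apply: measurable_funM.
  by apply: measurableT_comp => //; apply: measurable_fun_tr_restr; exact: measurable_snd.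
apply: measurable_fun_inv; apply: measurableT_comp => //.
by apply: measurable_fun_det; exact: measurable_snd.
Qed.

Let w0 p : 0 <= w p. Proof. by rewrite divr_ge0. Qed.

Let g p := (Normc.normc (wavelet_transform psi f p) ^+ 2)%:E.

Let mg : measurable_fun setT g.
Proof. by apply: measurable_sqr_normc; apply: measurable_wavelet_transform; [exact: L2psi.1|exact: L2f.1]. Qed.

Let g0 p : (0 <= g p)%E. Proof. by rewrite lee_fin exprn_ge0 ?normc_ge0. Qed.

Lemma tc_sqnormE : tc_sqnorm V H nu (wavelet_transform psi f) =
  (\int[circle_haar \x mu \x lebesgue_vs V \x nu]_(p in tc_set V H) ((w p)%:E * g p))%E.
Proof. exact: (integral_density_set _ mw w0 (measurable_tc_set V cH) mg g0). Qed.

(** The integrand of the right-hand side, after the cancellation of |det h|. *)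
Let J (q : 'cV[R]_n * 'cV[R]_n * 'M[R]_n) : \bar R :=
  (Normc.normc (F q.1.1) ^+ 2 * (Normc.normc (G (q.2^T *m (q.1.1 - q.1.2))) ^+ 2 * `|\det (tr_restr V q.2)|))%:E.

Let mFt : measurable_fun setT F. Proof. exact: (plancherelP L2f).1.1. Qed.
Let mGt : measurable_fun setT G. Proof. exact: (plancherelP L2psi).1.1. Qed.

Let mJ : measurable_fun setT J.
Proof.
have m1 : measurable_fun setT (fun q : 'cV[R]_n * 'cV[R]_n * 'M[R]_n => q.1) by exact: measurable_fst.
have m11 := measurableT_comp measurable_fst m1.
have m12 := measurableT_comp measurable_snd m1.
have m2 : measurable_fun setT (fun q : 'cV[R]_n * 'cV[R]_n * 'M[R]_n => q.2) by exact: measurable_snd.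
apply/measurable_EFinP; apply: measurable_funM.
  by apply: measurable_funX; apply: measurable_fun_normc; exact: measurableT_comp mFt m11.
apply: measurable_funM.
  apply: measurable_funX; apply: measurable_fun_normc; apply: (measurableT_comp mGt).
  apply: measurable_fun_mulmx; first exact: measurable_fun_trmx.
  exact: measurable_fun_submx.
by apply: measurableT_comp => //; exact: measurable_fun_tr_restr.
Qed.

Let J0 q : (0 <= J q)%E.
Proof. by rewrite lee_fin !mulr_ge0 ?exprn_ge0 ?normc_ge0. Qed.

Let slice (z : R[i]) xi h : circle z -> H h ->
  (\int[mu]_x ((w (z, x, xi, h))%:E * g (z, x, xi, h)) = \int[mu]_omega J (omega, xi, h))%E.
Proof.
move=> z1 Hh; have hu : h \in unitmx by have [+ _ _] := cH; exact.
have d0 := unitmx_normr_det_gt0 hu.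
transitivity (\int[mu]_x ((`|\det (tr_restr V h)| / `|\det h|)%:E * g (z, x, xi, h)))%E; first by [].
rewrite ge0_integralZl; [| exact: measurableT | | by move=> x _; exact: g0 | by rewrite lee_fin divr_ge0]; last first.
  apply: (measurableT_comp mg).
  by do 2 (apply: measurable_fun_pair => //); exact: pair1_measurable.
rewrite (integral_wavelet_slice xi hu z1 L2psi L2f) -ge0_integralZl ?lee_fin//; last 2 first.
- apply/measurable_EFinP; apply: measurable_funM.
    by apply: measurable_funX; exact: measurable_fun_normc mFt.
  apply: measurable_funM => //; apply: measurable_funX; apply: measurable_fun_normc.
  exact: measurableT_comp mGt (@measurable_affine_cV _ _ h^T xi).
- by move=> x _; rewrite lee_fin !mulr_ge0 ?exprn_ge0 ?normc_ge0.
apply: eq_integral => om _; rewrite -EFinM; congr EFin; rewrite /w /=; field.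
by rewrite lt0r_neq0.
Qed.

Lemma tc_sqnorm_wavelet_transform : tc_sqnorm V H nu (wavelet_transform psi f) =
  (\int[mu]_omega ((Normc.normc (F omega) ^+ 2)%:E * Phi V H nu psi omega))%E.
Proof.
have mH := measurable_closed_subgroup_GL cH; have mV := measurable_vspace V.
have mC := @measurable_circle R.
rewrite tc_sqnormE /tc_set.
have mwg : measurable_fun setT (fun p => (w p)%:E * g p)%E by apply: emeasurable_funM => //; exact/measurable_EFinP.
have wg0 p : (0 <= (w p)%:E * g p)%E by apply: mule_ge0; [rewrite lee_fin|].
(* The variables h and xi are taken outside first: the slice formula integrates over x with all the
   others fixed, and requires h in H. *)
rewrite (ge0_integral_setX2 (sigma_finite_prod (sigma_finite_prod circle_haar mu) (lebesgue_vs V)) nu (measurableX (measurableX mC measurableT) mV) mH mwg wg0).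
transitivity (\int[nu]_(h in H) \int[lebesgue_vs V]_(xi in [set xi | xi \in V]) \int[mu]_omega J (omega, xi, h))%E.
  apply: eq_integral => h /[!inE] Hh.
  have mwg1 : measurable_fun setT (fun p => (w (p, h))%:E * g (p, h))%E.
    exact: (measurableT_comp mwg (pair2_measurable h)).
  rewrite (ge0_integral_setX2 (sigma_finite_prod circle_haar mu) (lebesgue_vs V) (measurableX mC measurableT) mV mwg1 (fun p => wg0 _)).
  apply: eq_integral => xi _.
  have mwg2 : measurable_fun setT (fun p => (w (p, xi, h))%:E * g (p, xi, h))%E.
    exact: (measurableT_comp mwg1 (pair2_measurable xi)).
  rewrite (ge0_integral_setX1 circle_haar mu mC measurableT mwg2 (fun p => wg0 _)).
  (* The slice integral is the same for every z on the circle, which has mass 1. *)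
  rewrite -[RHS]integral_circle_cst; apply: eq_integral => z /[!inE] Cz.
  exact: slice.
(* Three exchanges bring the order h, xi, omega to omega, xi, h, after which |f^(omega)|^2 leaves
   the inner integrals. *)
rewrite -(ge0_integral_exchange (lebesgue_vs V) nu mV mH (F := fun p => \int[mu]_omega J (omega, p.1, p.2)))%E; last 2 first.
- apply: (measurable_integral_set2 mu (A := setT) (F := fun q => J (q.1, q.2.1, q.2.2))) => //.
  apply: (measurableT_comp mJ); apply: measurable_fun_pair.
    apply: measurable_fun_pair => //.
    exact: measurableT_comp measurable_fst measurable_snd.
  exact: measurableT_comp measurable_snd measurable_snd.
- by move=> p; exact: integral_ge0.
transitivity (\int[lebesgue_vs V]_(xi in [set xi | xi \in V]) \int[mu]_omega \int[nu]_(h in H) J (omega, xi, h))%E.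
  apply: eq_integral => xi _.
  rewrite (ge0_integral_exchange mu nu measurableT mH (F := fun p => J (p.1, xi, p.2)))//.
  apply: (measurableT_comp mJ); apply: measurable_fun_pair => //.
  by apply: measurable_fun_pair.
have mJh : measurable_fun setT (fun p => \int[nu]_(h in H) J (p, h))%E by exact: measurable_integral_set1.
rewrite -(ge0_integral_exchange mu (lebesgue_vs V) measurableT mV mJh)//; last by move=> p; exact: integral_ge0.
apply: eq_integral => omega _.
pose K (p : 'cV[R]_n * 'M[R]_n) := (Normc.normc (G (p.2^T *m (omega - p.1))) ^+ 2 * `|\det (tr_restr V p.2)|)%:E.
have mK : measurable_fun setT K.
  apply/measurable_EFinP; apply: measurable_funM.
    apply: measurable_funX; apply: measurable_fun_normc; apply: (measurableT_comp mGt).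
    apply: measurable_fun_mulmx; first by apply: measurable_fun_trmx; exact: measurable_snd.
    by apply: measurable_fun_submx => //; exact: measurable_fst.
  by apply: measurableT_comp => //; apply: measurable_fun_tr_restr; exact: measurable_snd.
have K0 p : (0 <= K p)%E by rewrite lee_fin mulr_ge0 ?exprn_ge0 ?normc_ge0.
rewrite /Phi -ge0_integralZl ?lee_fin ?exprn_ge0 ?normc_ge0//; last 2 first.
- by apply: measurable_funTS; exact: (measurable_integral_set1 nu mH mK K0).
- by move=> xi _; apply: integral_ge0 => h _; exact: (K0 (xi, h)).
apply: eq_integral => xi _; rewrite -ge0_integralZl ?lee_fin ?exprn_ge0 ?normc_ge0//.
- by apply: measurable_funTS; exact: (measurableT_comp mK (pair1_measurable xi)).
- by move=> h _; exact: (K0 (xi, h)).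
Qed.

End orthogonality.

Local Open Scope ereal_scope.

Theorem proposition3p1 (R : realType) (n : nat)
    (V : {vspace 'cV[R]_n}) (H : set 'M[R]_n)
    (nu : {measure set 'M[R]_n -> \bar R})
    (psi f : 'cV[R]_n -> R[i]) :
  translation_complete V H -> left_haar H nu -> L2 psi -> L2 f ->
  tc_sqnorm V H nu (wavelet_transform psi f) =
    \int[lebesgue_cV n]_omega
      ((Normc.normc (plancherel f omega) ^+ 2)%:E *
       \int[lebesgue_vs V]_(xi in [set xi | xi \in V]) \int[nu]_(h in H)
         (Normc.normc (plancherel psi (h^T *m (omega - xi))) ^+ 2 *
          `|\det (tr_restr V h)|)%:E)
  /\
  tc_sqnorm V H nu (wavelet_transform psi f) =
    \int[lebesgue_cV n]_omega
      ((Normc.normc (plancherel f omega) ^+ 2)%:E * Phi V H nu psi omega).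
Proof.
move=> [cH _ _ _] hnu L2psi L2f.
have sf := left_haar_sigma_finite cH hnu.
by split; exact: (tc_sqnorm_wavelet_transform V (as_sigma_finite sf) cH L2psi L2f).
Qed.
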